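(* Let $\mathbf G\to\mathbf H$ be a crossed module of Lie groups. A Morita equivalence between two Lie groupoids $B\rightrightarrows B_0$ and $B'\rightrightarrows B'_0$ induces a one to one correspondence between: (1) $\mathbf G\to\mathbf H$-gerbes over $B\rightrightarrows B_0$; (2) $\mathbf G\to\mathbf H$-gerbes over $B'\rightrightarrows B'_0$.
   Context: Crossed module of Lie groups: $(\mathbf G,\mathbf H,\rho,\jmath)$ with $\mathbf G,\mathbf H$ finite dimensional Lie groups and Lie group morphisms $\rho:\mathbf G\to\mathbf H$, $\jmath:\mathbf H\to\mathrm{Aut}(\mathbf G)$ such that, writing $h(g):=\jmath(h)(g)$, one has $\rho(h(g))=h\rho(g)h^{-1}$ and $\rho(g)(g')=gg'g^{-1}$. Lie groupoids $\Gamma\rightrightarrows M$ have source $s$, target $t$, unit $\epsilon$; the product $x\bullet x'$ is defined when $t(x)=s(x')$. A left action of $\Gamma\rightrightarrows M$ on $\pi:P\to M$: $\gamma\cdot p$ is defined when $t(\gamma)=\pi(p)$, with $\pi(\gamma\cdot p)=s(\gamma)$ and the usual axioms. An $\mathbf H$-principal bundle over $\Gamma\rightrightarrows M$ is a right $\mathbf H$-principal bundle $P\to M$ with a left $\Gamma$-action commuting with the $\mathbf H$-action. Pull-backs: for a surjective submersion $p:M'\to M$, $\Gamma[p]=M'\times_{p,M,s}\Gamma\times_{t,M,p}M'\rightrightarrows M'$ with $(x,\gamma,y)\bullet(y,\gamma',z)=(x,\gamma\gamma',z)$, functorially in $\Gamma$. A Morita equivalence between Lie groupoids $B\rightrightarrows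 B_0$ and $B'\rightrightarrows B_0'$ is $(T,f,g,\Phi)$ with $T$ a manifold, $f:T\to B_0$, $g:T\to B'_0$ surjective submersions and $\Phi:B[f]\to B'[g]$ a Lie groupoid isomorphism over $\mathrm{id}_T$. Lie groupoid extension: a Lie groupoid morphism $\varphi:\mathcal R\to\mathcal G$ over the identity of a common base $M$ that is a surjective submersion. Its kernel is $K=\varphi^{-1}(\epsilon(M))$; it is a $\mathbf G$-extension if $K$ is a locally trivial bundle of groups with typical fibre $\mathbf G$. The band is $Band(\mathcal R\to\mathcal G)=\coprod_{m\in M}\mathrm{Isom}(\mathbf G,K_m)$, an $\mathrm{Aut}(\mathbf G)$-principal bundle over $M$ (right action by precomposition) and over $\mathcal R\rightrightarrows M$ through $(r\cdot b)(g)=r\,b(g)\,r^{-1}$. A $\mathbf G\to\mathbf H$-extension of $\mathcal G\rightrightarrows M$ is a triple $(\mathcal R\to\mathcal G,P\to M,\chi)$ with $\mathcal R\to\mathcal G$ a $\mathbf G$-extension, $P\to M$ an $\mathbf H$-principal bundle over $\mathcal R\rightrightarrows M$, and $\chi:P\to Band(\mathcal R\to\mathcal G)$ a smooth map over $\mathrm{id}_M$ with $\chi(r\cdot p\cdot h)=r\cdot\chi(p)\cdot\jmath(h)$, such that $p\cdot\rho(g)=\chi(p)(g)\cdot p$ for all $p\in P,g\in\mathbf G$. An isomorphism between two such, $(\mathcal R\stackrel{\varphi}{\to}\mathcal G,P,\chi)$ and $(\mathcal R'\stackrel{\varphi'}{\to}\mathcal G,P',\chi')$, is a pair $(\Phi,\Psi)$,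 $\Phi:\mathcal R\to\mathcal R'$ a Lie groupoid isomorphism with $\varphi'\circ\Phi=\varphi$, $\Psi:P\to P'$ a diffeomorphism over $\mathrm{id}_M$ with $\Psi(r\cdot p\cdot h)=\Phi(r)\cdot\Psi(p)\cdot h$, such that $\chi'\circ\Psi=\overline\Phi\circ\chi$, where $\overline\Phi(\eta)(g)=\Phi(\eta(g))$. The pull-back of $(\mathcal R\stackrel{\phi}{\to}\mathcal G,P,\chi)$ by a surjective submersion $p:M'\to M$ is $(\mathcal R[p]\stackrel{\phi[p]}{\to}\mathcal G[p],\,p^*P=P\times_MM',\,\chi[p])$, with action $(n,r,n')\cdot(x,n')=(r\cdot x,n)$ and $\chi[p](x,n)=(\chi(x),n)$, using the canonical identification of the band of the pull-back with the pull-back of the band. A $\mathbf G\to\mathbf H$-extension over $B\rightrightarrows B_0$ is $(q,\mathcal R\to B[q],P\to M,\chi)$ with $q:M\to B_0$ a surjective submersion and $(\mathcal R\to B[q],P\to M,\chi)$ a $\mathbf G\to\mathbf H$-extension of $B[q]\rightrightarrows M$. Two such (with $q:M\to B_0$, $q':M'\to B_0$) are Morita equivalent if there are a manifold $M''$ and surjective submersions $p:M''\to M$, $p':M''\to M'$ with $q\circ p=q'\circ p'$ such that the pull-backs by $p$ and $p'$ are isomorphic as $\mathbf G\to\mathbf H$-extensions of $B[q\circ p]=B[q'\circ p']$. A $\mathbf G\to\mathbf H$-gerbe over $B\rightrightarrows B_0$ is a Morita equivalence class of $\mathbf G\to\mathbf H$-extensions over $B\rightrightarrows B_0$. *)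

(* Defs.v *)
From HB Require Import structures.
From mathcomp Require Import all_boot all_order all_algebra.
From mathcomp Require Import all_classical all_reals all_analysis.
Import numFieldNormedType.Exports.

Set Implicit Arguments.
Unset Strict Implicit.
Unset Printing Implicit Defensive.

Local Open Scope classical_set_scope.
Local Open Scope ring_scope.

(* Smooth manifolds are encoded as diffeological spaces that are locally
   Euclidean, Hausdorff and second countable.  Manifolds embed fully faithfully
   in diffeological spaces (the plots of a manifold being the smooth maps from
   open subsets of R^n), and the subspace and product diffeologies of a fibre
   product along a submersion, or of an embedded submanifold, are those of its
   manifold structure.  Hence pull-back groupoids, kernels and pulled back
   bundles carry their usual smooth structure by construction. *)

Section Euclidean.
Variable R : realType.

Fixpoint Ck (k : nat) (m n : nat) (U : set 'rV[R]_m) (f : 'rV[R]_m -> 'rV[R]_n)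
    : Prop :=
  if k is k'.+1 then
    (forall x, U x -> differentiable f x) /\
    (forall v, Ck k' U (fun x => 'd f x v))
  else forall x, U x -> {for x, continuous f}.

Definition Cinfty (m n : nat) (U : set 'rV[R]_m) (f : 'rV[R]_m -> 'rV[R]_n) :=
  forall k, Ck k U f.

End Euclidean.

(* [plot U p] only concerns the restriction of [p] to the open set [U]. *)
HB.mixin Record isDiffeological (R : realType) (T : Type) := {
  plot : forall n, set 'rV[R]_n -> ('rV[R]_n -> T) -> Prop;
  plot_open : forall n (U : set 'rV[R]_n) p, plot _ U p -> open U;
  plot_ext : forall n (U : set 'rV[R]_n) p p',
    (forall u, U u -> p u = p' u) -> plot _ U p -> plot _ U p';
  plot_const : forall n (U : set 'rV[R]_n) x, open U -> plot _ U (fun=> x);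
  plot_local : forall n (U : set 'rV[R]_n) p, open U ->
    (forall u, U u -> exists V, [/\ V u, V `<=` U & plot _ V p]) -> plot _ U p;
  plot_comp : forall m n (V : set 'rV[R]_m) (U : set 'rV[R]_n) f p,
    open V -> Cinfty V f -> (forall v, V v -> U (f v)) ->
    plot _ U p -> plot _ V (p \o f)
}.

#[short(type="diffType")]
HB.structure Definition Diffeological (R : realType) :=
  {T of isDiffeological R T}.

Arguments plot {R s n} U p.
Arguments plot_open {R s n U p}.
Arguments plot_ext {R s n U p p'}.
Arguments plot_const {R s n U} x.
Arguments plot_local {R s n U p}.
Arguments plot_comp {R s m n V U f p}.

Section ProductSpace.
Variables (R : realType) (X Y : diffType R).

Let pplot n (U : set 'rV[R]_n) (p : 'rV[R]_n -> X * Y) :=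
  plot U (fst \o p) /\ plot U (snd \o p).

Let pplot_open n (U : set 'rV[R]_n) p : pplot U p -> open U.
Proof. by case=> /plot_open. Qed.

Let pplot_ext n (U : set 'rV[R]_n) p p' :
  (forall u, U u -> p u = p' u) -> pplot U p -> pplot U p'.
Proof.
by move=> e [h1 h2]; split; [apply: plot_ext h1|apply: plot_ext h2];
  move=> u Uu /=; rewrite e.
Qed.

Let pplot_const n (U : set 'rV[R]_n) x : open U -> pplot U (fun=> x).
Proof. by move=> oU; split; exact: plot_const. Qed.

Let pplot_local n (U : set 'rV[R]_n) p : open U ->
  (forall u, U u -> exists V, [/\ V u, V `<=` U & pplot V p]) -> pplot U p.
Proof.
move=> oU h; split; apply: plot_local => // u /h[V [Vu VU [h1 h2]]];
  by exists V.
Qed.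

Let pplot_comp m n (V : set 'rV[R]_m) (U : set 'rV[R]_n) f p :
  open V -> Cinfty V f -> (forall v, V v -> U (f v)) ->
  pplot U p -> pplot V (p \o f).
Proof.
by move=> oV sf fU [h1 h2]; split;
  [exact: (plot_comp oV sf fU h1)|exact: (plot_comp oV sf fU h2)].
Qed.

HB.instance Definition _ := isDiffeological.Build R (X * Y)%type
  pplot_open pplot_ext pplot_const pplot_local pplot_comp.

End ProductSpace.

Section Subspace.
Variables (R : realType) (X : diffType R) (A : X -> Prop).

Let splot n (U : set 'rV[R]_n) (p : 'rV[R]_n -> sig A) :=
  plot U (fun u => sval (p u)).

Let splot_open n (U : set 'rV[R]_n) p : splot U p -> open U.
Proof. exact: plot_open. Qed.

Let splot_ext n (U : set 'rV[R]_n) p p' :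
  (forall u, U u -> p u = p' u) -> splot U p -> splot U p'.
Proof. by move=> e; apply: plot_ext => u Uu; rewrite e. Qed.

Let splot_const n (U : set 'rV[R]_n) x : open U -> splot U (fun=> x).
Proof. exact: plot_const. Qed.

Let splot_local n (U : set 'rV[R]_n) p : open U ->
  (forall u, U u -> exists V, [/\ V u, V `<=` U & splot V p]) -> splot U p.
Proof. exact: plot_local. Qed.

Let splot_comp m n (V : set 'rV[R]_m) (U : set 'rV[R]_n) f p :
  open V -> Cinfty V f -> (forall v, V v -> U (f v)) ->
  splot U p -> splot V (p \o f).
Proof. exact: plot_comp. Qed.

HB.instance Definition _ := isDiffeological.Build R (sig A)
  splot_open splot_ext splot_const splot_local splot_comp.

End Subspace.

Section DTopology.
Variables (R : realType) (X : diffType R).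

Definition dopen (A : set X) : Prop :=
  forall n (U : set 'rV[R]_n) (p : 'rV[R]_n -> X),
    plot U p -> open (U `&` p @^-1` A).

Definition dtop : Type := X.

HB.instance Definition _ := gen_eqMixin dtop.
HB.instance Definition _ := gen_choiceMixin dtop.

Let dopenT : dopen setT.
Proof. by move=> n U p /plot_open; rewrite preimage_setT setIT. Qed.

Let dopenI : setI_closed dopen.
Proof.
move=> A B oA oB n U p pU; rewrite preimage_setI -{1}(setIid U) setIACA.
by apply: openI; [exact: oA|exact: oB].
Qed.

Let dopen_bigU (I : Type) (f : I -> set X) :
  (forall i, dopen (f i)) -> dopen (\bigcup_i f i).
Proof.
move=> of_ n U p pU; rewrite preimage_bigcup setI_bigcupr.
by apply: bigcup_open => i _; exact: of_.
Qed.

HB.instance Definition _ :=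
  isOpenTopological.Build dtop dopenT dopenI dopen_bigU.

End DTopology.

Arguments dtop {R} X.

Section Manifolds.
Variable R : realType.

Definition smooth (X Y : diffType R) (f : X -> Y) : Prop :=
  forall n (U : set 'rV[R]_n) (p : 'rV[R]_n -> X), plot U p -> plot U (f \o p).

Definition diffeo (X Y : diffType R) (f : X -> Y) : Prop :=
  smooth f /\ exists g : Y -> X, [/\ smooth g, cancel f g & cancel g f].

(* [phi] restricts to a diffeomorphism from the open subset [U] of R^n onto a
   D-open subset of [X], whose inverse is the restriction of [psi]. *)
Record is_chart (X : diffType R) n (U : set 'rV[R]_n)
    (phi : 'rV[R]_n -> X) (psi : X -> 'rV[R]_n) : Prop := IsChart {
  chart_open : dopen (phi @` U);
  chart_plot : plot U phi;
  chart_cancel : forall u, U u -> psi (phi u) = u;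
  chart_inv : forall m (V : set 'rV[R]_m) (p : 'rV[R]_m -> X),
    plot V p -> (forall v, V v -> (phi @` U) (p v)) -> Cinfty V (psi \o p)
}.

(* The dimension is only required to be locally constant. *)
Record manifold (X : diffType R) : Prop := Manifold {
  manifold_chart : forall x : X, exists n (U : set 'rV[R]_n) phi psi,
    is_chart U phi psi /\ (phi @` U) x;
  manifold_hausdorff : hausdorff_space (dtop X);
  manifold_countable : @second_countable (dtop X)
}.

(* The differential is surjective, read in charts. *)
Definition submersive_at (X Y : diffType R) (f : X -> Y) (x : X) : Prop :=
  exists m (U : set 'rV[R]_m) (phi : 'rV[R]_m -> X) (psi : X -> 'rV[R]_m)
         n (V : set 'rV[R]_n) (phi' : 'rV[R]_n -> Y) (psi' : Y -> 'rV[R]_n),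
    [/\ is_chart U phi psi, (phi @` U) x,
        is_chart V phi' psi', (phi' @` V) (f x) &
        forall w : 'rV[R]_n, exists v : 'rV[R]_m,
          'd (psi' \o f \o phi) (psi x) v = w].

Record surj_submersion (X Y : diffType R) (f : X -> Y) : Prop := SurjSubm {
  surj_subm_smooth : smooth f;
  surj_subm_submersive : forall x, submersive_at f x;
  surj_subm_surj : forall y, exists x, f x = y
}.

End Manifolds.

HB.mixin Record isLieGroup (R : realType) (G : Type)
    of Group G & Diffeological R G := {
  lie_manifold : manifold (G : diffType R);
  smooth_mulg : smooth (fun xy : G * G => (xy.1 * xy.2)%g);
  smooth_invg : smooth (fun x : G => x^-1%g)
}.

#[short(type="lieGroupType")]
HB.structure Definition LieGroup (R : realType) :=
  {G of Group G & Diffeological R G & isLieGroup R G}.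

(* [cm_act h g] is h(g) = j(h)(g).  A map into Aut(G), such as j, is smooth
   when its adjoint is. *)
Record crossedModule (R : realType) := CrossedModule {
  cmG : lieGroupType R;
  cmH : lieGroupType R;
  cm_rho : cmG -> cmH;
  cm_act : cmH -> cmG -> cmG;
  cm_rho_smooth : smooth cm_rho;
  cm_rhoM : forall g g', cm_rho (g * g')%g = (cm_rho g * cm_rho g')%g;
  cm_act_smooth : smooth (fun hg : cmH * cmG => cm_act hg.1 hg.2);
  cm_actMr : forall h g g', cm_act h (g * g')%g = (cm_act h g * cm_act h g')%g;
  cm_act1 : forall g, cm_act 1%g g = g;
  cm_actM : forall h h' g, cm_act (h * h')%g g = cm_act h (cm_act h' g);
  cm_rho_act : forall h g, cm_rho (cm_act h g) = (h * cm_rho g * h^-1)%g;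
  cm_act_rho : forall g g', cm_act (cm_rho g) g' = (g * g' * g^-1)%g
}.

Section Groupoids.
Variable R : realType.

Record groupoid (M : diffType R) := Groupoid {
  arr :> diffType R;
  src : arr -> M;
  tgt : arr -> M;
  idm : M -> arr;
  comp : forall x y, tgt x = src y -> arr;
  inv : arr -> arr;
  src_idm : forall m, src (idm m) = m;
  tgt_idm : forall m, tgt (idm m) = m;
  src_comp : forall x y (e : tgt x = src y), src (comp e) = src x;
  tgt_comp : forall x y (e : tgt x = src y), tgt (comp e) = tgt y;
  src_inv : forall x, src (inv x) = tgt x;
  tgt_inv : forall x, tgt (inv x) = src x;
  comp_idl : forall x (e : tgt (idm (src x)) = src x), comp e = x;
  comp_idr : forall x (e : tgt x = src (idm (tgt x))), comp e = x;
  comp_invr : forall x (e : tgt x = src (inv x)), comp e = idm (src x);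
  comp_invl : forall x (e : tgt (inv x) = src x), comp e = idm (tgt x);
  compA : forall x y z (exy : tgt x = src y) (eyz : tgt y = src z)
    (e1 : tgt x = src (comp eyz)) (e2 : tgt (comp exy) = src z),
    comp e1 = comp e2
}.

Record lie_groupoid (M : diffType R) (Q : groupoid M) : Prop := LieGroupoid {
  lieg_base : manifold M;
  lieg_arr : manifold Q;
  lieg_src : surj_submersion (@src M Q);
  lieg_tgt : surj_submersion (@tgt M Q);
  lieg_idm : smooth (@idm M Q);
  lieg_inv : smooth (@inv M Q);
  lieg_comp :
    smooth (fun z : {xy : Q * Q | tgt xy.1 = src xy.2} => comp (svalP z))
}.

(* [composes x y z]: the product of x and y is defined and equal to z. *)
Definition composes (M : diffType R) (Q : groupoid M) (x y z : Q) : Prop :=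
  exists e : tgt x = src y, comp e = z.

(* [conjugates r k k']: the product r k r^-1 is defined and equal to k'. *)
Definition conjugates (M : diffType R) (Q : groupoid M) (r k k' : Q) : Prop :=
  exists2 rk : Q, composes r k rk & composes rk (inv r) k'.

(* Groupoid morphisms over the identity of the base. *)
Record gmor (M : diffType R) (Q Q' : groupoid M) := Gmor {
  gmor_fun :> Q -> Q';
  gmor_src : forall x, src (gmor_fun x) = src x;
  gmor_tgt : forall x, tgt (gmor_fun x) = tgt x;
  gmor_comp : forall x y (e : tgt x = src y)
    (e' : tgt (gmor_fun x) = src (gmor_fun y)), gmor_fun (comp e) = comp e'
}.

Lemma sig_eq (T : Type) (A : T -> Prop) (a b : sig A) : sval a = sval b -> a = b.
Proof.
case: a b => a ha [b hb] /= ab; case: b / ab hb => hb.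
by rewrite (Prop_irrelevance ha hb).
Qed.

Lemma comp_congr (M : diffType R) (Q : groupoid M) (x y x' y' : Q)
    (e : tgt x = src y) (e' : tgt x' = src y') :
  x = x' -> y = y' -> comp e = comp e'.
Proof.
by move=> xx' yy'; case: x' / xx' e' => e'; case: y' / yy' e' => e';
  rewrite (Prop_irrelevance e e').
Qed.

Lemma comp_idl_eq (M : diffType R) (Q : groupoid M) (x y : Q)
    (e : tgt x = src y) : x = idm Q (src y) -> comp e = y.
Proof. by move=> h; subst x; exact: comp_idl. Qed.

Lemma comp_idr_eq (M : diffType R) (Q : groupoid M) (x y : Q)
    (e : tgt x = src y) : y = idm Q (tgt x) -> comp e = x.
Proof. by move=> h; subst y; exact: comp_idr. Qed.

Section Pullback.
Variables (M M' : diffType R) (p : M' -> M).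

Section PullbackGroupoid.
Variable Q : groupoid M.

Definition pb_arr : diffType R :=
  {z : M' * Q * M' | p z.1.1 = src z.1.2 /\ tgt z.1.2 = p z.2}.

Let pb_src (z : pb_arr) : M' := (sval z).1.1.
Let pb_tgt (z : pb_arr) : M' := (sval z).2.

Definition pb_idm (m : M') : pb_arr :=
  exist _ (m, idm Q (p m), m)
    (conj (esym (src_idm Q (p m))) (tgt_idm Q (p m))).

Lemma pb_composable (x y : pb_arr) : pb_tgt x = pb_src y ->
  tgt (sval x).1.2 = src (sval y).1.2.
Proof. by move=> e; rewrite (svalP x).2 -(svalP y).1; congr p. Qed.

Lemma pb_compP (x y : pb_arr) (e : pb_tgt x = pb_src y) :
  p (sval x).1.1 = src (comp (pb_composable e)) /\
  tgt (comp (pb_composable e)) = p (sval y).2.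
Proof.
by rewrite src_comp tgt_comp; split; [exact: (svalP x).1|exact: (svalP y).2].
Qed.

Definition pb_comp (x y : pb_arr) (e : pb_tgt x = pb_src y) : pb_arr :=
  exist _ ((sval x).1.1, comp (pb_composable e), (sval y).2) (pb_compP e).

Lemma pb_invP (x : pb_arr) :
  p (sval x).2 = src (inv (sval x).1.2) /\ tgt (inv (sval x).1.2) = p (sval x).1.1.
Proof. by rewrite src_inv tgt_inv; case: (svalP x) => -> ->. Qed.

Definition pb_inv (x : pb_arr) : pb_arr :=
  exist _ ((sval x).2, inv (sval x).1.2, (sval x).1.1) (pb_invP x).

Lemma pb_comp_idl (x : pb_arr) (e : pb_tgt (pb_idm (pb_src x)) = pb_src x) :
  pb_comp e = x.
Proof.
apply: sig_eq; rewrite /= (comp_idl_eq (pb_composable e)).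
  by rewrite /pb_src; case: (sval x) => [[]].
by rewrite /= -(svalP x).1.
Qed.

Lemma pb_comp_idr (x : pb_arr) (e : pb_tgt x = pb_src (pb_idm (pb_tgt x))) :
  pb_comp e = x.
Proof.
apply: sig_eq; rewrite /= (comp_idr_eq (pb_composable e)).
  by rewrite /pb_tgt; case: (sval x) => [[]].
by rewrite /= (svalP x).2.
Qed.

Lemma pb_comp_invr (x : pb_arr) (e : pb_tgt x = pb_src (pb_inv x)) :
  pb_comp e = pb_idm (pb_src x).
Proof.
apply: sig_eq => /=; congr (_, _, _).
by rewrite /pb_src (svalP x).1; exact: comp_invr.
Qed.

Lemma pb_comp_invl (x : pb_arr) (e : pb_tgt (pb_inv x) = pb_src x) :
  pb_comp e = pb_idm (pb_tgt x).
Proof.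
apply: sig_eq => /=; congr (_, _, _).
by rewrite /pb_tgt -(svalP x).2; exact: comp_invl.
Qed.

Lemma pb_compA (x y z : pb_arr) (exy : pb_tgt x = pb_src y)
    (eyz : pb_tgt y = pb_src z)
    (e1 : pb_tgt x = pb_src (pb_comp eyz))
    (e2 : pb_tgt (pb_comp exy) = pb_src z) : pb_comp e1 = pb_comp e2.
Proof. by apply: sig_eq => /=; congr (_, _, _); exact: compA. Qed.

Definition pullback : groupoid M' :=
  @Groupoid M' pb_arr pb_src pb_tgt pb_idm pb_comp pb_inv
    (fun=> erefl) (fun=> erefl) (fun _ _ _ => erefl) (fun _ _ _ => erefl)
    (fun=> erefl) (fun=> erefl)
    pb_comp_idl pb_comp_idr pb_comp_invr pb_comp_invl pb_compA.

End PullbackGroupoid.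

Section PullbackMorphism.
Variables (Q Q' : groupoid M) (f : gmor Q Q').

Lemma pb_mor_subproof (z : pullback Q) :
  p (sval z).1.1 = src (f (sval z).1.2) /\ tgt (f (sval z).1.2) = p (sval z).2.
Proof. by rewrite gmor_src gmor_tgt; exact: (svalP z). Qed.

Definition pb_mor_fun (z : pullback Q) : pullback Q' :=
  exist _ ((sval z).1.1, f (sval z).1.2, (sval z).2) (pb_mor_subproof z).

Lemma pb_mor_comp (x y : pullback Q) (e : tgt x = src y)
    (e' : tgt (pb_mor_fun x) = src (pb_mor_fun y)) :
  pb_mor_fun (comp e) = comp e'.
Proof. by apply: sig_eq => /=; congr (_, _, _); exact: gmor_comp. Qed.

Definition pullback_mor : gmor (pullback Q) (pullback Q') :=
  @Gmor M' (pullback Q) (pullback Q') pb_mor_fun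
    (fun=> erefl) (fun=> erefl) pb_mor_comp.

End PullbackMorphism.
End Pullback.

Definition gmor_then (M : diffType R) (Q Q' Q'' : groupoid M)
    (f : gmor Q Q') (g : gmor Q' Q'') : gmor Q Q''.
Proof.
refine (@Gmor M Q Q'' (fun x => g (f x)) _ _ _).
- by move=> x; rewrite !gmor_src.
- by move=> x; rewrite !gmor_tgt.
- move=> x y e e'.
  have e1 : tgt (f x) = src (f y) by rewrite gmor_tgt gmor_src.
  by rewrite (gmor_comp e e1); exact: gmor_comp.
Defined.

(* The canonical isomorphism B[q][p] -> B[q \o p],
   (n, (p n, b, p n'), n') |-> (n, b, n'). *)
Section Flatten.
Variables (B0 M M' : diffType R) (B : groupoid B0).
Variables (q : M -> B0) (p : M' -> M) (h : M' -> B0).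
Hypothesis hE : forall n, h n = q (p n).

Lemma flatten_subproof (z : pullback p (pullback q B)) :
  h (sval z).1.1 = src (sval (sval z).1.2).1.2 /\
  tgt (sval (sval z).1.2).1.2 = h (sval z).2.
Proof.
have [e1 e2] := svalP z; have [e3 e4] := svalP (sval z).1.2.
by split; rewrite hE; [rewrite e1 -e3|rewrite -e2 e4].
Qed.

Definition flatten_fun (z : pullback p (pullback q B)) : pullback h B :=
  exist _ ((sval z).1.1, (sval (sval z).1.2).1.2, (sval z).2)
    (flatten_subproof z).

Lemma flatten_comp (x y : pullback p (pullback q B)) (e : tgt x = src y)
    (e' : tgt (flatten_fun x) = src (flatten_fun y)) :
  flatten_fun (comp e) = comp e'.
Proof. by apply: sig_eq => /=; congr (_, _, _); exact: comp_congr. Qed.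

Definition flatten_mor : gmor (pullback p (pullback q B)) (pullback h B) :=
  @Gmor M' (pullback p (pullback q B)) (pullback h B) flatten_fun
    (fun=> erefl) (fun=> erefl) flatten_comp.

End Flatten.

End Groupoids.

Section Extensions.
Variables (R : realType) (X : crossedModule R).
Local Notation G := (cmG X).
Local Notation H := (cmH X).

Section Kernel.
Variables (M : diffType R) (S Q : groupoid M) (phi : gmor S Q).

Definition kernel : set S := [set r | exists m, phi r = idm Q m].

Definition kernel_at (m : M) : set S := [set r | kernel r /\ src r = m].

(* Elements of the band over m are Lie group isomorphisms from G onto K_m,
   viewed as maps from G to the arrows of S. *)
Definition Band : set (M * (G -> S)) := [set mb |
  (exists2 b : G -> {r : S | kernel_at mb.1 r},
     diffeo b & forall g, mb.2 g = sval (b g)) /\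
  (forall g g', composes (mb.2 g) (mb.2 g') (mb.2 (g * g')%g))].

Definition locally_trivial_kernel : Prop := forall m : M,
  exists U : set M, [/\ dopen U, U m &
    exists tau : {x : M | U x} * G -> {r : S | kernel r /\ U (src r)},
      [/\ diffeo tau,
          forall u g, src (sval (tau (u, g))) = sval u &
          forall u g g', composes (sval (tau (u, g))) (sval (tau (u, g')))
                                  (sval (tau (u, g * g')%g))]].

Record G_extension : Prop := GExtension {
  gext_lie : lie_groupoid S;
  gext_subm : surj_submersion phi;
  gext_kernel : locally_trivial_kernel
}.

End Kernel.

Record principal_bundle (M P : diffType R) (proj : P -> M)
    (ract : P -> H -> P) : Prop := PrincipalBundle {
  prin_manifold : manifold P;
  prin_proj : smooth proj;
  prin_proj_ract : forall x h, proj (ract x h) = proj x;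
  prin_ract1 : forall x, ract x 1%g = x;
  prin_ractM : forall x h h', ract x (h * h')%g = ract (ract x h) h';
  prin_ract_smooth : smooth (fun xh : P * H => ract xh.1 xh.2);
  prin_trivial : forall m : M, exists U : set M, [/\ dopen U, U m &
    exists tau : {x : M | U x} * H -> {x : P | U (proj x)},
      [/\ diffeo tau,
          forall u h, proj (sval (tau (u, h))) = sval u &
          forall u h h', sval (tau (u, h * h')%g) = ract (sval (tau (u, h))) h']]
}.

Section ExtensionData.
Variables (M : diffType R) (Q : groupoid M).

(* The data of a (G -> H)-extension of Q; the axioms are in [extension] below.
   [ext_chi x] is the underlying map of the band element chi(x), which lies
   over [ext_proj x]. *)
Record ext_data := ExtData {
  ext_grpd : groupoid M;
  ext_mor : gmor ext_grpd Q;
  ext_bun : diffType R;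
  ext_proj : ext_bun -> M;
  ext_lact : forall (r : ext_grpd) (x : ext_bun), tgt r = ext_proj x -> ext_bun;
  ext_ract : ext_bun -> H -> ext_bun;
  ext_chi : ext_bun -> G -> ext_grpd;
  ext_proj_lact : forall r x (e : tgt r = ext_proj x),
    ext_proj (ext_lact e) = src r;
  ext_proj_ract : forall x h, ext_proj (ext_ract x h) = ext_proj x;
  ext_src_chi : forall x g, src (ext_chi x g) = ext_proj x;
  ext_tgt_chi : forall x g, tgt (ext_chi x g) = ext_proj x
}.

(* [Q] is meant to be a Lie groupoid, which is automatic for B[q]. *)
Record extension (E : ext_data) : Prop := Extension {
  extn_G : G_extension (ext_mor E);
  extn_bundle : principal_bundle (@ext_proj E) (@ext_ract E);
  extn_lact1 : forall x (e : tgt (idm _ (ext_proj x)) = ext_proj x),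
    @ext_lact E _ x e = x;
  extn_lactM : forall (r r' : ext_grpd E) x (err' : tgt r = src r')
    (e' : tgt r' = ext_proj x) (e1 : tgt (comp err') = ext_proj x)
    (e2 : tgt r = ext_proj (ext_lact e')),
    ext_lact e1 = ext_lact e2;
  extn_lact_smooth :
    smooth (fun z : {rx : ext_grpd E * ext_bun E | tgt rx.1 = ext_proj rx.2} =>
      ext_lact (svalP z));
  extn_lact_ract : forall (r : ext_grpd E) x h (e : tgt r = ext_proj x)
    (e' : tgt r = ext_proj (ext_ract x h)),
    ext_lact e' = ext_ract (ext_lact e) h;
  extn_band : forall x : ext_bun E, Band (ext_mor E) (ext_proj x, ext_chi x);
  (* smoothness of a map into the band is smoothness of its adjoint *)
  extn_chi_smooth :
    smooth (fun xg : ext_bun E * G => ext_chi xg.1 xg.2);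
  (* chi(r.x.h) = r.chi(x).j(h) *)
  extn_chi_equiv : forall (r : ext_grpd E) x h (e : tgt r = ext_proj x) g,
    conjugates r (ext_chi x (cm_act h g)) (ext_chi (ext_ract (ext_lact e) h) g);
  (* x.rho(g) = chi(x)(g).x *)
  extn_rho : forall (x : ext_bun E) g (e : tgt (ext_chi x g) = ext_proj x),
    ext_ract x (cm_rho g) = ext_lact e
}.

Definition ext_iso (E E' : ext_data) : Prop :=
  exists (Phi : gmor (ext_grpd E) (ext_grpd E')) (Psi : ext_bun E -> ext_bun E'),
    [/\ diffeo Phi /\ (forall r, ext_mor E' (Phi r) = ext_mor E r),
        diffeo Psi /\ (forall x, ext_proj (Psi x) = ext_proj x),
        forall r x h (e : tgt r = ext_proj x)
          (e' : tgt (Phi r) = ext_proj (Psi x)),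
          Psi (ext_ract (ext_lact e) h) = ext_ract (ext_lact e') h &
        forall x g, ext_chi (Psi x) g = Phi (ext_chi x g)].

End ExtensionData.

(* Same groupoid, bundle and chi, with the projection onto Q composed with
   [theta].  This is only used for isomorphisms [theta]. *)
Definition push_ext (M : diffType R) (Q Q' : groupoid M) (theta : gmor Q Q')
    (E : ext_data Q) : ext_data Q' :=
  @ExtData M Q' (ext_grpd E) (gmor_then (ext_mor E) theta) (ext_bun E)
    (@ext_proj M Q E) (@ext_lact M Q E) (@ext_ract M Q E) (@ext_chi M Q E)
    (@ext_proj_lact M Q E) (@ext_proj_ract M Q E)
    (@ext_src_chi M Q E) (@ext_tgt_chi M Q E).

Section PullbackExtension.
Variables (M M' : diffType R) (Q : groupoid M) (p : M' -> M) (E : ext_data Q).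

Let S := pullback p (ext_grpd E).

Definition pbe_bun : diffType R :=
  {z : ext_bun E * M' | ext_proj z.1 = p z.2}.

Let pbe_proj (z : pbe_bun) : M' := (sval z).2.

Lemma pbe_lact_ok (r : S) (z : pbe_bun) :
  tgt r = pbe_proj z -> tgt (sval r).1.2 = ext_proj (sval z).1.
Proof. by move=> e; rewrite (svalP r).2 (svalP z); congr p. Qed.

Lemma pbe_lactP (r : S) (z : pbe_bun) (e : tgt r = pbe_proj z) :
  ext_proj (ext_lact (pbe_lact_ok e)) = p (sval r).1.1.
Proof. by rewrite ext_proj_lact (svalP r).1. Qed.

Definition pbe_lact (r : S) (z : pbe_bun) (e : tgt r = pbe_proj z) : pbe_bun :=
  exist _ (ext_lact (pbe_lact_ok e), (sval r).1.1) (pbe_lactP e).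

Lemma pbe_ractP (z : pbe_bun) h :
  ext_proj (ext_ract (sval z).1 h) = p (sval z).2.
Proof. by rewrite ext_proj_ract (svalP z). Qed.

Definition pbe_ract (z : pbe_bun) (h : H) : pbe_bun :=
  exist _ (ext_ract (sval z).1 h, (sval z).2) (pbe_ractP z h).

Lemma pbe_chiP (z : pbe_bun) g :
  p (sval z).2 = src (ext_chi (sval z).1 g) /\
  tgt (ext_chi (sval z).1 g) = p (sval z).2.
Proof. by rewrite ext_src_chi ext_tgt_chi (svalP z). Qed.

Definition pbe_chi (z : pbe_bun) (g : G) : S :=
  exist _ ((sval z).2, ext_chi (sval z).1 g, (sval z).2) (pbe_chiP z g).

Definition pullback_ext : ext_data (pullback p Q) :=
  @ExtData M' (pullback p Q) S (pullback_mor p (ext_mor E)) pbe_bun pbe_proj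
    pbe_lact pbe_ract pbe_chi
    (fun _ _ _ => erefl) (fun _ _ => erefl)
    (fun _ _ => erefl) (fun _ _ => erefl).

End PullbackExtension.

Section Gerbes.
Variables (B0 : diffType R) (B : groupoid B0).

Record ext_over := ExtOver {
  eo_base : diffType R;
  eo_q : eo_base -> B0;
  eo_ext : ext_data (pullback eo_q B)
}.

Record extension_over (Y : ext_over) : Prop := ExtensionOver {
  eo_manifold : manifold (eo_base Y);
  eo_subm : surj_submersion (@eo_q Y);
  eo_extension : extension (eo_ext Y)
}.

(* The pull-backs by p and p' are compared as extensions of B[h], where
   h = q \o p = q' \o p', after the identifications B[q][p] = B[h] = B[q'][p']. *)
Definition morita_equivalent (Y Y' : ext_over) : Prop :=
  exists (N : diffType R) (p : N -> eo_base Y) (p' : N -> eo_base Y')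
    (h : N -> B0) (hE : forall n, h n = eo_q (p n))
    (hE' : forall n, h n = eo_q (p' n)),
    [/\ manifold N, surj_submersion p, surj_submersion p' &
        ext_iso (push_ext (flatten_mor B hE) (pullback_ext p (eo_ext Y)))
                (push_ext (flatten_mor B hE') (pullback_ext p' (eo_ext Y')))].

Definition gerbe_class (Y : ext_over) : ext_over -> Prop :=
  fun Y' => extension_over Y' /\ morita_equivalent Y Y'.

Definition gerbe : Type :=
  {c : ext_over -> Prop | exists2 Y, extension_over Y & c = gerbe_class Y}.

End Gerbes.

Section Morita.
Variables (B0 B0' : diffType R) (B : groupoid B0) (B' : groupoid B0').

Record morita := Morita {
  mor_T : diffType R;
  mor_f : mor_T -> B0;
  mor_g : mor_T -> B0';
  mor_iso : gmor (pullback mor_f B) (pullback mor_g B');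
  mor_manifold : manifold mor_T;
  mor_f_subm : surj_submersion mor_f;
  mor_g_subm : surj_submersion mor_g;
  mor_iso_diffeo : diffeo mor_iso
}.

Variable m : morita.

(* An extension E of B[f][q] is both an extension of B[f \o q], hence one over
   B with base map f \o q, and, through Phi[q] : B[f][q] -> B'[g][q], an
   extension of B'[g \o q], hence one over B' with base map g \o q.  The
   correspondence induced by (T, f, g, Phi) relates the classes of the two. *)
Definition ext_on_left (M : diffType R) (q : M -> mor_T m)
    (E : ext_data (pullback q (pullback (@mor_f m) B))) : ext_over B :=
  ExtOver (push_ext
    (@flatten_mor _ _ _ _ B (@mor_f m) q (@mor_f m \o q) (fun=> erefl)) E).

Definition ext_on_right (M : diffType R) (q : M -> mor_T m)
    (E : ext_data (pullback q (pullback (@mor_f m) B))) : ext_over B' :=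
  ExtOver (push_ext
    (@flatten_mor _ _ _ _ B' (@mor_g m) q (@mor_g m \o q) (fun=> erefl))
    (push_ext (pullback_mor q (mor_iso m)) E)).

Definition induced_correspondence (c : gerbe B) (c' : gerbe B') : Prop :=
  exists (M : diffType R) (q : M -> mor_T m)
    (E : ext_data (pullback q (pullback (@mor_f m) B))),
    [/\ manifold M, surj_submersion q, extension E,
        sval c = gerbe_class (ext_on_left E) &
        sval c' = gerbe_class (ext_on_right E)].

End Morita.

End Extensions.

(* Main.v *)
(* The correspondence factors through gerbes over T.  An extension of B[f][q] is
   one of B[f o q], and this induces a bijection from gerbes over B[f] to gerbes
   over B; the same holds for B'[g], and Phi identifies B[f] with B'[g].  The
   bijection is onto because an extension over M -> B0 may be pulled back to
   M x_B0 T.  It is injective because two pull-backs of an extension R along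
   p1, p2 : N -> M become isomorphic, by conjugation, as soon as a smooth map
   N -> R lifts the arrows (p1 n, 1, p2 n); such a lift exists after pulling back
   R -> B[q] itself, so an isomorphism that matches base points over B0 only can
   be moved to a cover where they match over T.  All the covers needed are fibre
   products along submersions, which are manifolds by the inverse function
   theorem. *)
Require Import Defs.
From HB Require Import structures.
From mathcomp Require Import all_boot all_order all_algebra perm.
From mathcomp Require Import all_classical all_reals all_analysis.
From mathcomp Require Import ring lra.
Import Order.TTheory GRing.Theory Num.Theory.
Import numFieldNormedType.Exports.
Import Defs.

Set Implicit Arguments.
Unset Strict Implicit.
Unset Printing Implicit Defensive.

Local Open Scope classical_set_scope.
Local Open Scope ring_scope.

(** * Smooth maps between coordinate spaces *)

(** A fibre product, being a subtype, receives its smooth structure for free, but not the property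
    of being a manifold: charts, separation and countability of every cover must be proved. The
    charts come from the split form of a submersion, and this is the only use of the inverse
    function theorem. Everywhere else a submersion is handled through smooth local sections, which
    compose and pull back without any differential calculus. The hard half of the correspondence is
    injectivity. An equivalence over [B] provides points whose images in [T] have the same image in
    [B0] but are in general distinct, while an equivalence over [B[f]] requires them to be equal in
    [T]. Two such points are joined by an arrow of [B[f]] over a unit of [B]. This arrow has no
    preferred lift to an extension, and a global smooth lift need not exist; the fibre product with
    the arrows of the extension carries a tautological one. The correspondence is given as a
    relation, through representatives over [T]; hence the bijection is extracted by choice from a
    relation that is total and single valued in both directions. *)

Section Differential.
Variable R : realType.
Implicit Types V W Z : normedModType R.

Lemma diff_eps V W (f : V -> W) (L : {linear V -> W}) x :
  continuous L ->
  (forall e, 0 < e -> \forall h \near (0 : V), `|f (h + x) - f x - L h| <= e * `|h|) ->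
  differentiable f x /\ ('d f x : V -> W) = L.
Proof.
move=> cL H.
have fE : f \o shift x = cst (f x) + L +o_ (0 : V) id.
  by apply/eqaddoP => e e0; apply: filterS (H e e0) => h /=; rewrite opprD addrA.
have dE := diff_unique cL fE.
by split=> //; apply/diff_locallyP; rewrite dE.
Qed.

Lemma diff_epsE V W (f : V -> W) x : differentiable f x ->
  forall e, 0 < e ->
  \forall h \near (0 : V), `|f (h + x) - f x - 'd f x h| <= e * `|h|.
Proof.
move=> /diff_locallyP[_ /eqaddoP H] e e0.
by apply: filterS (H e e0) => h /=; rewrite opprD addrA.
Qed.

Lemma diff_near V W (f g : V -> W) x : {near x, f =1 g} ->
  differentiable f x -> differentiable g x /\ ('d g x : V -> W) = 'd f x.
Proof.
move=> fg df; apply: diff_eps; first exact: diff_continuous.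
move=> e e0; have H := diff_epsE df e0.
have N : \forall h \near (0 : V), f (h + x) = g (h + x).
  have sx : (fun h : V => h + x) @ (0 : V) --> x.
    by rewrite -[X in _ --> X]add0r; apply: cvgD; [exact: cvg_id|exact: cvg_cst].
  exact: sx fg.
by apply: filterS2 N H => h <-; rewrite (nbhs_singleton fg).
Qed.

Lemma diff_open_ext V W (U : set V) (f g : V -> W) x : open U -> U x ->
  (forall u, U u -> f u = g u) ->
  differentiable f x -> differentiable g x /\ ('d g x : V -> W) = 'd f x.
Proof.
move=> oU Ux fg; apply: diff_near.
by apply: filterS (open_nbhs_nbhs (conj oU Ux)) => u; exact: fg.
Qed.

End Differential.

Section CkCalculus.
Variable R : realType.
Implicit Types V W Z : normedModType R.

(* [Ck] for maps between arbitrary normed spaces: calculus is done on the real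
   valued coordinates. *)
Fixpoint Cn (k : nat) V W (U : set V) (f : V -> W) : Prop :=
  if k is k'.+1 then
    (forall x, U x -> differentiable f x) /\
    (forall v, Cn k' U (fun x => 'd f x v))
  else forall x, U x -> {for x, continuous f}.

Lemma CkE k m n (U : set 'rV[R]_m) (f : 'rV[R]_m -> 'rV[R]_n) :
  Ck k U f <-> Cn k U f.
Proof.
elim: k f => [//|k IH] f /=.
by split=> -[h1 h2]; split=> // v; apply/IH; exact: h2.
Qed.

(** Openness of [U] is what makes this true: the derivative at a point of [U] depends on the values
    around it. *)
Lemma Cn_ext k V W (U : set V) (f g : V -> W) : open U ->
  (forall u, U u -> f u = g u) -> Cn k U f -> Cn k U g.
Proof.
move=> oU; elim: k f g => [|k IH] f g fg /=.
  move=> cf x Ux; have := cf x Ux.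
  have fgx : {near x, f =1 g}.
    by apply: filterS (open_nbhs_nbhs (conj oU Ux)) => u; exact: fg.
  by rewrite /prop_for /continuous_at -(fg x Ux); apply: cvg_trans; apply: near_eq_cvg;
    apply: filterS fgx => u ->.
move=> [df dk]; split=> [x Ux|v].
  by have [] := diff_open_ext oU Ux fg (df x Ux).
apply: IH (dk v) => u Uu.
by have [_ ->] := diff_open_ext oU Uu fg (df u Uu).
Qed.

Lemma Cn_sub k V W (U U' : set V) (f : V -> W) : U' `<=` U ->
  Cn k U f -> Cn k U' f.
Proof.
move=> s; elim: k f => [|k IH] f /=; first by move=> h x /s; exact: h.
by move=> [h1 h2]; split=> [x /s/h1//|v]; apply: IH.
Qed.

Lemma Cn_continuous k V W (U : set V) (f : V -> W) : Cn k U f ->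
  forall x, U x -> {for x, continuous f}.
Proof.
case: k => [//|k] [df _] x /df; exact: differentiable_continuous.
Qed.

Lemma CnW k V W (U : set V) (f : V -> W) : Cn k.+1 U f -> Cn k U f.
Proof.
elim: k f => [|k IH] f; first by move=> h /=; exact: Cn_continuous h.
by move=> [h1 h2]; split=> // v; exact/IH/h2.
Qed.

Lemma Cn_cst k V W (U : set V) (a : W) : open U -> Cn k U (cst a : V -> W).
Proof.
move=> oU; elim: k a => [|k IH] a /=; first by move=> x _; exact: cst_continuous.
split=> [x _ |v]; first exact: differentiable_cst.
by apply: (Cn_ext oU _ (IH 0)) => u _; rewrite diff_cst.
Qed.

Lemma Cn_comp_lin k V W Z (U : set V) (f : V -> W) (L : {linear W -> Z}) :
  open U -> continuous L -> Cn k U f -> Cn k U (L \o f).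
Proof.
move=> oU cL; elim: k f => [|k IH] f /=.
  by move=> h x Ux; apply: continuous_comp; [exact: h|exact: cL].
have dL x := @linear_differentiable _ _ _ L x cL.
move=> [df dk]; split=> [x Ux|v].
  by apply: differentiable_comp; [exact: df|exact: dL].
apply: (Cn_ext oU _ (IH _ (dk v))) => u Uu.
by rewrite diff_comp //=; [rewrite diff_lin|exact: df].
Qed.

Lemma Cn_lin k V W (U : set V) (L : {linear V -> W}) :
  open U -> continuous L -> Cn k U L.
Proof.
move=> oU cL; case: k => [|k] /=; first by move=> x _; exact: cL.
split=> [x _|v]; first exact: linear_differentiable.
by apply: (Cn_ext oU _ (Cn_cst k (L v) oU)) => u _; rewrite diff_lin.
Qed.

Lemma Cn_add k V W (U : set V) (f g : V -> W) : open U ->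
  Cn k U f -> Cn k U g -> Cn k U (fun x => f x + g x).
Proof.
move=> oU; elim: k f g => [|k IH] f g /=.
  by move=> hf hg x Ux; apply: cvgD; [exact: hf|exact: hg].
move=> [df dkf] [dg dkg]; split=> [x Ux|v].
  by apply: (@differentiableD _ _ _ f g); [exact: df|exact: dg].
apply: (Cn_ext oU _ (IH _ _ (dkf v) (dkg v))) => u Uu.
by rewrite (@diffD _ _ _ f g); [|exact: df|exact: dg].
Qed.

Lemma Cn_sum k V W (U : set V) (I : Type) (r : seq I) (P : pred I)
    (f : I -> V -> W) : open U ->
  (forall i, P i -> Cn k U (f i)) -> Cn k U (fun x => \sum_(i <- r | P i) f i x).
Proof.
move=> oU H; elim: r => [|i r IH].
  by apply: (Cn_ext oU _ (Cn_cst k 0 oU)) => u _; rewrite big_nil.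
have [Pi|nPi] := boolP (P i).
  apply: (Cn_ext oU _ (Cn_add oU (H i Pi) IH)) => u _.
  by rewrite big_cons Pi.
by apply: (Cn_ext oU _ IH) => u _; rewrite big_cons (negbTE nPi).
Qed.

Lemma Cn_mul k V (U : set V) (f g : V -> R) : open U ->
  Cn k U f -> Cn k U g -> Cn k U (fun x => f x * g x).
Proof.
move=> oU; elim: k f g => [|k IH] f g.
  by move=> hf hg x Ux; apply: cvgM; [exact: hf|exact: hg].
move=> hf hg; have [df dkf] := hf; have [dg dkg] := hg.
split=> [x Ux|v].
  by apply: (@differentiableM _ _ f g); [exact: df|exact: dg].
apply: (Cn_ext oU _ (Cn_add oU (IH _ _ (CnW hf) (dkg v)) (IH _ _ (CnW hg) (dkf v)))).
move=> u Uu.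
by rewrite (@diffM _ _ f g); [|exact: df|exact: dg].
Qed.

Lemma Cn_inv k V (U : set V) (f : V -> R) : open U ->
  (forall u, U u -> f u != 0) -> Cn k U f -> Cn k U (fun x => (f x)^-1).
Proof.
move=> oU f0; elim: k => [|k IH].
  by move=> hf x Ux; apply: cvgV; [exact: f0|exact: hf].
move=> hf; have [df dkf] := hf; have Cf := IH (CnW hf).
split=> [x Ux|v].
  by apply: (@differentiableV _ _ f); [exact: df|exact: f0].
apply: (Cn_ext oU _ (Cn_mul oU (Cn_cst k (-1 : R) oU)
  (Cn_mul oU (Cn_mul oU Cf Cf) (dkf v)))) => u Uu.
rewrite (@diffV _ _ f); [|exact: df|exact: f0].
by rewrite /= -expr2 exprVn mulN1r scaleNr.
Qed.

(** Coordinates bundled as linear maps, so that the rules for continuous linear maps apply to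
    them. *)
Definition coordl m n i j : {linear 'M[R]_(m, n) -> R} :=
  HB.pack (fun N : 'M[R]_(m, n) => N i j)
    (GRing.isLinear.Build _ _ _ _ (fun N : 'M[R]_(m, n) => N i j)
      (fun a u v => etrans (mxE _ _ _ _) (congr1 (fun x => x + v i j) (mxE _ _ _ _)))).

Lemma coordl_continuous m n i j : continuous (@coordl m n i j).
Proof. exact: coord_continuous. Qed.

Definition scalel (W : normedModType R) (w : W) : {linear R -> W} :=
  HB.pack (fun a : R => a *: w)
    (GRing.isLinear.Build _ _ _ _ (fun a : R => a *: w)
      (fun a u v => etrans (scalerDl _ _ _) (congr1 (fun x => x + v *: w) (esym (scalerA _ _ _))))).

Lemma Cn_coord k V n (U : set V) (f : V -> 'rV[R]_n) : open U ->
  Cn k U f <-> forall j, Cn k U (fun x => f x 0 j).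
Proof.
move=> oU; split=> [h j|h].
  exact: (Cn_comp_lin oU (@coordl_continuous 1 n 0 j) h).
have cs w : continuous (@scalel 'rV[R]_n w) by exact: scalel_continuous.
apply: (Cn_ext oU _ (Cn_sum _ oU (fun j _ => Cn_comp_lin oU (cs (delta_mx 0 j)) (h j)))).
by move=> u _ /=; rewrite [RHS]row_sum_delta.
Qed.

(** The derivative of [g \o f] along [v] is the sum over [j] of [('d f x v) 0 j] times the [j]-th
    partial derivative of [g] at [f x]. Each summand is a product of scalar functions, so the
    induction on [k] closes within real valued [g]; vector valued [g] are treated by coordinates. *)
Lemma Cn_comp k V n (U : set V) (U' : set 'rV[R]_n) (f : V -> 'rV[R]_n)
   (g : 'rV[R]_n -> R) :
  open U -> (forall u, U u -> U' (f u)) -> Cn k U f -> Cn k U' g ->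
  Cn k U (g \o f).
Proof.
move=> oU fU; elim: k g => [|k IH] g.
  move=> hf hg x Ux; apply: continuous_comp; [exact: hf|exact/hg/fU].
move=> hf hg; have [df dkf] := hf; have [dg dkg] := hg.
split=> [x Ux|v].
  by apply: differentiable_comp; [exact: df|exact/dg/fU].
have H (j : 'I_n) : Cn k U (fun x => ('d f x v) 0 j * ('d g (f x) (delta_mx 0 j))).
  apply: Cn_mul => //; first by move: (dkf v) => /(Cn_coord _ _ oU); apply.
  exact: IH (CnW hf) (dkg _).
apply: (Cn_ext oU _ (Cn_sum (index_enum 'I_n) oU (P := xpredT) (fun j _ => H j))) => u Uu.
rewrite (@diff_comp _ _ _ _ f g) /=; [|exact: df|exact/dg/fU].
rewrite [in RHS](row_sum_delta ('d f u v)) linear_sum /=.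
by apply: eq_bigr => j _; rewrite linearZ.
Qed.

Lemma Cn_mulmx k m n (U : set 'rV[R]_m) (A : 'M[R]_(m, n)) : open U ->
  Cn k U (fun u : 'rV[R]_m => u *m A).
Proof.
move=> oU; apply/Cn_coord => // j.
have H (i : 'I_m) : Cn k U (fun u : 'rV[R]_m => u 0 i * A i j).
  apply: Cn_mul => //; last exact: (Cn_cst k (A i j) oU).
  exact: (Cn_lin k oU (@coordl_continuous 1 m 0 i)).
apply: (Cn_ext oU _ (Cn_sum (index_enum 'I_m) oU (P := xpredT) (fun i _ => H i))).
by move=> u _; rewrite mxE.
Qed.

Lemma mulmxr_continuous m n (A : 'M[R]_(m, n)) :
  continuous (fun u : 'rV[R]_m => u *m A).
Proof. by move=> u; apply: (Cn_continuous (Cn_mulmx 0 A openT)). Qed.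

End CkCalculus.

Section Smooth.
Variable R : realType.

Lemma CinftyP m n (U : set 'rV[R]_m) (f : 'rV[R]_m -> 'rV[R]_n) :
  Cinfty U f <-> forall k, Cn k U f.
Proof. by split=> h k; apply/CkE; exact: h. Qed.

Lemma Cinfty_ext m n (U : set 'rV[R]_m) (f g : 'rV[R]_m -> 'rV[R]_n) : open U ->
  (forall u, U u -> f u = g u) -> Cinfty U f -> Cinfty U g.
Proof. by move=> oU fg /CinftyP h; apply/CinftyP => k; exact: Cn_ext fg (h k). Qed.

Lemma Cinfty_sub m n (U U' : set 'rV[R]_m) (f : 'rV[R]_m -> 'rV[R]_n) :
  U' `<=` U -> Cinfty U f -> Cinfty U' f.
Proof. by move=> s /CinftyP h; apply/CinftyP => k; exact: Cn_sub s (h k). Qed.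

Lemma Cinfty_differentiable m n (U : set 'rV[R]_m) (f : 'rV[R]_m -> 'rV[R]_n) u :
  Cinfty U f -> U u -> differentiable f u.
Proof. by move=> /(_ 1%N)[h _]; exact: h. Qed.

Lemma Cinfty_diff m n (U : set 'rV[R]_m) (f : 'rV[R]_m -> 'rV[R]_n) v :
  Cinfty U f -> Cinfty U (fun x => 'd f x v).
Proof. by move=> h k; have [_] := h k.+1; apply. Qed.

Lemma Cinfty_preimage_open m n (U : set 'rV[R]_m) (O : set 'rV[R]_n)
    (f : 'rV[R]_m -> 'rV[R]_n) :
  open U -> open O -> Cinfty U f -> open (U `&` f @^-1` O).
Proof.
move=> oU oO /(_ 0%N) cf; rewrite openE => u [Uu Ofu].
apply: filterI; first exact: open_nbhs_nbhs.
by apply: (cf u Uu); exact: open_nbhs_nbhs.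
Qed.

Lemma Cinfty_comp m n p (U : set 'rV[R]_m) (U' : set 'rV[R]_n)
    (f : 'rV[R]_m -> 'rV[R]_n) (g : 'rV[R]_n -> 'rV[R]_p) :
  open U -> open U' -> (forall u, U u -> U' (f u)) -> Cinfty U f -> Cinfty U' g ->
  Cinfty U (g \o f).
Proof.
move=> oU oU' fU /CinftyP hf /CinftyP hg; apply/CinftyP => k.
apply/Cn_coord => // j.
exact: (@Cn_comp R k _ _ U U' f (fun y => g y 0 j) oU fU (hf k) ((Cn_coord _ _ oU').1 (hg k) j)).
Qed.

Lemma Cinfty_mulmx m n (U : set 'rV[R]_m) (A : 'M[R]_(m, n)) : open U ->
  Cinfty U (fun u : 'rV[R]_m => u *m A).
Proof. by move=> oU; apply/CinftyP => k; exact: Cn_mulmx. Qed.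

Lemma Cinfty_id m (U : set 'rV[R]_m) : open U -> Cinfty U id.
Proof.
move=> oU; apply: (Cinfty_ext oU _ (Cinfty_mulmx 1%:M oU)) => u _.
exact: mulmx1.
Qed.

Lemma Cinfty_cst m n (U : set 'rV[R]_m) (a : 'rV[R]_n) : open U ->
  Cinfty U (fun=> a).
Proof. by move=> oU; apply/CinftyP => k; exact: Cn_cst. Qed.

Lemma Cinfty_add m n (U : set 'rV[R]_m) (f g : 'rV[R]_m -> 'rV[R]_n) : open U ->
  Cinfty U f -> Cinfty U g -> Cinfty U (fun x => f x + g x).
Proof. by move=> oU /CinftyP hf /CinftyP hg; apply/CinftyP => k; exact: Cn_add. Qed.

Lemma Cinfty_lsubmx m n (U : set 'rV[R]_(m + n)) : open U ->
  Cinfty U (fun u : 'rV[R]_(m + n) => lsubmx u).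
Proof.
move=> oU; apply: (Cinfty_ext oU _ (Cinfty_mulmx (col_mx 1%:M 0) oU)) => u _.
by rewrite -{1}[u]hsubmxK mul_row_col mulmx1 mulmx0 addr0.
Qed.

Lemma Cinfty_rsubmx m n (U : set 'rV[R]_(m + n)) : open U ->
  Cinfty U (fun u : 'rV[R]_(m + n) => rsubmx u).
Proof.
move=> oU; apply: (Cinfty_ext oU _ (Cinfty_mulmx (col_mx 0 1%:M) oU)) => u _.
by rewrite -{1}[u]hsubmxK mul_row_col mulmx1 mulmx0 add0r.
Qed.

Lemma Cinfty_row_mx p m n (U : set 'rV[R]_p) (f : 'rV[R]_p -> 'rV[R]_m)
    (g : 'rV[R]_p -> 'rV[R]_n) : open U ->
  Cinfty U f -> Cinfty U g -> Cinfty U (fun x => row_mx (f x) (g x)).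
Proof.
move=> oU hf hg.
have h1 := Cinfty_comp oU openT (fun _ _ => I) hf
  (Cinfty_mulmx (row_mx 1%:M (0 : 'M[R]_(m, n))) openT).
have h2 := Cinfty_comp oU openT (fun _ _ => I) hg
  (Cinfty_mulmx (row_mx (0 : 'M[R]_(n, m)) 1%:M) openT).
apply: (Cinfty_ext oU _ (Cinfty_add oU h1 h2)) => u _.
by rewrite /= !mul_mx_row !mulmx1 !mulmx0 add_row_mx addr0 add0r.
Qed.

Lemma Cinfty_continuous m n (U : set 'rV[R]_m) (f : 'rV[R]_m -> 'rV[R]_n) u :
  Cinfty U f -> U u -> {for u, continuous f}.
Proof. by move=> /(_ 0%N) h /h. Qed.

Lemma Cn_det k m (V : normedModType R) (U : set V) (A : V -> 'M[R]_m) : open U ->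
  (forall i j, Cn k U (fun x => A x i j)) -> Cn k U (fun x => \det (A x)).
Proof.
move=> oU hA; have P (s : {perm 'I_m}) : Cn k U (fun x => \prod_i A x i (s i)).
  elim: (index_enum 'I_m) => [|i r IH].
    by apply: (Cn_ext oU _ (Cn_cst k (1 : R) oU)) => u _; rewrite big_nil.
  apply: (Cn_ext oU _ (Cn_mul oU (hA i (s i)) IH)) => u _.
  by rewrite big_cons.
rewrite /determinant; apply: Cn_sum => // s _; apply: Cn_mul => //.
exact: (Cn_cst k ((-1) ^+ s : R) oU).
Qed.

(** Cramer's rule: the entries are cofactors divided by the determinant. *)
Lemma Cn_invmx k m (V : normedModType R) (U : set V) (A : V -> 'M[R]_m) : open U ->
  (forall x, U x -> A x \in unitmx) ->
  (forall i j, Cn k U (fun x => A x i j)) ->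
  forall i j, Cn k U (fun x => invmx (A x) i j).
Proof.
move=> oU uA hA i j.
have h1 : Cn k U (fun x => (\det (A x))^-1).
  apply: Cn_inv => //; last exact: Cn_det.
  by move=> u /uA; rewrite unitmxE unitfE.
have h2 : Cn k U (fun x => \det (row' j (col' i (A x)))).
  apply: Cn_det => // i' j'.
  apply: (Cn_ext oU _ (hA (lift j i') (lift i j'))) => u _.
  by rewrite !mxE.
apply: (Cn_ext oU _ (Cn_mul oU h1 (Cn_mul oU (Cn_cst k ((-1) ^+ (j + i) : R) oU) h2))).
by move=> u Uu; rewrite /invmx uA // !mxE.
Qed.

End Smooth.

(** * The inverse function theorem *)

Section InverseFunction.
Variable R : realType.

Lemma diff_subid (V : normedModType R) (F : V -> V) x : differentiable F x ->
  differentiable (fun x => x - F x) x /\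
  forall v, 'd (fun x => x - F x) x v = v - 'd F x v.
Proof.
move=> dF; have did : differentiable (@id V) x by [].
split; first exact: (@differentiableB _ _ _ id F).
move=> v; rewrite (@diffB _ _ _ id F x did dF).
have E : 'd (@id V) x = id :> (V -> V) by exact: diff_val.
by change ('d (@id V) x v - 'd F x v = v - 'd F x v); rewrite E.
Qed.

(** With [k = g (h + y) - g y] one has [k - L h = - L (h - 'd F (g y) k)]. The argument of [L] is
    the remainder of [F], which is small compared to [k], hence to [h] by the Lipschitz bound on
    [g]. *)
Lemma diff_inverse (V W : normedModType R) (F : V -> W) (g : W -> V)
    (L : {linear W -> V}) y (c : R) : 0 < c ->
  differentiable F (g y) -> continuous L -> (forall v, L ('d F (g y) v) = v) ->
  (\forall z \near y, F (g z) = z /\ `|g z - g y| <= c * `|z - y|) ->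
  differentiable g y /\ forall v, 'd g y v = L v.
Proof.
move=> c0 dF cL LK Ng; have Fgy : F (g y) = y by case: (nbhs_singleton Ng).
suff [d1 d2] : differentiable g y /\ ('d g y : W -> V) = L.
  by split=> // v; rewrite d2.
apply: diff_eps => // e e0.
have [C C0 hC] := linear_lipschitz cL.
(* [C] bounds [L] and [c] bounds [k] by [h]; dividing by both makes the final estimate exactly
   [e * |h|]. *)
have e'0 : 0 < e / (c * C) by rewrite divr_gt0 // mulr_gt0.
have /nbhs_ballP[d /= d0 hd] := diff_epsE dF e'0.
have N1 : \forall h \near (0 : W), F (g (h + y)) = h + y /\
    `|g (h + y) - g y| <= c * `|h + y - y|.
  have sx : (fun h : W => h + y) @ (0 : W) --> y.
    by rewrite -[X in _ --> X]add0r; apply: cvgD; [exact: cvg_id|exact: cvg_cst].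
  exact: sx Ng.
have d20 : 0 < d / c by rewrite divr_gt0.
have N2 := nbhsx_ballx (0 : W) _ d20.
apply: filterS2 N1 N2 => h [Fgh]; rewrite addrK => kh.
rewrite -ball_normE /ball_ /= sub0r normrN => hd2.
set k := g (h + y) - g y in kh *.
have bk : ball 0 d k.
  rewrite -ball_normE /ball_ /= sub0r normrN.
  by apply: le_lt_trans kh _; rewrite mulrC -ltr_pdivlMr.
have := hd _ bk; rewrite {1}/k subrK Fgh Fgy addrK => hR.
have -> : k - L h = - L (h - 'd F (g y) k) by rewrite linearB LK opprB.
rewrite normrN; apply: le_trans (hC _) _.
apply: le_trans (ler_wpM2l (ltW C0) hR) _.
apply: le_trans (ler_wpM2l (ltW C0) (ler_wpM2l (ltW e'0) kh)) _.
rewrite le_eqVlt; apply/orP; left; apply/eqP; field.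
by rewrite !gt_eqF.
Qed.

Lemma diff_line (V : normedModType R) (y w : V) (t : R) :
  differentiable (fun s : R => y + s *: w) t /\
  'd (fun s : R => y + s *: w) t 1 = w.
Proof.
have d1 : differentiable (fun s : R => s *: w) t by [].
have d0 : differentiable (cst y : R -> V) t by [].
split; first exact: (@differentiableD _ _ _ (cst y) (fun s : R => s *: w)).
rewrite (@diffD _ _ _ (cst y) (fun s : R => s *: w)) // diff_cst.
have E : 'd (fun s : R => s *: w) t = (fun s : R => s *: w) :> (R -> V) by exact: diff_val.
by rewrite E /= add0r scale1r.
Qed.

Lemma Cinfty_near0 m n (G : 'rV[R]_m -> 'rV[R]_n) (U : set 'rV[R]_m) x0 e :
  Cinfty U G -> U x0 -> G x0 = 0 -> 0 < e -> \forall x \near x0, `|G x| < e.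
Proof.
move=> cG Ux0 G0 e0; have := Cinfty_continuous cG Ux0.
move=> /cvgrPdist_lt /(_ e e0); apply: filterS => x.
by rewrite G0 sub0r normrN.
Qed.

Lemma coord_le_norm n (v : 'rV[R]_n) j : `|v 0 j| <= `|v|.
Proof.
rewrite [leRHS]/Num.Def.normr /= mx_normrE.
exact: (le_bigmax _ (fun i : 'I_1 * 'I_n => `|v i.1 i.2|) (0, j)).
Qed.

Lemma norm_le_coord n (v : 'rV[R]_n) c : 0 <= c -> (forall j, `|v 0 j| <= c) ->
  `|v| <= c.
Proof.
move=> c0 H; rewrite [leLHS]/Num.Def.normr /= mx_normrE.
by apply: bigmax_le => // -[i j] _ /=; rewrite (ord1 i).
Qed.

Lemma ball_convex n (x0 x y : 'rV[R]_n) r (t : R) : ball x0 r x -> ball x0 r y ->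
  0 <= t <= 1 -> ball x0 r (y + t *: (x - y)).
Proof.
rewrite -ball_normE /ball_ /= => hx hy /andP[t0 t1].
have -> : x0 - (y + t *: (x - y)) = t *: (x0 - x) + (1 - t) *: (x0 - y).
  by apply/rowP => j; rewrite !mxE; ring.
apply: le_lt_trans (ler_normD _ _) _; rewrite !normrZ ger0_norm // ger0_norm ?subr_ge0 //.
(* Strictness comes from the summand with factor [t], so [t = 0] is treated apart. *)
move: t0; rewrite le_eqVlt => /orP[/eqP<-|t0]; first by rewrite mul0r add0r subr0 mul1r.
have h1 : t * `|x0 - x| < t * r by rewrite ltr_pM2l.
have h2 : (1 - t) * `|x0 - y| <= (1 - t) * r by apply: ler_wpM2l; [rewrite subr_ge0|exact: ltW].
lra.
Qed.

(** The norm on row vectors is the sup norm, so it suffices to bound each coordinate; the mean value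
    theorem in one variable, along the segment from [y] to [x], does so with the same constant. *)
Lemma mean_value_le m n (H : 'rV[R]_m -> 'rV[R]_n) x0 (r c : R) : 0 <= c ->
  (forall x, ball x0 r x -> differentiable H x) ->
  (forall x v, ball x0 r x -> `|'d H x v| <= c * `|v|) ->
  forall x y, ball x0 r x -> ball x0 r y -> `|H x - H y| <= c * `|x - y|.
Proof.
move=> c0 dH bH x y bx by_; apply: norm_le_coord; first exact: mulr_ge0.
move=> j; pose g (t : R) := y + t *: (x - y).
pose phi (t : R) := H (g t) 0 j.
have dg (t : R) : differentiable g t /\ 'd g t 1 = x - y by exact: diff_line.
have bg (t : R) : 0 <= t <= 1 -> ball x0 r (g t) by exact: ball_convex.
have dphi (t : R) : 0 <= t <= 1 ->
    differentiable phi t /\ 'd phi t 1 = ('d H (g t) (x - y)) 0 j.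
  move=> t01; have dHg := dH _ (bg t t01).
  have [dgt dgE] := dg t.
  have d1 : differentiable (H \o g) t by exact: differentiable_comp.
  have cc := @linear_differentiable _ _ _ (coordl R 0 j) ((H \o g) t)
    (@coordl_continuous R 1 n 0 j).
  have E : phi = coordl R 0 j \o (H \o g) by [].
  rewrite E; split; first exact: differentiable_comp.
  rewrite (@diff_comp _ _ _ _ (H \o g) (coordl R 0 j)) //.
  rewrite [LHS]/= (@diff_lin _ _ _ (coordl R 0 j)); last exact: coordl_continuous.
  rewrite (@diff_comp _ _ _ _ g H) //=.
  by rewrite dgE.
have [] := @MVT_segment R phi (fun t => ('d H (g t) (x - y)) 0 j) 0 1 ler01.
- move=> t; rewrite in_itv /= => /andP[t0 t1].
  have [|d1 d2] := dphi t; first by rewrite !ltW.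
  apply: DeriveDef; first exact: diff_derivable.
  by rewrite deriveE.
- apply: continuous_in_subspaceT => t; rewrite inE /= in_itv /= => t01.
  by apply: differentiable_continuous; case: (dphi t t01).
move=> t; rewrite in_itv /= => t01; rewrite subr0 mulr1.
have g1 : g 1 = x by rewrite /g scale1r addrC subrK.
have g0 : g 0 = y by rewrite /g scale0r addr0.
rewrite /phi g1 g0 => E.
have -> : (H x - H y) 0 j = H x 0 j - H y 0 j by rewrite !mxE.
rewrite E; apply: le_trans (coord_le_norm _ _) _.
by apply: bH; exact: bg.
Qed.

Lemma diff_near_bound m n (H : 'rV[R]_m -> 'rV[R]_n) (U : set 'rV[R]_m) x0 (c : R) :
  0 < c -> open U -> U x0 -> Cinfty U H -> (forall v, 'd H x0 v = 0) ->
  \forall x \near x0, forall v, `|'d H x v| <= c * `|v|.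
Proof.
(* The [m] basis directions contribute at most [e * |v|] each; [m.+1] keeps the denominator nonzero
   when [m = 0]. *)
move=> c0 oU Ux0 cH d0; pose e := c / m.+1%:R.
have e0 : 0 < e by rewrite divr_gt0.
have N : \forall x \near x0, forall i : 'I_m, `|'d H x (delta_mx 0 i)| < e.
  apply: (@filter_forall _ _ (fun i x => `|'d H x (delta_mx 0 i)| < e) (nbhs x0)) => i.
  exact: Cinfty_near0 (Cinfty_diff (delta_mx 0 i) cH) Ux0 (d0 _) e0.
apply: filterS N => x hx v.
rewrite [in leLHS](row_sum_delta v) linear_sum /=.
apply: le_trans (ler_norm_sum _ _ _) _.
apply: le_trans (_ : \sum_(i < m) (`|v| * e) <= _).
  apply: ler_sum => i _; rewrite linearZ normrZ.
  by apply: ler_pM => //; [exact: coord_le_norm|exact/ltW].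
rewrite sumr_const card_ord -mulr_natr -mulrA mulrC ler_wpM2r //.
rewrite /e -mulrA ler_piMr ?(ltW c0) // mulrC ler_pdivrMr // mul1r.
by rewrite ler_nat.
Qed.


Definition rV_complete n : completeNormedModType R := HB.pack 'rV[R]_n.

Lemma contraction_closed_ball n (T : 'rV[R]_n -> 'rV[R]_n) x0 (r c : R) :
  0 < r -> 0 <= c < 1 ->
  (forall x, `|x - x0| <= r -> `|T x - x0| <= r) ->
  (forall x y, `|x - x0| <= r -> `|y - x0| <= r -> `|T x - T y| <= c * `|x - y|) ->
  exists2 x, `|x - x0| <= r & T x = x.
Proof.
move=> r0 /andP[c0 c1] Tr Tc.
pose A : set (rV_complete n) := [set x : 'rV[R]_n | `|x - x0| <= r].
have mA : set_fun A A T by move=> x; exact: Tr.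
pose f : {fun A >-> A} := HB.pack (T : rV_complete n -> rV_complete n)
  (isFun.Build _ _ A A T mA).
have ctr : is_contraction f.
  by exists (NngNum c0); split=> // -[x y] [/= xA yA]; exact: Tc.
have cA : closed A.
  have -> : A = closed_ball (x0 : rV_complete n) r.
    rewrite closed_ballE // /closed_ball_; apply/seteqP.
    by split=> x; rewrite /A /= distrC.
  exact: closed_ball_closed.
have [] := banach_fixed_point ctr cA.
  by exists x0; rewrite /A /= subrr normr0 ltW.
by move=> x Ax Ex; exists x.
Qed.

(** The map [H = id - F] has derivative zero at [x0], hence is a contraction of ratio 1/2 nearby.
    Solving [F x = y] means finding a fixed point of [H + y], and the decomposition
    [x - x' = (H x - H x') + (F x - F x')] shows that the solution is a 2-Lipschitz function of
    [y]. *)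
Lemma inverse_function_id m (F : 'rV[R]_m -> 'rV[R]_m) (U : set 'rV[R]_m) x0 :
  open U -> U x0 -> Cinfty U F -> (forall v, 'd F x0 v = v) ->
  exists (U1 W : set 'rV[R]_m) (g : 'rV[R]_m -> 'rV[R]_m),
    [/\ open U1, U1 x0, U1 `<=` U & open W] /\
    [/\ forall x, U1 x -> W (F x) /\ g (F x) = x,
        forall y, W y -> U1 (g y) /\ F (g y) = y & Cinfty W g].
Proof.
move=> oU Ux0 cF dF0; pose H x := x - F x.
have dFU x : U x -> differentiable F x by exact: Cinfty_differentiable.
have dH x : U x -> differentiable H x /\ forall v, 'd H x v = v - 'd F x v.
  by move=> /dFU/diff_subid.
have cH : Cinfty U H.
  apply: (Cinfty_ext oU _ (Cinfty_add oU (Cinfty_id oU)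
    (Cinfty_comp oU openT (fun _ _ => I) cF (Cinfty_mulmx (- 1%:M) openT)))) => u _.
  by rewrite /= mulmxN mulmx1.
have hlt : 0 < (2^-1 : R) by [].
have dH0 v : 'd H x0 v = 0 by rewrite (dH _ Ux0).2 dF0 subrr.
have Nb := diff_near_bound hlt oU Ux0 cH dH0.
have [r' /= r'0 hr'] : exists2 r', 0 < r' & forall x, ball x0 r' x ->
    U x /\ forall v, `|'d H x v| <= 2^-1 * `|v|.
  have : \forall x \near x0, U x /\ forall v, `|'d H x v| <= 2^-1 * `|v|.
    by apply: filterI => //; exact: open_nbhs_nbhs.
  by move=> /nbhs_ballP[r' r'0 hr']; exists r' => // x /hr'.
have Hlip x y : ball x0 r' x -> ball x0 r' y -> `|H x - H y| <= 2^-1 * `|x - y|.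
  apply: mean_value_le; first exact: ltW.
    by move=> z /hr'[/dH[]].
  by move=> z v /hr'[_]; apply.
(* Halving [r'] puts the closed ball of radius [r], where the fixed point theorem applies, inside
   the open ball where [H] is controlled. *)
pose r := r' / 2; have r0 : 0 < r by rewrite divr_gt0.
have rr' : r < r' by rewrite /r; lra.
have ballE s z : ball x0 s z = (`|z - x0| < s) :> Prop.
  by rewrite -ball_normE /ball_ /= distrC.
have cl z : `|z - x0| <= r -> ball x0 r' z.
  by move=> h; rewrite ballE; exact: le_lt_trans rr'.
have bl z : ball x0 r z -> ball x0 r' z by rewrite !ballE => /ltW/cl; rewrite ballE.
have c0 : ball x0 r' x0 by exact: ballxx.
(* For [y] in [W], [H x - H x0] has norm at most [r / 2] and [y - F x0] less than [r / 2], so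
   [H + y] sends the closed ball of radius [r] into the open one; the solution is thus an interior
   point. *)
pose W : set 'rV[R]_m := ball (F x0) (r / 2).
pose U1 := ball x0 r `&` F @^-1` W.
have exg y : W y -> exists2 x, U1 x & F x = y.
  rewrite /W -ball_normE /ball_ /= distrC => Wy.
  pose T x := H x + y.
  have TE x : T x - x0 = H x - H x0 + (y - F x0).
    by rewrite /T /H; apply/rowP => j; rewrite !mxE; ring.
  have Tb x : `|x - x0| <= r -> `|T x - x0| < r.
    move=> xr; rewrite TE; apply: le_lt_trans (ler_normD _ _) _.
    have h1 := Hlip _ _ (cl _ xr) c0; lra.
  have [|||x xr Tx] := @contraction_closed_ball m T x0 r 2^-1 r0.
  - by apply/andP; split; lra.
  - by move=> x /Tb/ltW.
  - move=> x x' xr x'r; have -> : T x - T x' = H x - H x'.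
      by rewrite /T; apply/rowP => j; rewrite !mxE; ring.
    by apply: Hlip; exact: cl.
  have Fx : F x = y.
    move: Tx; rewrite /T /H => E; apply/rowP => j.
    by move/rowP: E => /(_ j); rewrite !mxE => E; lra.
  exists x => //; split; last by rewrite /preimage /= Fx /W -ball_normE /ball_ /= distrC.
  by rewrite ballE -Tx; exact: Tb.
have Flip x x' : ball x0 r' x -> ball x0 r' x' -> `|x - x'| <= 2 * `|F x - F x'|.
  move=> bx bx'; have h := Hlip _ _ bx bx'.
  have : `|x - x'| <= `|H x - H x'| + `|F x - F x'|.
    apply: le_trans (ler_normD _ _); rewrite le_eqVlt; apply/orP; left; apply/eqP.
    by congr (`| _ |); rewrite /H; apply/rowP => j; rewrite !mxE; ring.
  by move=> h2; lra.
pose g y := get [set x | U1 x /\ F x = y].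
have gP y : W y -> U1 (g y) /\ F (g y) = y.
  move=> /exg[x U1x Fx].
  exact: (@getPex _ [set x | U1 x /\ F x = y] (ex_intro _ x (conj U1x Fx))).
have U1r' x : U1 x -> ball x0 r' x by move=> [/bl].
have oW : open W by exact: ball_open.
have glip y y' : W y -> W y' -> `|g y - g y'| <= 2 * `|y - y'|.
  move=> /gP[Ug Fg] /gP[Ug' Fg']; rewrite -{2}Fg -{2}Fg'.
  by apply: Flip; exact: U1r'.
pose J x : 'M[R]_m := \matrix_(i, j) ('d F x (delta_mx 0 i)) 0 j.
have JE x v : v *m J x = 'd F x v.
  rewrite [in RHS](row_sum_delta v) linear_sum /=.
  apply/rowP => j; rewrite mxE summxE; apply: eq_bigr => i _.
  by rewrite mxE linearZ /= mxE.
(* A vector [v] killed by [J x] satisfies ['d H x v = v], and the bound 1/2 on ['d H x] forces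
   [v = 0]. *)
have Ju x : ball x0 r' x -> J x \in unitmx.
  move=> bx; rewrite -row_free_unit -kermx_eq0; apply/eqP/row_matrixP => i.
  rewrite row0; set v := row i _.
  have vJ : v *m J x = 0 by apply/sub_kermxP; rewrite /v row_sub.
  have [Ux hb] := hr' _ bx; have := hb v; rewrite (dH _ Ux).2 -JE vJ subr0 => h.
  by apply/eqP; rewrite -normr_le0; lra.
have dg y : W y -> differentiable g y /\ forall v, 'd g y v = v *m invmx (J (g y)).
  move=> Wy; have [Ugy Fgy] := gP _ Wy.
  have bgy := U1r' _ Ugy; have uJ := Ju _ bgy.
  pose L : {linear 'rV[R]_m -> 'rV[R]_m} := mulmxr (invmx (J (g y))).
  have cL : continuous L by exact: mulmxr_continuous.
  apply: (@diff_inverse _ _ F g L y 2) => //.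
  - by apply: dFU; exact: (hr' _ bgy).1.
  - by move=> v; rewrite -JE /= mulmxK.
  have := open_nbhs_nbhs (conj oW Wy); apply: filterS => z Wz.
  by split; [exact: (gP _ Wz).2|exact: glip].
exists U1, W, g; split; split=> //.
- rewrite /U1; apply: Cinfty_preimage_open => //; first exact: ball_open.
  by apply: Cinfty_sub cF => x /bl/hr'[].
- by split; [exact: ballxx|apply: ballxx; rewrite divr_gt0].
- by move=> x /U1r'/hr'[].
- move=> x U1x; have Wx : W (F x) := U1x.2.
  split=> //; have [Ug Fg] := gP _ Wx; apply/eqP; rewrite -subr_eq0 -normr_le0.
  by have := Flip _ _ (U1r' _ Ug) (U1r' _ U1x); rewrite Fg subrr normr0 mulr0.
(* The derivative of [g] is the inverse of [J (g y)]; if [g] is of class [k] so is this inverse, and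
   [g] gains one order. *)
apply/CinftyP; elim=> [|k IH].
  by move=> y Wy; apply: differentiable_continuous; case: (dg y Wy).
split=> [y Wy|v]; first by case: (dg y Wy).
have CJ i j : Cn k W (fun y => J (g y) i j).
  have := Cinfty_diff (delta_mx 0 i) cF => /CinftyP/(_ k)/(Cn_coord _ _ oU)/(_ j) h.
  apply: (Cn_ext oW _ (Cn_comp (U' := U) oW _ IH h)); first by move=> y _; rewrite /= mxE.
  by move=> y /gP[/U1r'/hr'[]].
have uJ y : W y -> J (g y) \in unitmx by move=> /gP[/U1r'/Ju].
have CV := Cn_invmx oW uJ CJ.
apply/Cn_coord => // j.
have h i : Cn k W (fun y => v 0 i * invmx (J (g y)) i j).
  by apply: Cn_mul => //; exact: (Cn_cst k (v 0 i : R) oW).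
apply: (Cn_ext oW _ (Cn_sum (index_enum 'I_m) oW (P := xpredT) (fun i _ => h i))) => y Wy.
by rewrite (dg y Wy).2 mxE.
Qed.

(** The two dimensions keep different names: the application has [m] on one side and a sum [k + n]
    on the other. Composition with [B] reduces to a derivative equal to the identity. *)
Lemma inverse_function m n (F : 'rV[R]_m -> 'rV[R]_n) (U : set 'rV[R]_m) x0
    (A : 'M[R]_(m, n)) (B : 'M[R]_(n, m)) :
  open U -> U x0 -> Cinfty U F -> (forall v, 'd F x0 v = v *m A) ->
  A *m B = 1%:M -> B *m A = 1%:M ->
  exists (U1 : set 'rV[R]_m) (W : set 'rV[R]_n) (g : 'rV[R]_n -> 'rV[R]_m),
    [/\ open U1, U1 x0, U1 `<=` U & open W] /\
    [/\ forall x, U1 x -> W (F x) /\ g (F x) = x,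
        forall y, W y -> U1 (g y) /\ F (g y) = y & Cinfty W g].
Proof.
move=> oU Ux0 cF dF AB BA; pose F' x := F x *m B.
have cF' : Cinfty U F' by exact: (Cinfty_comp oU openT (fun _ _ => I) cF (Cinfty_mulmx B openT)).
have dF' v : 'd F' x0 v = v.
  pose L : {linear 'rV[R]_n -> 'rV[R]_m} := mulmxr B.
  have cL : continuous L by exact: mulmxr_continuous.
  rewrite (@diff_comp _ _ _ _ F L) /=; last exact: linear_differentiable.
    by rewrite (@diff_lin _ _ _ L) //= dF -mulmxA AB mulmx1.
  exact: Cinfty_differentiable cF Ux0.
have [U1 [W [g [[oU1 U1x U1U oW] [h1 h2 h3]]]]] := inverse_function_id oU Ux0 cF' dF'.
have cB := Cinfty_mulmx B (@openT 'rV[R]_n).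
exists U1, ((fun y => y *m B) @^-1` W), (fun y => g (y *m B)); split; split=> //.
- by rewrite -[X in open X]setTI; exact: Cinfty_preimage_open openT oW cB.
- move=> y Wy; have [U1g E] := h2 _ Wy; split=> //.
  by rewrite -[LHS]mulmx1 -BA mulmxA [X in X *m A]E -mulmxA BA mulmx1.
- have := Cinfty_comp (U := (fun y => y *m B) @^-1` W) _ oW (fun u Wu => Wu) _ h3; apply.
    by rewrite -[X in open X]setTI; exact: Cinfty_preimage_open openT oW cB.
  exact: Cinfty_sub (@subsetT _ _) cB.
Qed.

End InverseFunction.

(** * Submersions and fibre products *)

(** If [s *m A = 1], then [1 - A *m s] projects onto the kernel of [A]; [K] gives the coordinates of
    this projection in a basis [C] of the kernel, and [B] stacks [C] on [s]. *)
Lemma surjective_complement (F : fieldType) m n (A : 'M[F]_(m, n)) :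
  (forall w : 'rV_n, exists v : 'rV_m, v *m A = w) ->
  exists k (K : 'M[F]_(m, k)) (B : 'M[F]_(k + n, m)),
    row_mx K A *m B = 1%:M /\ B *m row_mx K A = 1%:M.
Proof.
move=> sA; have /row_fullP[s sA1] : row_full A.
  rewrite -sub1mx; apply/row_subP => i.
  by have [v <-] := sA (row i 1%:M); exact: submxMl.
pose C := row_base (kermx A).
have CA : C *m A = 0 by apply/sub_kermxP; rewrite eq_row_base.
have /row_freeP[D CD] : row_free C by exact: row_base_free.
have /submxP[K KC] : (1%:M - A *m s <= C)%MS.
  rewrite eq_row_base; apply/sub_kermxP.
  by rewrite mulmxBl mul1mx -mulmxA sA1 mulmx1 subrr.
exists (\rank (kermx A)), K, (col_mx C s); split.
  by rewrite mul_row_col -KC subrK.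
have inj k (Y Z : 'M[F]_(k, \rank (kermx A))) : Y *m C = Z *m C -> Y = Z.
  move=> E; have : Y *m C *m D = Z *m C *m D by rewrite E.
  by rewrite -[Y *m C *m D]mulmxA -[Z *m C *m D]mulmxA CD !mulmx1.
have CK : C *m K = 1%:M.
  by apply: inj; rewrite -mulmxA -KC mulmxBr mulmx1 mulmxA CA mul0mx subr0 mul1mx.
have sK : s *m K = 0.
  by apply: inj; rewrite -mulmxA -KC mulmxBr mulmx1 mulmxA sA1 mul1mx subrr mul0mx.
by rewrite mul_col_row CK CA sK sA1 scalar_mx_block.
Qed.

Section DifferentialRules.
Variable R : realType.
Implicit Types V W Z : normedModType R.

Lemma diff_section V W (a : V -> W) (b : W -> V) (N : set W) w0 x :
  open N -> N w0 -> b w0 = x -> differentiable a x -> differentiable b w0 ->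
  (forall w, N w -> a (b w) = w) -> forall w, 'd a x ('d b w0 w) = w.
Proof.
move=> oN Nw0 <- da db ab w.
have did : differentiable (@id W) w0 by [].
have [_ E] := diff_open_ext (g := a \o b) oN Nw0 (fun w Nw => esym (ab w Nw)) did.
have dE : 'd (@id W) w0 = id :> (W -> W) by exact: diff_val.
have := congr1 (fun h => h w) E; rewrite diff_comp //= => ->.
by rewrite dE.
Qed.

Lemma diff_lin_add V W Z (L1 : {linear V -> Z}) (L2 : {linear W -> Z}) (F : V -> W) x v :
  continuous L1 -> continuous L2 -> differentiable F x ->
  'd (fun u => L1 u + L2 (F u)) x v = L1 v + L2 ('d F x v).
Proof.
move=> c1 c2 dF; have d1 : differentiable L1 x by exact: linear_differentiable.
have d2 : differentiable L2 (F x) by exact: linear_differentiable.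
have d3 : differentiable (L2 \o F) x by exact: differentiable_comp.
rewrite (@diffD _ _ _ L1 (L2 \o F) x d1 d3) /=.
by rewrite (diff_lin _ c1) (diff_comp dF d2) /= (diff_lin _ c2).
Qed.

End DifferentialRules.

(** * Submersions, local sections and split charts *)

Section LocalSmoothness.
Variable R : realType.
Implicit Types X Y Z : diffType R.

(** Only plots landing in [A] are tested, so a local section can be a total function with arbitrary
    values outside its domain. *)
Definition smooth_on X Y (A : set X) (f : X -> Y) : Prop :=
  forall n (U : set 'rV[R]_n) (p : 'rV[R]_n -> X), plot U p ->
    (forall u, U u -> A (p u)) -> plot U (f \o p).

Lemma plot_restrict X n (U U' : set 'rV[R]_n) (p : 'rV[R]_n -> X) :
  open U' -> U' `<=` U -> plot U p -> plot U' p.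
Proof. by move=> oU' s; apply: plot_comp => //; exact: Cinfty_id. Qed.

Lemma smooth_smooth_on X Y (A : set X) (f : X -> Y) : smooth f -> smooth_on A f.
Proof. by move=> h n U p /h. Qed.

Lemma smooth_on_comp X Y Z (A : set X) (B : set Y) (f : X -> Y) (g : Y -> Z) :
  smooth_on A f -> smooth_on B g -> (forall x, A x -> B (f x)) ->
  smooth_on A (g \o f).
Proof.
by move=> hf hg AB n U p pU pA; apply: (hg _ _ (f \o p)) => [|u /pA/AB//]; exact: hf.
Qed.

Lemma smooth_comp X Y Z (f : X -> Y) (g : Y -> Z) :
  smooth f -> smooth g -> smooth (g \o f).
Proof. by move=> hf hg n U p /hf/hg. Qed.

Lemma smooth_id X : smooth (@id X). Proof. by []. Qed.

Lemma smooth_cst X Y (y : Y) : smooth (fun _ : X => y).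
Proof. by move=> n U p /plot_open; exact: plot_const. Qed.

Lemma smooth_pair X Y Z (f : X -> Y) (g : X -> Z) :
  smooth f -> smooth g -> smooth (fun x => (f x, g x)).
Proof. by move=> hf hg n U p pU; split; [exact: hf|exact: hg]. Qed.

Lemma smooth_fst X Y : smooth (@fst X Y). Proof. by move=> n U p []. Qed.
Lemma smooth_snd X Y : smooth (@snd X Y). Proof. by move=> n U p []. Qed.

Lemma smooth_sval X (A : X -> Prop) : smooth (fun x : sig A => sval x).
Proof. by []. Qed.

Lemma smooth_sig X Y (A : Y -> Prop) (f : X -> sig A) :
  smooth (fun x => sval (f x)) -> smooth f.
Proof. by move=> h n U p /h. Qed.

Lemma smooth_ext X Y (f g : X -> Y) : f =1 g -> smooth f -> smooth g.
Proof. by move=> fg h n U p /h; apply: plot_ext => u _ /=; rewrite fg. Qed.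

Lemma dopen_smooth_on X Y (A : set X) (B : set Y) (f : X -> Y) :
  dopen A -> dopen B -> smooth_on A f -> dopen (A `&` f @^-1` B).
Proof.
move=> oA oB hf n U p pU; have oU' := oA _ _ _ pU.
have pU' : plot (U `&` p @^-1` A) (f \o p).
  by apply: hf => [|u []//]; apply: plot_restrict pU => // u [].
by have := oB _ _ _ pU'; rewrite -setIA.
Qed.

Lemma dopen_preimage X Y (B : set Y) (f : X -> Y) :
  dopen B -> smooth f -> dopen (f @^-1` B).
Proof. by move=> oB hf n U p /hf pU; exact: oB pU. Qed.

Lemma dopen_setT X : dopen [set: X].
Proof. by move=> n U p /plot_open; rewrite preimage_setT setIT. Qed.

Lemma dopen_setI X (A B : set X) : dopen A -> dopen B -> dopen (A `&` B).
Proof.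
by move=> oA oB; apply: (dopen_smooth_on (f := id)) => // n U p.
Qed.

Lemma chart_psiK X n (U : set 'rV[R]_n) phi (psi : X -> 'rV[R]_n) x :
  is_chart U phi psi -> (phi @` U) x -> U (psi x) /\ phi (psi x) = x.
Proof. by move=> c [u Uu <-]; rewrite (chart_cancel c Uu). Qed.

Lemma chart_domain_open X n (U : set 'rV[R]_n) phi (psi : X -> 'rV[R]_n) :
  is_chart U phi psi -> open U.
Proof. by move=> /chart_plot/plot_open. Qed.

Lemma chart_image_open X n (U U' : set 'rV[R]_n) phi (psi : X -> 'rV[R]_n) :
  is_chart U phi psi -> open U' -> U' `<=` U -> dopen (phi @` U').
Proof.
move=> c oU' s m O p pO; have oO := chart_open c pO.
have cp : Cinfty (O `&` p @^-1` (phi @` U)) (psi \o p).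
  by apply: (chart_inv c) => [|v []//]; apply: plot_restrict pO => // v [].
have := Cinfty_preimage_open oO oU' cp; congr (open _).
apply/seteqP; split=> v /=.
  by move=> [[Ov Uv] U'v]; split=> //; exists (psi (p v)) => //; have [] := chart_psiK c Uv.
move=> [Ov [u U'u E]]; split; last by rewrite -E (chart_cancel c (s _ U'u)).
by split=> //; exists u => //; exact: s.
Qed.

Definition has_section X Y (f : X -> Y) x : Prop :=
  exists (V : set Y) (s : Y -> X),
    [/\ dopen V, V (f x), smooth_on V s, s (f x) = x & forall y, V y -> f (s y) = y].

Definition charted X (x : X) : Prop :=
  exists n (U : set 'rV[R]_n) phi psi, is_chart U phi psi /\ (phi @` U) x.

(** In charts the section becomes a right inverse [b] of the coordinate expression [a] of [f] near
    the image point; the chain rule makes the derivative of [b] a right inverse of that of [a]. *)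
Lemma section_submersive X Y (f : X -> Y) x : smooth f ->
  charted x -> charted (f x) -> has_section f x -> submersive_at f x.
Proof.
move=> sf [m [U [phi [psi [c Ux]]]]] [n [V [phi' [psi' [c' Vfx]]]]].
move=> [VS [s [oVS VSx ss sx fs]]].
exists m, U, phi, psi, n, V, phi', psi'; split=> //.
have [Upx pKx] := chart_psiK c Ux; have [Vpx pKfx] := chart_psiK c' Vfx.
pose a := psi' \o f \o phi.
pose U0 := U `&` (f \o phi) @^-1` (phi' @` V).
have pfU : plot U (f \o phi) by exact/sf/(chart_plot c).
have oU0 : open U0 by exact: (chart_open c' pfU).
have ca : Cinfty U0 a.
  by apply: (chart_inv c' (p := f \o phi)) => [|v []//]; apply: plot_restrict pfU => // v [].
have U0x : U0 (psi x) by split=> //=; rewrite pKx.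
pose V0 := V `&` phi' @^-1` (VS `&` s @^-1` (phi @` U)).
have oV0 : open V0.
  by apply: (dopen_smooth_on oVS (chart_open c) ss); exact: chart_plot c'.
have V0x : V0 (psi' (f x)) by split=> //=; rewrite pKfx; split=> //=; rewrite sx.
pose b := psi \o (s \o phi').
have cb : Cinfty V0 b.
  apply: (chart_inv c) => [|v [_ []]//].
  by apply: ss => [|v [_ []]//]; apply: plot_restrict (chart_plot c') => // v [].
have bx : b (psi' (f x)) = psi x by rewrite /b /= pKfx sx.
have da := Cinfty_differentiable ca U0x.
have db := Cinfty_differentiable cb V0x.
have ab v : V0 v -> a (b v) = v.
  move=> [Vv [VSv sv]]; rewrite /a /b /=.
  by rewrite (chart_psiK c sv).2 fs // (chart_cancel c' Vv).
by move=> w; exists ('d b (psi' (f x)) w); exact: (diff_section oV0 V0x bx).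
Qed.

(** Completing the derivative [A] of [F] by [K] to an invertible matrix makes [u |-> (u *m K, F u)]
    a local diffeomorphism. Reparametrising the chart by its inverse turns [f] into the projection
    onto the last [n] coordinates. *)
Lemma split_chart X Y (f : X -> Y) x : smooth f -> submersive_at f x ->
  exists k n (W : set 'rV[R]_(k + n)) (phi : 'rV[R]_(k + n) -> X) psi
         (V : set 'rV[R]_n) (phi' : 'rV[R]_n -> Y) psi',
    [/\ is_chart W phi psi, (phi @` W) x, is_chart V phi' psi' &
        forall w, W w -> V (rsubmx w) /\ f (phi w) = phi' (rsubmx w)].
Proof.
move=> sf [m [U [phi [psi [n [V [phi' [psi' [c Ux c' Vfx sd]]]]]]]]].
have [Upx pKx] := chart_psiK c Ux.
pose F := psi' \o f \o phi.
pose U0 := U `&` (f \o phi) @^-1` (phi' @` V).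
have pfU : plot U (f \o phi) by exact/sf/(chart_plot c).
have oU0 : open U0 by exact: (chart_open c' pfU).
have cF : Cinfty U0 F.
  by apply: (chart_inv c' (p := f \o phi)) => [|v []//]; apply: plot_restrict pfU => // v [].
have U0x : U0 (psi x) by split=> //=; rewrite pKx.
pose A := lin1_mx ('d F (psi x)).
have AE v : v *m A = 'd F (psi x) v by exact: mul_rV_lin1.
have [|k [K [B [KB BK]]]] := @surjective_complement _ _ _ A.
  by move=> w; have [v vE] := sd w; exists v; rewrite AE.
pose G u := row_mx (u *m K) (F u).
have cK : Cinfty U0 (fun u => u *m K) by exact: Cinfty_mulmx.
have cG : Cinfty U0 G by exact: Cinfty_row_mx.
have dG v : 'd G (psi x) v = v *m row_mx K A.
  pose L1 : {linear 'rV[R]_m -> 'rV[R]_(k + n)} := mulmxr (row_mx K 0).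
  pose L2 : {linear 'rV[R]_n -> 'rV[R]_(k + n)} := mulmxr (row_mx 0 1%:M).
  have -> : G = (fun u => L1 u + L2 (F u)).
    apply/funext => u.
    by rewrite /L1 /L2 /= !mul_mx_row !mulmx1 !mulmx0 add_row_mx addr0 add0r.
  rewrite diff_lin_add; [|exact: mulmxr_continuous|exact: mulmxr_continuous|].
    by rewrite -AE /L1 /L2 /= !mul_mx_row !mulmx1 !mulmx0 add_row_mx addr0 add0r.
  exact: Cinfty_differentiable cF U0x.
have [U1 [W [g [[oU1 U1x U1U oW] [h1 h2 cg]]]]] := inverse_function oU0 U0x cG dG KB BK.
exists k, n, W, (phi \o g), (G \o psi), V, phi', psi'; split=> //.
- have gU y : W y -> U (g y) by move=> /h2[/U1U[]].
  split=> /=.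
  + have -> : (phi \o g) @` W = phi @` U1.
      apply/seteqP; split=> z [y yW <-] /=; first by exists (g y) => //; case: (h2 _ yW).
      by exists (G y); [case: (h1 _ yW)|rewrite /= (h1 _ yW).2].
    by apply: (chart_image_open c) => // u /U1U[].
  + exact: plot_comp (chart_plot c).
  + by move=> u Wu; rewrite (chart_cancel c (gU _ Wu)) (h2 _ Wu).2.
  + move=> l O p pO pW.
    have pU v : O v -> (phi @` U) (p v) by move=> /pW[y Wy <-]; exists (g y) => //; exact: gU.
    apply: (Cinfty_comp (f := psi \o p) (plot_open pO) oU0) => //.
      move=> v /pW[y Wy E]; rewrite /= -E (chart_cancel c (gU _ Wy)).
      by have [/U1U] := h2 _ Wy.
    exact: (chart_inv c).
- by exists (G (psi x)); [case: (h1 _ U1x)|rewrite /= (h1 _ U1x).2].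
move=> w Ww; have [U1g Gg] := h2 _ Ww.
have -> : rsubmx w = F (g w) by rewrite -{1}Gg /G row_mxKr.
have [_ /=] := U1U _ U1g => /(chart_psiK c')[h3 h4].
by split; [exact: h3|rewrite /F /= h4].
Qed.

(** In a split chart, the section freezes the first [k] coordinates at those of [x]. *)
Lemma submersive_section X Y (f : X -> Y) x : smooth f -> submersive_at f x ->
  has_section f x.
Proof.
move=> sf /(split_chart sf)[k [n [W [phi [psi [V [phi' [psi' [c xW c' H]]]]]]]]].
have [Wpx pKx] := chart_psiK c xW.
pose emb b := row_mx (lsubmx (psi x)) b : 'rV[R]_(k + n).
have cemb : Cinfty setT emb.
  by apply: Cinfty_row_mx; [exact: openT|exact/Cinfty_cst/openT|exact/Cinfty_id/openT].
have oV := chart_domain_open c'.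
pose V1 := V `&` emb @^-1` W.
have oV1 : open V1.
  apply: openI => //; rewrite -[X in open X]setTI.
  exact: Cinfty_preimage_open openT (chart_domain_open c) cemb.
exists (phi' @` V1), (phi \o emb \o psi'); split.
- by apply: (chart_image_open c') => // v [].
- exists (rsubmx (psi x)); last by rewrite -(H _ Wpx).2 pKx.
  by split; [exact: (H _ Wpx).1|rewrite /preimage /= /emb hsubmxK].
- move=> m O p pO pV1; apply: (plot_comp (U := W) (f := emb \o (psi' \o p))).
  + exact: plot_open pO.
  + apply: (Cinfty_comp (plot_open pO) openT) cemb => //.
    by apply: (chart_inv c' pO) => v /pV1[y [Vy _] <-]; exists y.
  + by move=> v /pV1[y [Vy Wy] E]; rewrite /= -E (chart_cancel c' Vy).
  + exact: chart_plot c.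
- rewrite /= -{1}pKx (H _ Wpx).2 (chart_cancel c'); last exact: (H _ Wpx).1.
  by rewrite /emb hsubmxK.
- move=> y [v [Vv Wv] <-] /=; rewrite (chart_cancel c' Vv) (H _ Wv).2.
  by rewrite /emb row_mxKr.
Qed.

End LocalSmoothness.

(** * Separation and countability from two coordinate maps *)

Section Topology.
Variable R : realType.
Implicit Types X Y Z W : diffType R.

Lemma dopenE X (A : set (dtop X)) : open A = dopen (A : set X).
Proof. by []. Qed.

Lemma hausdorff_pair W X Y (a : W -> X) (b : W -> Y) : smooth a -> smooth b ->
  (forall w w', a w = a w' -> b w = b w' -> w = w') ->
  hausdorff_space (dtop X) -> hausdorff_space (dtop Y) -> hausdorff_space (dtop W).
Proof.
move=> sa sb inj; rewrite !open_hausdorff => hX hY w w' ww'.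
have sep Z (c : W -> Z) : smooth c -> (c w : dtop Z) != (c w' : dtop Z) ->
    (forall x y : dtop Z, x != y -> exists2 AB, (x \in AB.1 /\ y \in AB.2) &
      [/\ open AB.1, open AB.2 & AB.1 `&` AB.2 == set0]) ->
    exists2 AB : set (dtop W) * set (dtop W), (w \in AB.1 /\ w' \in AB.2) &
      [/\ open AB.1, open AB.2 & AB.1 `&` AB.2 == set0].
  move=> sc cw /(_ _ _ cw)[[A B] /= [wA wB] [oA oB /eqP AB]].
  exists (c @^-1` A, c @^-1` B) => /=; first by move: wA wB; rewrite !inE.
  split; [exact: dopen_preimage|exact: dopen_preimage|apply/eqP].
  by rewrite -preimage_setI AB preimage_set0.
have [aw|aw] := eqVneq (a w : dtop X) (a w'); last exact: (sep _ a sa aw hX).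
have [bw|bw] := eqVneq (b w : dtop Y) (b w'); last exact: (sep _ b sb bw hY).
by move: ww'; rewrite (inj _ _ aw bw) eqxx.
Qed.

(** The hypothesis on boxes is needed because the D-topology of a fibre product is not by definition
    induced from a product topology; it might have more open sets. *)
Lemma second_countable_pair W X Y (a : W -> X) (b : W -> Y) : smooth a -> smooth b ->
  (forall w (A : set W), dopen A -> A w -> exists (U : set X) (V : set Y),
     [/\ dopen U, dopen V, U (a w), V (b w) &
         forall w', U (a w') -> V (b w') -> A w']) ->
  @second_countable (dtop X) -> @second_countable (dtop Y) ->
  @second_countable (dtop W).
Proof.
move=> sa sb H [BX cBX [oBX bX]] [BY cBY [oBY bY]].
pose c (UV : set X * set Y) : set (dtop W) := a @^-1` UV.1 `&` b @^-1` UV.2.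
exists (c @` (BX `*` BY)).
  by apply: sub_countable (card_image_le _ _) _; exact: countableX.
split.
  move=> C [[U V] [/= /oBX oU /oBY oV] <-]; rewrite dopenE.
  by apply: dopen_setI; exact: dopen_preimage.
move=> w A; rewrite nbhsE => -[A' [oA' A'w] A'A].
have [U [V [oU oV Ua Vb UV]]] := H w A' oA' A'w.
have nU : open_nbhs (a w : dtop X) U by split.
have nV : open_nbhs (b w : dtop Y) V by split.
have [U1 [BU1 U1a] U1U] := bX (a w) U (open_nbhs_nbhs nU).
have [V1 [BV1 V1b] V1V] := bY (b w) V (open_nbhs_nbhs nV).
exists (c (U1, V1)); first by split=> //; exists (U1, V1).
by move=> w' [/U1U h1 /V1V h2]; apply: A'A; exact: UV.
Qed.

End Topology.

(** * Manifold structure of a fibre product along a submersion *)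

Section FibreProduct.
Variable R : realType.
Variables X Y Z : diffType R.
Variables (f : X -> Z) (g : Y -> Z).
Hypotheses (sf : smooth f) (ff : forall x, submersive_at f x) (sg : smooth g).

Local Notation fp := {xy : X * Y | f xy.1 = g xy.2}.

Lemma smooth_fp_fst : smooth (fun w : fp => (sval w).1).
Proof. by move=> n U p []. Qed.

Lemma smooth_fp_snd : smooth (fun w : fp => (sval w).2).
Proof. by move=> n U p []. Qed.

Section Chart.
Variables (w0 : fp) (k n l : nat).
Variables (W : set 'rV[R]_(k + n)) (phi : 'rV[R]_(k + n) -> X) (psi : X -> 'rV[R]_(k + n)).
Variables (V : set 'rV[R]_n) (phi' : 'rV[R]_n -> Z) (psi' : Z -> 'rV[R]_n).
Variables (VY : set 'rV[R]_l) (phiY : 'rV[R]_l -> Y) (psiY : Y -> 'rV[R]_l).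
Hypotheses (c : is_chart W phi psi) (c' : is_chart V phi' psi') (cY : is_chart VY phiY psiY).
Hypothesis split : forall w, W w -> V (rsubmx w) /\ f (phi w) = phi' (rsubmx w).

(** Coordinates on the fibre product are the [k] fibre coordinates in [X] and the [l] coordinates in
    [Y]. The other [n] coordinates of the point of [X] are those of its image in [Z], hence are
    dictated by [g]. *)
Let theta (u : 'rV[R]_(k + l)) : 'rV[R]_(k + n) :=
  row_mx (lsubmx u) (psi' (g (phiY (rsubmx u)))).

Definition fp_dom : set 'rV[R]_(k + l) :=
  [set u | [/\ VY (rsubmx u), (phi' @` V) (g (phiY (rsubmx u))) & W (theta u)]].

(** The equation defining the fibre product is guaranteed on [fp_dom]; where it fails, the value is
    the default [w0]. *)
Definition fp_phi (u : 'rV[R]_(k + l)) : fp :=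
  if pselect (f (phi (theta u)) = g (phiY (rsubmx u))) is left e
  then exist (fun xy => f xy.1 = g xy.2) (phi (theta u), phiY (rsubmx u)) e else w0.

Definition fp_psi (w : fp) : 'rV[R]_(k + l) :=
  row_mx (lsubmx (psi (sval w).1)) (psiY (sval w).2).

Let fp_phiE u : fp_dom u -> sval (fp_phi u) = (phi (theta u), phiY (rsubmx u)).
Proof.
move=> [Vu /(chart_psiK c')[_ gu] Wu]; rewrite /fp_phi; case: pselect => //= -[].
by rewrite (split Wu).2 /theta row_mxKr gu.
Qed.

Lemma fp_dom_theta wx b : W wx -> VY b -> f (phi wx) = g (phiY b) ->
  fp_dom (row_mx (lsubmx wx) b) /\ theta (row_mx (lsubmx wx) b) = wx.
Proof.
move=> Wx Vb E; have [Vr fr] := split Wx.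
have tE : theta (row_mx (lsubmx wx) b) = wx.
  by rewrite /theta row_mxKl row_mxKr -E fr (chart_cancel c' Vr) hsubmxK.
split=> //; split; rewrite ?tE ?row_mxKr // -E fr.
by exists (rsubmx wx).
Qed.

Let O1 : set 'rV[R]_(k + l) := [set u | VY (rsubmx u)].

Let cr m1 m2 : Cinfty (@setT 'rV[R]_(m1 + m2)) (fun u : 'rV[R]_(m1 + m2) => rsubmx u).
Proof. exact/Cinfty_rsubmx/openT. Qed.

Let oO1 : open O1.
Proof.
rewrite -[X in open X]setTI.
exact: (Cinfty_preimage_open openT (chart_domain_open cY) (@cr k l)).
Qed.

Let pO1 : plot O1 (phiY \o (fun u : 'rV[R]_(k + l) => rsubmx u)).
Proof.
by apply: plot_comp (chart_plot cY) => //; exact: Cinfty_sub (@subsetT _ _) (@cr k l).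
Qed.

Let O2 := O1 `&` (g \o (phiY \o (fun u : 'rV[R]_(k + l) => rsubmx u))) @^-1` (phi' @` V).

Let oO2 : open O2.
Proof. by apply: (chart_open c'); apply: sg; exact: pO1. Qed.

Let ctheta : Cinfty O2 theta.
Proof.
apply: Cinfty_row_mx => //.
  by apply: Cinfty_sub (@subsetT _ _) _; exact/Cinfty_lsubmx/openT.
apply: (chart_inv c' (p := g \o (phiY \o (fun u : 'rV[R]_(k + l) => rsubmx u)))).
  by apply: plot_restrict oO2 (@subIsetl _ _ _) _; apply: sg; exact: pO1.
by move=> v [].
Qed.

Let fp_domE : fp_dom = O2 `&` theta @^-1` W.
Proof. by apply/seteqP; split=> u [] => [h1 h2 h3|[h1 h2] h3]. Qed.

Lemma fp_dom_open : open fp_dom.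
Proof.
by rewrite fp_domE; apply: Cinfty_preimage_open ctheta => //; exact: chart_domain_open c.
Qed.

Lemma fp_image : fp_phi @` fp_dom =
  [set w | (phi @` W) (sval w).1 /\ (phiY @` VY) (sval w).2].
Proof.
apply/seteqP; split=> w.
  by move=> [u Du <-] /=; rewrite fp_phiE //=; case: Du => h1 h2 h3; split;
    [exists (theta u)|exists (rsubmx u)].
move=> [[wx Wx E1] [b Vb E2]].
have E : f (phi wx) = g (phiY b) by rewrite E1 E2; exact: (svalP w).
have [D tE] := fp_dom_theta Wx Vb E.
exists (row_mx (lsubmx wx) b) => //; apply: sig_eq; rewrite fp_phiE // tE row_mxKr E1 E2.
by case: (sval w).
Qed.

Lemma fp_chart : is_chart fp_dom fp_phi fp_psi.
Proof.
split.
- rewrite fp_image; apply: (dopen_setI (A := [set w : fp | (phi @` W) (sval w).1])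
    (B := [set w : fp | (phiY @` VY) (sval w).2])).
    exact: (dopen_preimage (chart_open c) smooth_fp_fst).
  exact: (dopen_preimage (chart_open cY) smooth_fp_snd).
- split.
    apply: (@plot_ext _ _ _ _ (phi \o theta)); first by move=> u Du /=; rewrite fp_phiE.
    apply: plot_comp (chart_plot c); first exact: fp_dom_open.
      by rewrite fp_domE; apply: Cinfty_sub ctheta => u [].
    by move=> u [].
  apply: (@plot_ext _ _ _ _ (phiY \o (fun u : 'rV[R]_(k + l) => rsubmx u))).
    by move=> u Du /=; rewrite fp_phiE.
  by apply: plot_restrict pO1; [exact: fp_dom_open|move=> u []].
- move=> u Du; rewrite /fp_psi fp_phiE //=; case: Du => Vu _ Wu.
  by rewrite (chart_cancel c Wu) (chart_cancel cY Vu) /theta row_mxKl hsubmxK.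
- move=> m O p pO; rewrite fp_image => pP; have oO := plot_open pO.
  apply: Cinfty_row_mx => //.
    apply: (Cinfty_comp (f := psi \o (fun v => (sval (p v)).1)) oO openT) => //.
      apply: (chart_inv c) => [|v /pP[]//]; exact: (smooth_fp_fst pO).
    exact/Cinfty_lsubmx/openT.
  apply: (chart_inv cY (p := fun v => (sval (p v)).2)) => [|v /pP[]//].
  exact: (smooth_fp_snd pO).
Qed.

(** Read in the chart, [A] contains a ball for the sup norm, which is a product of a ball in the
    fibre coordinates of [X] and a ball in the coordinates of [Y]. *)
Lemma fp_box (A : set fp) : dopen A -> A w0 -> (phi @` W) (sval w0).1 ->
  (phiY @` VY) (sval w0).2 ->
  exists (U1 : set X) (U2 : set Y),
    [/\ dopen U1, dopen U2, U1 (sval w0).1, U2 (sval w0).2 &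
     forall w : fp, U1 (sval w).1 -> U2 (sval w).2 -> A w].
Proof.
move=> oA Aw X0 Y0; have [W0 pK0] := chart_psiK c X0.
have [V0 pY0] := chart_psiK cY Y0.
have E : f (phi (psi (sval w0).1)) = g (phiY (psiY (sval w0).2)).
  by rewrite pK0 pY0; exact: (svalP w0).
have [D0 tE] := fp_dom_theta W0 V0 E.
set u0 := row_mx _ _ in D0 tE.
have oP := oA _ _ _ (chart_plot fp_chart).
have Pu0 : (fp_dom `&` fp_phi @^-1` A) u0.
  split=> //=; suff -> : fp_phi u0 = w0 by [].
  by apply: sig_eq; rewrite fp_phiE // tE row_mxKr pK0 pY0; case: (sval w0).
have /nbhs_ballP[e /= e0 he] := open_nbhs_nbhs (conj oP Pu0).
have cl m1 m2 : Cinfty (@setT 'rV[R]_(m1 + m2)) (fun u : 'rV[R]_(m1 + m2) => lsubmx u).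
  exact/Cinfty_lsubmx/openT.
pose W1 := W `&` (fun u : 'rV[R]_(k + n) => lsubmx u) @^-1` ball (lsubmx (psi (sval w0).1)) e.
pose V1 := VY `&` ball (psiY (sval w0).2) e.
have oW1 : open W1.
  apply: openI; first exact: chart_domain_open c.
  by rewrite -[X in open X]setTI; apply: Cinfty_preimage_open openT _ (@cl k n); exact: ball_open.
have oV1 : open V1 by apply: openI; [exact: chart_domain_open cY|exact: ball_open].
exists (phi @` W1), (phiY @` V1); split.
- by apply: (chart_image_open c) => // v [].
- by apply: (chart_image_open cY) => // v [].
- by exists (psi (sval w0).1) => //; split=> //; exact: ballxx.
- by exists (psiY (sval w0).2) => //; split=> //; exact: ballxx.
move=> w [wx [Wx Bx] E1] [b [Vb Bb] E2].
have Ew : f (phi wx) = g (phiY b) by rewrite E1 E2; exact: (svalP w).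
have [Dw tw] := fp_dom_theta Wx Vb Ew.
have Bu : ball u0 e (row_mx (lsubmx wx) b).
  move: Bx Bb; rewrite /u0 /preimage -!ball_normE /ball_ /= => Bx Bb.
  rewrite opp_row_mx add_row_mx [ltLHS]/Num.Def.normr /= mx_normrE.
  apply: bigmax_lt => // -[i j] _ /=; rewrite mxE; case: fintype.split => j';
    [apply: le_lt_trans Bx|apply: le_lt_trans Bb]; rewrite (ord1 i); exact: coord_le_norm.
have [_] := he _ Bu; rewrite /preimage /=.
suff -> : fp_phi (row_mx (lsubmx wx) b) = w by [].
by apply: sig_eq; rewrite fp_phiE // tw row_mxKr E1 E2; case: (sval w).
Qed.

End Chart.

Lemma fp_manifold : manifold X -> manifold Y -> manifold fp.
Proof.
move=> mX mY; have sel (w : fp) := split_chart sf (ff (sval w).1).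
split.
- move=> w; have [k [n [W [phi [psi [V [phi' [psi' [c Ux c' H]]]]]]]]] := sel w.
  have [l [VY [phiY [psiY [cY VYy]]]]] := manifold_chart mY (sval w).2.
  have C := fp_chart w c c' cY H.
  exists (k + l)%N; do 3!eexists; split; first exact: C.
  by rewrite fp_image.
- apply: (hausdorff_pair smooth_fp_fst smooth_fp_snd).
  + move=> w w' h1 h2; apply: sig_eq; move: h1 h2.
    by case: (sval w) (sval w') => [x y] [x' y'] /= -> ->.
  + exact: manifold_hausdorff.
  + exact: manifold_hausdorff.
- apply: (second_countable_pair smooth_fp_fst smooth_fp_snd).
  + move=> w A oA Aw.
    have [k [n [W [phi [psi [V [phi' [psi' [c Ux c' H]]]]]]]]] := sel w.
    have [l [VY [phiY [psiY [cY VYy]]]]] := manifold_chart mY (sval w).2.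
    exact: (fp_box c c' cY H oA Aw).
  + exact: manifold_countable.
  + exact: manifold_countable.
Qed.

End FibreProduct.

(** * Pull-backs of Lie groupoids *)

Section Diffeomorphisms.
Variable R : realType.
Implicit Types X Y Z : diffType R.

Lemma diffeo_id X : diffeo (@id X).
Proof. by split; [exact: smooth_id|exists id; split]. Qed.

Lemma can_diffeo X Y (f : X -> Y) (g : Y -> X) :
  smooth f -> smooth g -> cancel f g -> cancel g f -> diffeo f.
Proof. by move=> sf sg fK gK; split=> //; exists g; split. Qed.

Lemma diffeo_comp X Y Z (f : X -> Y) (g : Y -> Z) :
  diffeo f -> diffeo g -> diffeo (g \o f).
Proof.
move=> [sf [f' [sf' fK f'K]]] [sg [g' [sg' gK g'K]]].
split; first exact: smooth_comp.
exists (f' \o g'); split; first exact: smooth_comp.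
  by move=> x /=; rewrite gK fK.
by move=> x /=; rewrite f'K g'K.
Qed.

Lemma diffeo_inj X Y (f : X -> Y) : diffeo f -> injective f.
Proof. by move=> [_ [g [_ fK _]]]; exact: can_inj fK. Qed.

Lemma manifold_diffeo X Y (f : X -> Y) : diffeo f -> manifold X -> manifold Y.
Proof.
move=> [sf [g [sg fK gK]]] mX; split.
- move=> y; have [n [U [phi [psi [c [u Uu gy]]]]]] := manifold_chart mX (g y).
  exists n, U, (f \o phi), (psi \o g); split; last by exists u; rewrite //= gy gK.
  have imE : (f \o phi) @` U = g @^-1` (phi @` U).
    apply/seteqP; split=> z /=; first by move=> [v Vv <-]; exists v; rewrite // fK.
    by move=> [v Vv E]; exists v; rewrite // E gK.
  split.
  + by rewrite imE; exact: dopen_preimage (chart_open c) sg.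
  + exact: sf (chart_plot c).
  + by move=> v Uv /=; rewrite fK (chart_cancel c Uv).
  + move=> m V p pV; rewrite imE => pP.
    by apply: (chart_inv c (p := g \o p)) => //; exact: sg.
- by apply: (hausdorff_pair sg sg _ (manifold_hausdorff mX) (manifold_hausdorff mX))
    => w w' /(can_inj gK).
- apply: (second_countable_pair sg sg _ (manifold_countable mX) (manifold_countable mX)).
  move=> w A oA Aw; exists (f @^-1` A), setT; split.
  + exact: dopen_preimage.
  + exact: dopen_setT.
  + by rewrite /preimage /= gK.
  + by [].
  + by move=> w'; rewrite /preimage /= gK.
Qed.

(* Between manifolds these are the surjective submersions; unlike the latter
   they are stable under composition and base change for formal reasons. *)
Definition loc_split X Y (f : X -> Y) : Prop :=
  [/\ smooth f, forall x, has_section f x & forall y, exists x, f x = y].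

Lemma surj_submersion_split X Y (f : X -> Y) : surj_submersion f -> loc_split f.
Proof.
by move=> [sf ff hf]; split=> // x; exact: submersive_section.
Qed.

Lemma split_surj_submersion X Y (f : X -> Y) : manifold X -> manifold Y ->
  loc_split f -> surj_submersion f.
Proof.
move=> mX mY [sf ff hf]; split=> // x.
by apply: section_submersive => //; exact: manifold_chart.
Qed.

Lemma has_section_comp X Y Z (f : X -> Y) (g : Y -> Z) x :
  has_section f x -> has_section g (f x) -> has_section (g \o f) x.
Proof.
move=> [V [s [oV Vf ss sf fs]]] [W [t [oW Wg st tg gt]]].
exists (W `&` t @^-1` V), (s \o t); split=> /=.
- exact: dopen_smooth_on.
- by split=> //=; rewrite tg.
- apply: (smooth_on_comp (B := V)) => // [n U p pU pW|z []//].
  by apply: st => // u /pW[].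
- by rewrite tg sf.
- by move=> z [Wz Vz]; rewrite fs // gt.
Qed.

Lemma loc_split_comp X Y Z (f : X -> Y) (g : Y -> Z) :
  loc_split f -> loc_split g -> loc_split (g \o f).
Proof.
move=> [sf ff hf] [sg gg hg]; split; first exact: smooth_comp.
  by move=> x; exact: has_section_comp.
by move=> z; have [y <-] := hg z; have [x <-] := hf y; exists x.
Qed.

Lemma diffeo_split X Y (f : X -> Y) : diffeo f -> loc_split f.
Proof.
move=> [sf [g [sg fK gK]]]; split=> // [x|y]; last by exists (g y).
exists setT, g; split=> //; [exact: dopen_setT|exact: smooth_smooth_on].
Qed.

Section Base.
Variables (X Y Z : diffType R) (f : X -> Z) (g : Y -> Z).
Local Notation fp := {xy : X * Y | f xy.1 = g xy.2}.

(** A local section [s] of [f] induces [y |-> (s (g y), y)], completed by the default [w] where this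
    pair leaves the fibre product. *)
Lemma fp_snd_split : loc_split f -> smooth g -> loc_split (fun w : fp => (sval w).2).
Proof.
move=> [sf ff hf] sg; split; first exact: smooth_fp_snd.
  move=> w; have [V [s [oV Vf ss sx fs]]] := ff (sval w).1.
  rewrite (svalP w) in Vf sx.
  pose t (y : Y) : fp := if pselect (f (s (g y)) = g y) is left e
    then exist _ (s (g y), y) e else w.
  have tE y : V (g y) -> sval (t y) = (s (g y), y).
    by move=> /fs e; rewrite /t; case: pselect.
  exists (g @^-1` V), t; split=> //.
  - exact: dopen_preimage.
  - move=> n U p pU pV; suff : plot U (sval \o (t \o p)) by [].
    apply: (@plot_ext _ _ _ _ (fun u => (s (g (p u)), p u))).
      by move=> u Uu /=; rewrite tE //; exact: pV.
    split=> //; apply: (ss _ _ (g \o p)) => //; exact: sg.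
  - by apply: sig_eq; rewrite tE // sx; case: (sval w).
  - by move=> y Vy; rewrite tE.
move=> y; have [x e] := hf (g y).
by exists (exist _ (x, y) e : fp).
Qed.

End Base.

Section Flip.
Variables (X Y Z : diffType R) (f : X -> Z) (g : Y -> Z).
Local Notation fp := {xy : X * Y | f xy.1 = g xy.2}.
Local Notation fp' := {yx : Y * X | g yx.1 = f yx.2}.

Definition fp_flip (w : fp) : fp' :=
  exist (fun yx => g yx.1 = f yx.2) ((sval w).2, (sval w).1) (esym (svalP w)).

End Flip.

Lemma fp_flip_diffeo X Y Z (f : X -> Z) (g : Y -> Z) : diffeo (@fp_flip X Y Z f g).
Proof.
have s X' Y' Z' f' g' : smooth (@fp_flip X' Y' Z' f' g').
  by apply: smooth_sig; apply: smooth_pair; [exact: smooth_fp_snd|exact: smooth_fp_fst].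
split; first exact: s.
exists (@fp_flip Y X Z g f); split; first exact: s.
  by move=> w; apply: sig_eq => /=; case: (sval w).
by move=> w; apply: sig_eq => /=; case: (sval w).
Qed.

Lemma fp_fst_split X Y Z (f : X -> Z) (g : Y -> Z) :
  loc_split g -> smooth f ->
  loc_split (fun w : {xy : X * Y | f xy.1 = g xy.2} => (sval w).1).
Proof.
move=> sg sf.
exact: loc_split_comp (diffeo_split (fp_flip_diffeo f g)) (fp_snd_split sg sf).
Qed.

Lemma fp_manifold_l X Y Z (f : X -> Z) (g : Y -> Z) :
  surj_submersion f -> smooth g -> manifold X -> manifold Y ->
  manifold {xy : X * Y | f xy.1 = g xy.2}.
Proof. by move=> [sf ff _] sg; exact: fp_manifold. Qed.

Lemma fp_manifold_r X Y Z (f : X -> Z) (g : Y -> Z) :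
  surj_submersion g -> smooth f -> manifold X -> manifold Y ->
  manifold {xy : X * Y | f xy.1 = g xy.2}.
Proof.
move=> hg sf mX mY; apply: (manifold_diffeo (fp_flip_diffeo g f)).
exact: fp_manifold_l.
Qed.

End Diffeomorphisms.

Lemma invK (R : realType) (N : diffType R) (S : groupoid N) (x : S) : inv (inv x) = x.
Proof.
have e1 : tgt (inv (inv x)) = src (inv x) by rewrite tgt_inv.
have e2 : tgt (inv x) = src x by rewrite tgt_inv.
have e3 : tgt (inv (inv x)) = src (comp e2) by rewrite src_comp tgt_inv.
have e4 : tgt (comp e1) = src x by rewrite tgt_comp tgt_inv.
have := compA e3 e4.
rewrite (comp_idr_eq e3); last by rewrite comp_invl tgt_inv src_inv.
by rewrite (comp_idl_eq e4) // comp_invl tgt_inv.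
Qed.

Section PullbackLie.
Variable R : realType.
Variables (M M' : diffType R) (p : M' -> M) (Q : groupoid M).

Lemma smooth_pb_fst : smooth (fun z : pb_arr p Q => (sval z).1.1).
Proof. by move=> n U u [[]]. Qed.

Lemma smooth_pb_mid : smooth (fun z : pb_arr p Q => (sval z).1.2).
Proof. by move=> n U u [[]]. Qed.

Lemma smooth_pb_snd : smooth (fun z : pb_arr p Q => (sval z).2).
Proof. by move=> n U u [[]]. Qed.

Lemma smooth_pb (X : diffType R) (f : X -> pb_arr p Q) :
  smooth (fun x => (sval (f x)).1.1) -> smooth (fun x => (sval (f x)).1.2) ->
  smooth (fun x => (sval (f x)).2) -> smooth f.
Proof. by move=> h1 h2 h3 n U u uU; split; [split|]; [exact: h1|exact: h2|exact: h3]. Qed.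

Lemma pb_eq (z z' : pb_arr p Q) : (sval z).1.1 = (sval z').1.1 ->
  (sval z).1.2 = (sval z').1.2 -> (sval z).2 = (sval z').2 -> z = z'.
Proof.
move=> h1 h2 h3; apply: sig_eq; move: h1 h2 h3.
by case: (sval z) (sval z') => [[a b] c] [[a' b'] c'] /= -> -> ->.
Qed.

Hypotheses (hQ : lie_groupoid Q) (mM' : manifold M') (hp : surj_submersion p).

(** The arrows of the pull-back are rewritten as two successive binary fibre products, each along
    the submersion [p]. *)
Let A1 : diffType R := {mq : M' * Q | p mq.1 = src mq.2}.
Let A2 : diffType R := {wn : A1 * M' | tgt (sval wn.1).2 = p wn.2}.

Let sp : smooth p. Proof. exact: surj_subm_smooth hp. Qed.
Let stg : smooth (fun w : A1 => tgt (sval w).2).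
Proof.
apply: (smooth_comp (f := fun w : A1 => (sval w).2) (g := @tgt _ _ Q)); first exact: smooth_fp_snd.
exact: surj_subm_smooth (lieg_tgt hQ).
Qed.

Let mA1 : manifold A1.
Proof.
apply: fp_manifold_l => //; last exact: lieg_arr.
exact: surj_subm_smooth (lieg_src hQ).
Qed.

Let mA2 : manifold A2.
Proof. exact: (fp_manifold_r hp stg mA1 mM'). Qed.

Let toA2 (z : pb_arr p Q) : A2 :=
  exist (fun wn : A1 * M' => tgt (sval wn.1).2 = p wn.2)
    (exist (fun mq : M' * Q => p mq.1 = src mq.2) (sval z).1 (svalP z).1, (sval z).2)
    (svalP z).2.

Let ofA2 (w : A2) : pb_arr p Q :=
  exist (fun z : M' * Q * M' => p z.1.1 = src z.1.2 /\ tgt z.1.2 = p z.2)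
    (sval (sval w).1, (sval w).2) (conj (svalP (sval w).1) (svalP w)).

Let toA2_smooth : smooth toA2.
Proof. by move=> n U u [h1 h2]; split. Qed.
Let ofA2_smooth : smooth ofA2.
Proof. by move=> n U u [h1 h2]; split. Qed.
Let toA2K : cancel toA2 ofA2.
Proof. by move=> z; apply: sig_eq => /=; case: (sval z). Qed.
Let ofA2K : cancel ofA2 toA2.
Proof.
move=> w; apply: sig_eq => /=; rewrite [RHS]surjective_pairing; congr (_, _).
exact: sig_eq.
Qed.

Lemma pullback_manifold : manifold (pb_arr p Q).
Proof. exact: (manifold_diffeo (can_diffeo ofA2_smooth toA2_smooth ofA2K toA2K)). Qed.

Lemma pullback_src_split : loc_split (fun z : pb_arr p Q => (sval z).1.1).
Proof.
have h1 := diffeo_split (can_diffeo toA2_smooth ofA2_smooth toA2K ofA2K).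
have h2 := fp_fst_split (surj_submersion_split hp) stg.
have h3 := fp_fst_split (surj_submersion_split (lieg_src hQ)) sp.
exact: loc_split_comp h1 (loc_split_comp h2 h3).
Qed.

Lemma pullback_inv_smooth : smooth (@pb_inv _ _ _ p Q).
Proof.
apply: smooth_pb; [exact: smooth_pb_snd| |exact: smooth_pb_fst].
exact: smooth_comp smooth_pb_mid (lieg_inv hQ).
Qed.

Lemma lie_pullback : lie_groupoid (pullback p Q).
Proof.
split=> //.
- exact: pullback_manifold.
- exact: split_surj_submersion pullback_manifold mM' pullback_src_split.
- apply: (split_surj_submersion pullback_manifold mM').
  (* The target is the source composed with inversion, a diffeomorphism, so the result for the
     source carries over. *)
  have iK : cancel (@pb_inv _ _ _ p Q) (@pb_inv _ _ _ p Q).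
    by move=> z; exact: (@invK _ _ (pullback p Q)).
  have : loc_split (@pb_inv _ _ _ p Q).
    apply: diffeo_split; split; first exact: pullback_inv_smooth.
    by exists (@pb_inv _ _ _ p Q); split=> //; exact: pullback_inv_smooth.
  by move=> /loc_split_comp/(_ pullback_src_split).
- apply: smooth_pb; [exact: smooth_id| |exact: smooth_id].
  exact: smooth_comp sp (lieg_idm hQ).
- exact: pullback_inv_smooth.
- apply: smooth_pb.
  + exact: smooth_comp (smooth_comp (@smooth_sval _ _ _) (@smooth_fst _ _ _)) smooth_pb_fst.
  + pose c (z : {xy : pullback p Q * pullback p Q | tgt xy.1 = src xy.2}) :
        {xy : Q * Q | tgt xy.1 = src xy.2} :=
      exist (fun xy : Q * Q => tgt xy.1 = src xy.2)
        ((sval (sval z).1).1.2, (sval (sval z).2).1.2) (pb_composable (svalP z)).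
    have sc : smooth c.
      apply: smooth_sig; apply: smooth_pair.
        exact: smooth_comp (smooth_comp (@smooth_sval _ _ _) (@smooth_fst _ _ _)) smooth_pb_mid.
      exact: smooth_comp (smooth_comp (@smooth_sval _ _ _) (@smooth_snd _ _ _)) smooth_pb_mid.
    apply: (smooth_ext _ (smooth_comp sc (lieg_comp hQ))) => z.
    exact: comp_congr.
  + exact: smooth_comp (smooth_comp (@smooth_sval _ _ _) (@smooth_snd _ _ _)) smooth_pb_snd.
Qed.

End PullbackLie.

(** * Isomorphisms of extensions *)

Section GroupoidAlgebra.
Variables (R : realType) (M : diffType R) (Q : groupoid M).
Implicit Types x y z : Q.

(* Total extension of the partial product, with junk value [x] when the product
   is not defined. *)
Definition gmul x y : Q :=
  if pselect (tgt x = src y) is left e then comp e else x.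

Lemma gmulE x y (e : tgt x = src y) : gmul x y = comp e.
Proof. by rewrite /gmul; case: pselect => // e'; exact: comp_congr. Qed.

Lemma src_gmul x y : tgt x = src y -> src (gmul x y) = src x.
Proof. by move=> e; rewrite (gmulE e) src_comp. Qed.

Lemma tgt_gmul x y : tgt x = src y -> tgt (gmul x y) = tgt y.
Proof. by move=> e; rewrite (gmulE e) tgt_comp. Qed.

Lemma gmulA x y z : tgt x = src y -> tgt y = src z ->
  gmul x (gmul y z) = gmul (gmul x y) z.
Proof.
move=> e1 e2.
have e3 : tgt x = src (gmul y z) by rewrite src_gmul.
have e4 : tgt (gmul x y) = src z by rewrite tgt_gmul.
rewrite (gmulE e3) (gmulE e4); move: e3 e4.
by rewrite (gmulE e1) (gmulE e2) => e3 e4; exact: compA.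
Qed.

Lemma gmulV x : gmul x (inv x) = idm Q (src x).
Proof.
have e : tgt x = src (inv x) by rewrite src_inv.
by rewrite (gmulE e) comp_invr.
Qed.

Lemma gVmul x : gmul (inv x) x = idm Q (tgt x).
Proof.
have e : tgt (inv x) = src x by rewrite tgt_inv.
by rewrite (gmulE e) comp_invl.
Qed.

Lemma g1mul x m : m = src x -> gmul (idm Q m) x = x.
Proof.
move=> ->; have e : tgt (idm Q (src x)) = src x by rewrite tgt_idm.
by rewrite (gmulE e) comp_idl.
Qed.

Lemma gmul1 x m : m = tgt x -> gmul x (idm Q m) = x.
Proof.
move=> ->; have e : tgt x = src (idm Q (tgt x)) by rewrite src_idm.
by rewrite (gmulE e) comp_idr.
Qed.

Lemma gmulKV x y : src x = src y -> gmul x (gmul (inv x) y) = y.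
Proof.
move=> e; rewrite gmulA ?src_inv ?tgt_inv // gmulV g1mul //.
Qed.

Lemma gmulK x y : tgt x = src y -> gmul (gmul x y) (inv y) = x.
Proof. by move=> e; rewrite -gmulA ?src_inv // gmulV gmul1. Qed.

Lemma conjugatesE r k k' : conjugates r k k' ->
  k' = gmul (gmul r k) (inv r) /\ tgt r = src k /\ tgt k = tgt r.
Proof.
move=> [rk [e <-] [e' <-]]; rewrite (gmulE e) (gmulE e'); do 2!split=> //.
by rewrite -(tgt_comp e) e' src_inv.
Qed.

Lemma conjugates_gmul r k : tgt r = src k -> tgt k = tgt r ->
  conjugates r k (gmul (gmul r k) (inv r)).
Proof.
move=> e1 e2; exists (gmul r k); first by exists e1; rewrite gmulE.
have e3 : tgt (gmul r k) = src (inv r) by rewrite tgt_gmul // src_inv.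
by exists e3; rewrite -gmulE.
Qed.

Lemma composesE x y z : composes x y z <-> tgt x = src y /\ gmul x y = z.
Proof.
split; first by move=> [e <-]; rewrite (gmulE e).
by move=> [e <-]; exists e; rewrite (gmulE e).
Qed.

Lemma smooth_gmul (X : diffType R) (f g : X -> Q) : lie_groupoid Q ->
  smooth f -> smooth g -> (forall a, tgt (f a) = src (g a)) ->
  smooth (fun a => gmul (f a) (g a)).
Proof.
move=> hQ sf sg e.
pose c a : {xy : Q * Q | tgt xy.1 = src xy.2} :=
  exist (fun xy : Q * Q => tgt xy.1 = src xy.2) (f a, g a) (e a).
have sc : smooth c by apply: smooth_sig; exact: smooth_pair.
apply: (smooth_ext _ (smooth_comp sc (lieg_comp hQ))) => a /=.
by rewrite (gmulE (e a)); exact: comp_congr.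
Qed.

End GroupoidAlgebra.

Section Morphisms.
Variable R : realType.

Lemma gmor_gmul (M : diffType R) (Q Q' : groupoid M) (f : gmor Q Q') (x y : Q) :
  tgt x = src y -> f (gmul x y) = gmul (f x) (f y).
Proof.
move=> e; have e' : tgt (f x) = src (f y) by rewrite gmor_tgt gmor_src.
by rewrite (gmulE e) (gmulE e') (gmor_comp e e').
Qed.

(** Preservation of units is not a field of [gmor]: it follows because the image of a unit is
    idempotent, and idempotents of a groupoid are units. *)
Lemma gmor_idm (M : diffType R) (Q Q' : groupoid M) (f : gmor Q Q') m :
  f (idm Q m) = idm Q' m.
Proof.
have e : tgt (f (idm Q m)) = src (f (idm Q m)).
  by rewrite gmor_tgt gmor_src tgt_idm src_idm.
have uu : gmul (f (idm Q m)) (f (idm Q m)) = f (idm Q m).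
  by rewrite -gmor_gmul ?tgt_idm ?src_idm // g1mul ?src_idm.
by rewrite -[LHS](gmulK e) uu gmulV gmor_src src_idm.
Qed.

Lemma gmor_inv (M : diffType R) (Q Q' : groupoid M) (f : gmor Q Q') (x : Q) :
  f (inv x) = inv (f x).
Proof.
have e : tgt (f (inv x)) = src (f x) by rewrite gmor_tgt gmor_src tgt_inv.
rewrite -[LHS](gmulK e) -gmor_gmul ?tgt_inv // gVmul gmor_idm g1mul //.
by rewrite src_inv gmor_tgt.
Qed.

Lemma gmor_comp_eq (M : diffType R) (Q Q' : groupoid M) (f : Q -> Q') :
  (forall x, src (f x) = src x) -> (forall x, tgt (f x) = tgt x) ->
  (forall x y, tgt x = src y -> f (gmul x y) = gmul (f x) (f y)) ->
  forall x y (e : tgt x = src y) (e' : tgt (f x) = src (f y)), f (comp e) = comp e'.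
Proof. by move=> fs ft fM x y e e'; rewrite -(gmulE e) -(gmulE e') fM. Qed.

Definition gmor_id (M : diffType R) (Q : groupoid M) : gmor Q Q :=
  @Gmor R M Q Q id (fun=> erefl) (fun=> erefl) (fun _ _ _ _ => comp_congr _ _ erefl erefl).

Lemma gmor_inverse (M : diffType R) (Q Q' : groupoid M) (f : gmor Q Q') : diffeo f ->
  exists g : gmor Q' Q, [/\ diffeo g, cancel f g & cancel g f].
Proof.
move=> [sf [g [sg fK gK]]].
have gs x : src (g x) = src x by rewrite -[in RHS](gK x) gmor_src.
have gt x : tgt (g x) = tgt x by rewrite -[in RHS](gK x) gmor_tgt.
have gM x y : tgt x = src y -> g (gmul x y) = gmul (g x) (g y).
  move=> e; apply: (can_inj fK); rewrite gmor_gmul ?gs ?gt //.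
  by rewrite !gK.
exists (@Gmor R M Q' Q g gs gt (gmor_comp_eq gs gt gM)); split=> //.
exact: can_diffeo sg sf gK fK.
Qed.

Lemma pullback_mor_diffeo (M M' : diffType R) (p : M' -> M) (Q Q' : groupoid M)
    (f : gmor Q Q') : diffeo f -> diffeo (pullback_mor p f).
Proof.
move=> df; have [g [[sg _] fK gK]] := gmor_inverse df; have [sf _] := df.
have s (Q1 Q2 : groupoid M) (k : gmor Q1 Q2) : smooth k -> smooth (pullback_mor p k).
  move=> sk; apply: smooth_pb; [exact: smooth_pb_fst| |exact: smooth_pb_snd].
  exact: smooth_comp (@smooth_pb_mid _ _ _ p Q1) sk.
apply: (can_diffeo (s _ _ _ sf) (s _ _ _ sg)) => z; by apply: pb_eq => /=.
Qed.

Section Flatten.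
Variables (B0 M M' : diffType R) (B : groupoid B0).
Variables (q : M -> B0) (p : M' -> M) (h : M' -> B0).
Hypothesis hE : forall n, h n = q (p n).

Lemma unflatten_subproof1 (z : pullback h B) :
  q (p (sval z).1.1) = src (sval z).1.2 /\ tgt (sval z).1.2 = q (p (sval z).2).
Proof. by rewrite -!hE; exact: (svalP z). Qed.

Definition unflatten (z : pullback h B) : pullback p (pullback q B) :=
  exist _ ((sval z).1.1,
    exist _ (p (sval z).1.1, (sval z).1.2, p (sval z).2) (unflatten_subproof1 z),
    (sval z).2) (conj erefl erefl).

Lemma flatten_diffeo : smooth p -> diffeo (flatten_mor B hE).
Proof.
move=> sp; apply: (can_diffeo (g := unflatten)).
- apply: smooth_pb; [exact: smooth_pb_fst| |exact: smooth_pb_snd].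
  by move=> n U u [[_ [[]]]].
- apply: smooth_pb; [exact: smooth_pb_fst| |exact: smooth_pb_snd].
  apply: smooth_pb; [|exact: smooth_pb_mid|].
    exact: smooth_comp (@smooth_pb_fst _ _ _ _ _) sp.
  exact: smooth_comp (@smooth_pb_snd _ _ _ _ _) sp.
- move=> z; apply: pb_eq => //=; have [e1 e2] := svalP z.
  by apply: pb_eq => //=.
- by move=> z; exact: pb_eq.
Qed.

Lemma flatten_inj : injective (flatten_mor B hE).
Proof.
move=> z z' E; have := congr1 sval E => -[e1 e2 e3].
have [a1 a2] := svalP z; have [a3 a4] := svalP z'.
apply: pb_eq => //; apply: pb_eq => //.
  by rewrite -[LHS]a1 -[RHS]a3 e1.
by rewrite [LHS]a2 [RHS]a4 e3.
Qed.

End Flatten.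
End Morphisms.

Section IsoAlgebra.
Variables (R : realType) (X : crossedModule R).
Local Notation G := (cmG X).
Local Notation H := (cmH X).

Lemma lact_congr (M : diffType R) (Q : groupoid M) (E : ext_data X Q)
    (r r' : ext_grpd E) (x x' : ext_bun E)
    (e : tgt r = ext_proj x) (e' : tgt r' = ext_proj x') :
  r = r' -> x = x' -> ext_lact e = ext_lact e'.
Proof.
move=> rr' xx'; case: r' / rr' e' => e'; case: x' / xx' e' => e'.
by rewrite (Prop_irrelevance e e').
Qed.

Section OverFixedBase.
Variables (M : diffType R) (Q : groupoid M).
Implicit Types E : ext_data X Q.

Lemma ext_iso_refl E : ext_iso E E.
Proof.
exists (gmor_id (ext_grpd E)), id; split=> //.
- by split=> //; exact: diffeo_id.
- by split=> //; exact: diffeo_id.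
by move=> r x h e e'; congr ext_ract; exact: lact_congr.
Qed.

Lemma ext_iso_trans E E' E'' : ext_iso E E' -> ext_iso E' E'' -> ext_iso E E''.
Proof.
move=> [P1 [S1 [[d1 m1] [d1' p1] a1 c1]]] [P2 [S2 [[d2 m2] [d2' p2] a2 c2]]].
exists (gmor_then P1 P2), (S2 \o S1); split.
- by split=> [|r]; [exact: diffeo_comp d1 d2|rewrite /= m2 m1].
- by split=> [|x]; [exact: diffeo_comp d1' d2'|rewrite /= p2 p1].
- move=> r x h e e' /=.
  have e1 : tgt (P1 r) = ext_proj (S1 x) by rewrite gmor_tgt p1.
  by rewrite (a1 _ _ _ _ e1) (a2 _ _ _ _ e').
- by move=> x g /=; rewrite c2 c1.
Qed.

Lemma ext_iso_sym E E' : ext_iso E E' -> ext_iso E' E.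
Proof.
move=> [P [S [[d m] [[sS [T [sT SK TK]]] p] a c]]].
have [P' [d' PK P'K]] := gmor_inverse d.
have pT x : ext_proj (T x) = ext_proj x by rewrite -[in RHS](TK x) p.
exists P', T; split.
- by split=> // r; rewrite -m P'K.
- by split=> //; exact: can_diffeo sT sS TK SK.
- move=> r x h e e'; apply: (can_inj SK); rewrite TK.
  have e1 : tgt (P (P' r)) = ext_proj (S (T x)) by rewrite P'K TK.
  rewrite (a _ _ _ _ e1); congr ext_ract; apply: lact_congr; first by rewrite P'K.
  by rewrite TK.
- by move=> x g; apply: (can_inj PK); rewrite P'K -c TK.
Qed.

End OverFixedBase.

Lemma push_ext_iso (M : diffType R) (Q Q' : groupoid M) (theta : gmor Q Q')
    (E E' : ext_data X Q) :
  ext_iso E E' -> ext_iso (push_ext theta E) (push_ext theta E').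
Proof.
move=> [P [S [[d m] [d' p] a c]]]; exists P, S; split=> //.
by split=> // r /=; rewrite m.
Qed.

Lemma push_ext_iso_inj (M : diffType R) (Q Q' : groupoid M) (theta : gmor Q Q')
    (E E' : ext_data X Q) : injective theta ->
  ext_iso (push_ext theta E) (push_ext theta E') -> ext_iso E E'.
Proof.
move=> inj [P [S [[d m] [d' p] a c]]]; exists P, S; split=> //.
by split=> // r; apply: inj; exact: m.
Qed.

Lemma smooth_pbe_fst (M M' : diffType R) (Q : groupoid M) (p : M' -> M)
  (E : ext_data X Q) : smooth (fun z : pbe_bun p E => (sval z).1).
Proof. by move=> n U u []. Qed.

Lemma smooth_pbe_snd (M M' : diffType R) (Q : groupoid M) (p : M' -> M)
  (E : ext_data X Q) : smooth (fun z : pbe_bun p E => (sval z).2).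
Proof. by move=> n U u []. Qed.

Lemma pbe_eq (M M' : diffType R) (Q : groupoid M) (p : M' -> M)
    (E : ext_data X Q) (z z' : pbe_bun p E) :
  (sval z).1 = (sval z').1 -> (sval z).2 = (sval z').2 -> z = z'.
Proof.
move=> h1 h2; apply: sig_eq; move: h1 h2.
by case: (sval z) (sval z') => [a b] [a' b'] /= -> ->.
Qed.

Lemma smooth_pbe (Y M M' : diffType R) (Q : groupoid M) (p : M' -> M)
    (E : ext_data X Q) (f : Y -> pbe_bun p E) :
  smooth (fun y => (sval (f y)).1) -> smooth (fun y => (sval (f y)).2) -> smooth f.
Proof. by move=> h1 h2 n U u uU; split; [exact: h1|exact: h2]. Qed.

Lemma pullback_ext_iso (M M' : diffType R) (Q : groupoid M) (p : M' -> M)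
    (E E' : ext_data X Q) :
  ext_iso E E' -> ext_iso (pullback_ext p E) (pullback_ext p E').
Proof.
move=> [P [S [[d m] [[sS [T [sT SK TK]]] pS] a c]]].
have pT x : ext_proj (T x) = ext_proj x by rewrite -[in RHS](TK x) pS.
have hS (z : pbe_bun p E) : ext_proj (S (sval z).1) = p (sval z).2.
  by rewrite pS; exact: (svalP z).
have hT (z : pbe_bun p E') : ext_proj (T (sval z).1) = p (sval z).2.
  by rewrite pT; exact: (svalP z).
pose S' z : pbe_bun p E' := exist _ (S (sval z).1, (sval z).2) (hS z).
pose T' z : pbe_bun p E := exist _ (T (sval z).1, (sval z).2) (hT z).
exists (pullback_mor p P), S'; split.
- split; first exact: pullback_mor_diffeo.
  by move=> r; apply: pb_eq => //=.
- split=> //; apply: (can_diffeo (g := T')).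
  + apply: smooth_pbe; last exact: smooth_pbe_snd.
    exact: smooth_comp (@smooth_pbe_fst _ _ _ _ _) sS.
  + apply: smooth_pbe; last exact: smooth_pbe_snd.
    exact: smooth_comp (@smooth_pbe_fst _ _ _ _ _) sT.
  + by move=> z; apply: pbe_eq => //=.
  + by move=> z; apply: pbe_eq => //=.
- move=> r x h e e'; apply: pbe_eq => //=.
- by move=> x g; apply: pb_eq => //=.
Qed.

Section Restriction.
Variables (B0 : diffType R) (B : groupoid B0).

(* Pull-back along [p] of an extension of B[q], seen as one of B[q \o p]. *)
Definition restr (M N : diffType R) (q : M -> B0) (p : N -> M) (h : N -> B0)
    (hE : forall n, h n = q (p n)) (E : ext_data X (pullback q B)) :
    ext_data X (pullback h B) :=
  push_ext (flatten_mor B hE) (pullback_ext p E).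

Lemma restr_iso (M N : diffType R) (q : M -> B0) (p : N -> M) (h : N -> B0)
    (hE : forall n, h n = q (p n)) (E E' : ext_data X (pullback q B)) :
  ext_iso E E' -> ext_iso (restr hE E) (restr hE E').
Proof. by move=> ?; exact/push_ext_iso/pullback_ext_iso. Qed.

(** Iterated pull-backs agree with a single one only up to forgetting the intermediate points, which
    [a] recovers. The composites [h'] and [c] are separate maps with pointwise equations, since on a
    fibre product two descriptions of the same map are equal but not convertible. *)
Lemma restr_comp (M N N' : diffType R) (q : M -> B0) (p : N -> M) (a : N' -> N)
    (c : N' -> M) (h : N -> B0) (h' : N' -> B0)
    (hE : forall n, h n = q (p n)) (hE' : forall n, h' n = h (a n))
    (hc : forall n, c n = p (a n)) (hE'' : forall n, h' n = q (c n))
    (E : ext_data X (pullback q B)) : smooth a ->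
  ext_iso (restr hE' (restr hE E)) (restr hE'' E).
Proof.
move=> sa.
have hS (z : pbe_bun a (restr hE E)) : ext_proj (sval (sval z).1).1 = c (sval z).2.
  by rewrite hc -(svalP z) (svalP (sval z).1).
have hT1 (z : pbe_bun c E) : ext_proj (sval z).1 = p (a (sval z).2).
  by rewrite (svalP z) hc.
pose S z : pbe_bun c E := exist _ ((sval (sval z).1).1, (sval z).2) (hS z).
pose T z : pbe_bun a (restr hE E) :=
  exist (fun z : ext_bun (restr hE E) * N' => ext_proj z.1 = a z.2)
    (exist (fun z : ext_bun E * N => ext_proj z.1 = p z.2)
       ((sval z).1, a (sval z).2) (hT1 z), (sval z).2) erefl.
exists (flatten_mor (ext_grpd E) hc), S; split.
- split; first exact: flatten_diffeo.
  by move=> r; apply: pb_eq.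
- split=> //; apply: (can_diffeo (g := T)).
  + apply: smooth_pbe; last exact: smooth_pbe_snd.
    by move=> n U u [[]].
  + apply: smooth_pbe; last exact: smooth_pbe_snd.
    apply: smooth_pbe; first exact: smooth_pbe_fst.
    exact: smooth_comp (@smooth_pbe_snd _ _ _ _ _) sa.
  + move=> z; apply: pbe_eq => //; apply: pbe_eq => //=.
    exact: esym (svalP z).
  + by move=> z; apply: pbe_eq.
- move=> r x k e e'; apply: pbe_eq => //=.
  by congr ext_ract; exact: lact_congr.
- by move=> x g; apply: pb_eq.
Qed.

End Restriction.
End IsoAlgebra.

(** * Pull-backs of extensions *)

Section Preservation.
Variables (R : realType) (X : crossedModule R).
Local Notation G := (cmG X).
Local Notation H := (cmH X).

Lemma kernelE (M : diffType R) (S Q : groupoid M) (phi : gmor S Q) (r : S) :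
  kernel phi r -> phi r = idm Q (src r) /\ tgt r = src r.
Proof.
move=> [m E]; have sE : src r = m by rewrite -(gmor_src phi) E src_idm.
by rewrite -(gmor_tgt phi) E tgt_idm sE.
Qed.

Section Action.
Variables (M : diffType R) (Q : groupoid M) (E : ext_data X Q).
Implicit Types (r : ext_grpd E) (x : ext_bun E).

(* Total extension of the partial action, with junk value [x]. *)
Definition gact r x : ext_bun E :=
  if pselect (tgt r = ext_proj x) is left e then ext_lact e else x.

Lemma gactE r x (e : tgt r = ext_proj x) : gact r x = ext_lact e.
Proof. by rewrite /gact; case: pselect => // e'; exact: lact_congr. Qed.

Lemma proj_gact r x : tgt r = ext_proj x -> ext_proj (gact r x) = src r.
Proof. by move=> e; rewrite (gactE e) ext_proj_lact. Qed.

Hypothesis hE : extension E.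

Lemma gact1 x : gact (idm _ (ext_proj x)) x = x.
Proof.
have e : tgt (idm (ext_grpd E) (ext_proj x)) = ext_proj x by rewrite tgt_idm.
by rewrite (gactE e) extn_lact1.
Qed.

Lemma gactM r r' x : tgt r = src r' -> tgt r' = ext_proj x ->
  gact (gmul r r') x = gact r (gact r' x).
Proof.
move=> e1 e2.
have e3 : tgt (gmul r r') = ext_proj x by rewrite tgt_gmul.
have e4 : tgt r = ext_proj (gact r' x) by rewrite proj_gact.
rewrite (gactE e3) (gactE e4); move: e3 e4; rewrite (gmulE e1) (gactE e2) => e3 e4.
exact: (extn_lactM hE).
Qed.

Lemma gact_ract r x h : tgt r = ext_proj x ->
  gact r (ext_ract x h) = ext_ract (gact r x) h.
Proof.
move=> e; have e' : tgt r = ext_proj (ext_ract x h) by rewrite ext_proj_ract.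
by rewrite (gactE e) (gactE e'); exact: (extn_lact_ract hE).
Qed.

(** The equivariance of [chi] at [h = 1]. *)
Lemma chi_gact r x g : tgt r = ext_proj x ->
  ext_chi (gact r x) g = gmul (gmul r (ext_chi x g)) (inv r).
Proof.
move=> e; have /conjugatesE[<- _] : conjugates r (ext_chi x g) (ext_chi (gact r x) g).
  rewrite -[g in ext_chi x g](cm_act1 (c := X)) (gactE e).
  by rewrite -[ext_lact e](prin_ract1 (extn_bundle hE)); exact: (extn_chi_equiv hE).
by [].
Qed.

Lemma smooth_gact (Y : diffType R) (f : Y -> ext_grpd E) (k : Y -> ext_bun E) :
  smooth f -> smooth k -> (forall y, tgt (f y) = ext_proj (k y)) ->
  smooth (fun y => gact (f y) (k y)).
Proof.
move=> sf sk e.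
pose c y : {rx : ext_grpd E * ext_bun E | tgt rx.1 = ext_proj rx.2} :=
  exist (fun rx : ext_grpd E * ext_bun E => tgt rx.1 = ext_proj rx.2) (f y, k y) (e y).
have sc : smooth c by apply: smooth_sig; exact: smooth_pair.
apply: (smooth_ext _ (smooth_comp sc (extn_lact_smooth hE))) => y /=.
by rewrite (gactE (e y)); exact: lact_congr.
Qed.

End Action.

Section Pullback.
Variables (M M' : diffType R) (p : M' -> M).

Lemma pb_kernel (S Q : groupoid M) (phi : gmor S Q) (z : pullback p S) :
  kernel (pullback_mor p phi) z <->
  (sval z).1.1 = (sval z).2 /\ kernel phi (sval z).1.2.
Proof.
split; first by move=> [m /(congr1 sval)[-> E ->]]; split=> //; exists (p m).
move=> [e k]; have [E _] := kernelE k; exists (sval z).1.1.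
by apply: pb_eq => //=; rewrite E (svalP z).1.
Qed.

Hypotheses (mM' : manifold M') (hp : surj_submersion p).
Let sp : smooth p. Proof. exact: surj_subm_smooth hp. Qed.

(** A local section of [phi] can be applied to the middle component alone: as [phi] is over the
    identity, the lift keeps its end points. *)
Lemma pullback_mor_split (S Q : groupoid M) (phi : gmor S Q) :
  loc_split phi -> loc_split (pullback_mor p phi).
Proof.
move=> [sf ff hf]; split.
- apply: smooth_pb; [exact: smooth_pb_fst| |exact: smooth_pb_snd].
  exact: smooth_comp (@smooth_pb_mid _ _ _ p S) sf.
- move=> z; have [V [s [oV Vf ss sx fs]]] := ff (sval z).1.2.
  pose t (y : pullback p Q) : pullback p S :=
    if pselect (p (sval y).1.1 = src (s (sval y).1.2) /\
                tgt (s (sval y).1.2) = p (sval y).2) is left e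
    then exist _ ((sval y).1.1, s (sval y).1.2, (sval y).2) e else z.
  have tE y : V (sval y).1.2 -> sval (t y) = ((sval y).1.1, s (sval y).1.2, (sval y).2).
    move=> /fs e; rewrite /t; case: pselect => // -[].
    by rewrite -(gmor_src phi) -(gmor_tgt phi) e; exact: (svalP y).
  exists ((fun y : pullback p Q => (sval y).1.2) @^-1` V), t; split=> //.
  + exact: dopen_preimage oV (@smooth_pb_mid _ _ _ p Q).
  + move=> n U u uU uV; suff : plot U (sval \o (t \o u)) by [].
    apply: (@plot_ext _ _ _ _ (fun v => ((sval (u v)).1.1, s (sval (u v)).1.2, (sval (u v)).2))).
      by move=> v Uv /=; rewrite tE //; exact: uV.
    split; [split|].
    * exact: (smooth_pb_fst uU).
    * by apply: (ss _ _ (fun v => (sval (u v)).1.2)) => //; exact: (smooth_pb_mid uU).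
    * exact: (smooth_pb_snd uU).
  + by apply: sig_eq; rewrite tE //= sx; case: (sval z) => [[]].
  + by move=> y Vy; apply: sig_eq; rewrite /= tE //= fs //; case: (sval y) => [[]].
- move=> y; have [x e] := hf (sval y).1.2.
  have hx : p (sval y).1.1 = src x /\ tgt x = p (sval y).2.
    by rewrite -(gmor_src phi) -(gmor_tgt phi) e; exact: (svalP y).
  exists (exist _ ((sval y).1.1, x, (sval y).2) hx).
  by apply: pb_eq.
Qed.

Section Kernel.
Variables (S Q : groupoid M) (phi : gmor S Q).

Lemma pb_diag_proof (m : M') (r : S) : kernel phi r -> src r = p m ->
  p m = src r /\ tgt r = p m.
Proof. by move=> /kernelE[_ ->]. Qed.

Definition pb_diag (m : M') (r : S) (k : kernel phi r) (e : src r = p m) : pullback p S :=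
  exist _ (m, r, m) (pb_diag_proof k e).

Lemma pb_diag_kernel (m : M') (r : S) (k : kernel phi r) (e : src r = p m) :
  kernel (pullback_mor p phi) (pb_diag k e).
Proof. exact/pb_kernel. Qed.

(** The kernel of the pull-back is the pull-back of the kernel, so [tau] over [U] yields the
    trivialisation [(x, g) |-> (x, tau (p x, g), x)] over the preimage of [U]. *)
Lemma pullback_locally_trivial : locally_trivial_kernel X phi ->
  locally_trivial_kernel X (pullback_mor p phi).
Proof.
move=> lt m; have [U [oU Um [tau [[stau [itau [sit tK iK]]] ts tm]]]] := lt (p m).
exists (p @^-1` U); split=> //; first exact: dopen_preimage.
pose U' := p @^-1` U.
pose dn (x : {x : M' | U' x}) : {x : M | U x} := exist U (p (sval x)) (svalP x).
have tk (x : {x : M' | U' x}) (g : G) : kernel phi (sval (tau (dn x, g))).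
  by case: (svalP (tau (dn x, g))).
pose tz (x : {x : M' | U' x}) (g : G) : pullback p S := pb_diag (tk x g) (ts (dn x) g).
have tzP x g : kernel (pullback_mor p phi) (tz x g) /\ U' (src (tz x g)).
  by split; [exact: pb_diag_kernel|exact: (svalP x)].
pose K' := {z : pullback p S | kernel (pullback_mor p phi) z /\ U' (src z)}.
pose tau' (xg : {x : M' | U' x} * G) : K' := exist _ (tz xg.1 xg.2) (tzP xg.1 xg.2).
have ok (w : K') : kernel phi (sval (sval w)).1.2 /\ U (src (sval (sval w)).1.2).
  have [/pb_kernel[_ k] u] := svalP w; split=> //.
  by rewrite -(svalP (sval w)).1.
pose it (w : K') : {r : S | kernel phi r /\ U (src r)} := exist _ (sval (sval w)).1.2 (ok w).
pose itau' (w : K') : {x : M' | U' x} * G :=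
  (exist U' (sval (sval w)).1.1 (svalP w).2, (itau (it w)).2).
exists tau'; split.
- apply: (can_diffeo (g := itau')).
  + apply: smooth_sig; apply: smooth_pb => /=.
    * exact: smooth_fst.
    * apply: (smooth_comp (f := fun xg : {x : M' | U' x} * G => tau (dn xg.1, xg.2))) => //.
      apply: (smooth_comp (f := fun xg : {x : M' | U' x} * G => (dn xg.1, xg.2))) => //.
      apply: smooth_pair; last exact: smooth_snd.
      apply: smooth_sig.
      apply: (smooth_comp (f := fun xg : {x : M' | U' x} * G => sval xg.1) _ sp).
      exact: smooth_fst.
    * exact: smooth_fst.
  + apply: smooth_pair.
      apply: smooth_sig; exact: (smooth_comp (@smooth_sval _ _ _) (@smooth_pb_fst _ _ _ p S)).
    apply: (smooth_comp (f := fun w => itau (it w))); last exact: smooth_snd.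
    apply: smooth_comp sit; apply: smooth_sig.
    exact: (smooth_comp (@smooth_sval _ _ _) (@smooth_pb_mid _ _ _ p S)).
  + move=> [x g]; rewrite /itau' /=; congr (_, _); first exact: sig_eq.
    have -> : it (tau' (x, g)) = tau (dn x, g) by apply: sig_eq.
    by rewrite tK.
  + move=> w; apply: sig_eq; have [/pb_kernel[e _] _] := svalP w.
    apply: pb_eq => //=.
    (* By [ts] the first component of [itau] is the source of its argument, here [p] of the base
       point of [w]. *)
    have -> : (dn (exist U' (sval (sval w)).1.1 (svalP w).2), (itau (it w)).2) = itau (it w).
      rewrite [RHS]surjective_pairing; congr (_, _); apply: sig_eq => /=.
      rewrite -(ts (itau (it w)).1 (itau (it w)).2) -surjective_pairing iK /=.
      exact: (svalP (sval w)).1.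
    by rewrite iK.
- by [].
- move=> u g g'; apply/composesE; split=> //.
  have /composesE[e E] := tm (dn u) g g'.
  have e1 : tgt (sval (tau' (u, g))) = src (sval (tau' (u, g'))) by [].
  rewrite (gmulE e1); apply: pb_eq => //=.
  by rewrite -gmulE.
Qed.

(** The canonical identification of bands: [r |-> (m, r, m)] is a diffeomorphism from the kernel at
    [p m] onto the kernel of the pull-back at [m]. *)
Lemma pullback_Band (m : M') (b : G -> S) (b' : G -> pullback p S) :
  Band phi (p m, b) -> (forall g, sval (b' g) = (m, b g, m)) ->
  Band (pullback_mor p phi) (m, b').
Proof.
move=> [[c [sc [d [sd cK dK]]] cE] cM] b'E.
have {}cE g : b g = sval (c g) := cE g.
split; last first.
  move=> g g'; have e1 : tgt (b' g) = src (b' g') by rewrite /= !b'E.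
  have /composesE[e E] := cM g g'.
  apply/composesE; split=> //; rewrite (gmulE e1).
  apply: pb_eq; rewrite /= ?b'E //=.
  have e2 : tgt (sval (b' g)).1.2 = src (sval (b' g')).1.2 by rewrite !b'E.
  by rewrite -gmulE !b'E.
have kb g : kernel_at (pullback_mor p phi) m (b' g).
  split; last by rewrite /= b'E.
  apply/pb_kernel; rewrite b'E; split=> //=; rewrite cE.
  by case: (svalP (c g)).
have kd (r : {z | kernel_at (pullback_mor p phi) m z}) :
    kernel_at phi (p m) (sval (sval r)).1.2.
  have [/pb_kernel[e k] s] := svalP r; split=> //.
  by rewrite -(svalP (sval r)).1; congr p.
exists (fun g => exist _ (b' g) (kb g)) => //.
apply: (can_diffeo (g := fun r => d (exist _ (sval (sval r)).1.2 (kd r)))).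
- apply: smooth_sig => /=; apply: smooth_pb.
  + by apply: (smooth_ext (f := fun=> m)) => [g|]; [rewrite b'E|exact: smooth_cst].
  + apply: (smooth_ext (f := fun g => sval (c g))) => // g.
    by rewrite b'E /= cE.
  + by apply: (smooth_ext (f := fun=> m)) => [g|]; [rewrite b'E|exact: smooth_cst].
- apply: (smooth_comp _ sd); apply: smooth_sig.
  exact: (smooth_comp (@smooth_sval _ _ _) (@smooth_pb_mid _ _ _ p S)).
- move=> g /=; rewrite -[RHS]cK; congr d; apply: sig_eq => /=.
  by rewrite b'E /= cE.
- move=> r; apply: sig_eq; have [/pb_kernel[e k] s] := svalP r.
  apply: pb_eq; rewrite /= b'E //=; first by rewrite cE dK.
  by rewrite -e.
Qed.

End Kernel.

Variables (Q : groupoid M) (E : ext_data X Q).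
Hypotheses (hQ : lie_groupoid Q) (hE : extension E).

Lemma pullback_principal : principal_bundle (@ext_proj _ _ _ _ (pullback_ext p E))
  (@ext_ract _ _ _ _ (pullback_ext p E)).
Proof.
have pr := extn_bundle hE; split.
- exact: (fp_manifold_r hp (prin_proj pr) (prin_manifold pr) mM').
- exact: smooth_pbe_snd.
- by [].
- by move=> x; apply: pbe_eq => //=; exact: (prin_ract1 pr).
- by move=> x h h'; apply: pbe_eq => //=; exact: (prin_ractM pr).
- apply: smooth_pbe => /=.
    apply: (smooth_comp (f := fun xh : pbe_bun p E * H => ((sval xh.1).1, xh.2)) _
      (prin_ract_smooth pr)).
    by move=> n U u [[]].
  by move=> n U u [[]].
move=> m; have [U [oU Um [tau [[stau [itau [sit tK iK]]] tp tm]]]] := prin_trivial pr (p m).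
exists (p @^-1` U); split=> //; first exact: dopen_preimage.
pose U' := p @^-1` U.
pose dn (x : {x : M' | U' x}) : {x : M | U x} := exist U (p (sval x)) (svalP x).
pose tz (x : {x : M' | U' x}) (g : H) : pbe_bun p E :=
  exist _ (sval (tau (dn x, g)), sval x) (tp (dn x) g).
pose K' := {z : pbe_bun p E | U' (sval z).2}.
pose tau' (xg : {x : M' | U' x} * H) : K' :=
  exist (fun z : pbe_bun p E => U' (sval z).2) (tz xg.1 xg.2) (svalP xg.1).
have ok (w : K') : U (ext_proj (sval (sval w)).1).
  by rewrite (svalP (sval w)); exact: (svalP w).
pose it (w : K') : {r : ext_bun E | U (ext_proj r)} := exist _ (sval (sval w)).1 (ok w).
pose itau' (w : K') : {x : M' | U' x} * H :=
  (exist U' (sval (sval w)).2 (svalP w), (itau (it w)).2).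
exists tau'; split.
- apply: (can_diffeo (g := itau')).
  + apply: smooth_sig; apply: smooth_pbe => /=; last exact: smooth_fst.
    apply: (smooth_comp (f := fun xg : {x : M' | U' x} * H => tau (dn xg.1, xg.2))) => //.
    apply: (smooth_comp (f := fun xg : {x : M' | U' x} * H => (dn xg.1, xg.2))) => //.
    apply: smooth_pair; last exact: smooth_snd.
    apply: smooth_sig.
    apply: (smooth_comp (f := fun xg : {x : M' | U' x} * H => sval xg.1) _ sp).
    exact: smooth_fst.
  + apply: smooth_pair.
      apply: smooth_sig; exact: (smooth_comp (@smooth_sval _ _ _) (@smooth_pbe_snd _ _ _ _ _ _ _)).
    apply: (smooth_comp (f := fun w => itau (it w))); last exact: smooth_snd.
    apply: smooth_comp sit; apply: smooth_sig.
    exact: (smooth_comp (@smooth_sval _ _ _) (@smooth_pbe_fst _ _ _ _ _ _ _)).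
  + move=> [x g]; rewrite /itau' /=; congr (_, _); first exact: sig_eq.
    have -> : it (tau' (x, g)) = tau (dn x, g) by apply: sig_eq.
    by rewrite tK.
  + move=> w; apply: sig_eq; apply: pbe_eq => //=.
    have -> : (dn (exist U' (sval (sval w)).2 (svalP w)), (itau (it w)).2) = itau (it w).
      rewrite [RHS]surjective_pairing; congr (_, _); apply: sig_eq => /=.
      rewrite -(tp (itau (it w)).1 (itau (it w)).2) -surjective_pairing iK /=.
      exact: esym (svalP (sval w)).
    by rewrite iK.
- by [].
- by move=> u h h'; apply: pbe_eq => //=; exact: tm.
Qed.

Lemma pullback_extension : extension (pullback_ext p E).
Proof.
have gE := extn_G hE; have lS := gext_lie gE.
have lpS := lie_pullback lS mM' hp; have lpQ := lie_pullback hQ mM' hp.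
split.
- split=> //; last exact/pullback_locally_trivial/(gext_kernel gE).
  apply: split_surj_submersion (lieg_arr lpS) (lieg_arr lpQ) _.
  exact/pullback_mor_split/surj_submersion_split/(gext_subm gE).
- exact: pullback_principal.
- move=> x e; apply: pbe_eq => //=.
  by rewrite -[RHS](gact1 hE (sval x).1) -gactE; congr gact; rewrite /= (svalP x).
- by move=> r r' x err' e' e1 e2; apply: pbe_eq => //=; exact: (extn_lactM hE).
- apply: smooth_pbe => /=; last by move=> n U u [[[]]].
  pose c (z : {rx : pullback p (ext_grpd E) * pbe_bun p E | tgt rx.1 = (sval rx.2).2}) :
      {rx : ext_grpd E * ext_bun E | tgt rx.1 = ext_proj rx.2} :=
    exist (fun rx : ext_grpd E * ext_bun E => tgt rx.1 = ext_proj rx.2)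
      ((sval (sval z).1).1.2, (sval (sval z).2).1) (pbe_lact_ok (svalP z)).
  have sc : smooth c by apply: smooth_sig => n U u [[[]] ? ? ? []].
  apply: (smooth_ext _ (smooth_comp sc (extn_lact_smooth hE))) => z.
  exact: lact_congr.
- by move=> r x h e e'; apply: pbe_eq => //=; exact: (extn_lact_ract hE).
- move=> x; apply: (pullback_Band (b := ext_chi (sval x).1)) => //.
  by rewrite -(svalP x); exact: extn_band.
- apply: smooth_pb => /=; [| |].
  + by move=> n U u [[]].
  + apply: (smooth_comp (f := fun xg : pbe_bun p E * G => ((sval xg.1).1, xg.2)) _
      (extn_chi_smooth hE)).
    by move=> n U u [[]].
  + by move=> n U u [[]].
- move=> r x h e g.
  have := extn_chi_equiv hE h (pbe_lact_ok e) g => /conjugatesE[E1 [e1 e2]].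
  pose k := ext_chi x (cm_act h g) : pullback p (ext_grpd E).
  have e3 : tgt r = src k by [].
  have e4 : tgt k = tgt r by [].
  have e5 : tgt (gmul r k) = src (inv r) by rewrite tgt_gmul // src_inv.
  suff -> : ext_chi (ext_ract (ext_lact e) h) g = gmul (gmul r k) (inv r).
    exact: conjugates_gmul.
  rewrite (gmulE e5); move: e5; rewrite (gmulE e3) => e5.
  apply: pb_eq => //=.
  by rewrite E1 -gmulE -gmulE.
- by move=> x g e; apply: pbe_eq => //=; exact: (extn_rho hE).
Qed.

End Pullback.
End Preservation.

(** * Conjugation by a section of an extension *)

Section Push.
Variables (R : realType) (X : crossedModule R).
Variables (M : diffType R) (Q Q' : groupoid M) (theta : gmor Q Q').
Hypotheses (dtheta : diffeo theta) (mQ' : manifold Q').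

Lemma push_kernel (S : groupoid M) (phi : gmor S Q) :
  kernel (gmor_then phi theta) = kernel phi.
Proof.
apply/seteqP; split=> r [m E]; exists m.
  by apply: (diffeo_inj dtheta); rewrite gmor_idm.
by rewrite /= E gmor_idm.
Qed.

Lemma push_extension (E : ext_data X Q) : extension E -> extension (push_ext theta E).
Proof.
move=> hE; have gE := extn_G hE; split; try by case: hE.
- split; first exact: gext_lie gE.
  + apply: split_surj_submersion mQ' _; first exact: lieg_arr (gext_lie gE).
    exact: loc_split_comp (surj_submersion_split (gext_subm gE)) (diffeo_split dtheta).
  + have := gext_kernel gE; rewrite /locally_trivial_kernel.
    by rewrite (push_kernel (ext_mor E)).
- move=> x; have := extn_band hE x; rewrite /Band /kernel_at.
  by rewrite (push_kernel (ext_mor E)).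
Qed.

End Push.

Section Conjugation.
Variables (R : realType).

Lemma inv_idm (M : diffType R) (S : groupoid M) m : inv (idm S m) = idm S m.
Proof.
have e : tgt (idm S m) = src (inv (idm S m)) by rewrite src_inv.
by rewrite -[LHS](g1mul (m := m)) ?src_inv ?tgt_idm // gmulV src_idm.
Qed.

Lemma pb_gmul_mid (M N : diffType R) (p : N -> M) (S : groupoid M) (z z' : pullback p S) :
  tgt z = src z' -> (sval (gmul z z')).1.2 = gmul (sval z).1.2 (sval z').1.2.
Proof. by move=> e; rewrite (gmulE e) (gmulE (pb_composable e)). Qed.

Lemma pb_gmul_fst (M N : diffType R) (p : N -> M) (S : groupoid M) (z z' : pullback p S) :
  tgt z = src z' -> (sval (gmul z z')).1.1 = (sval z).1.1.
Proof. by move=> e; rewrite (gmulE e). Qed.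

Lemma pb_gmul_snd (M N : diffType R) (p : N -> M) (S : groupoid M) (z z' : pullback p S) :
  tgt z = src z' -> (sval (gmul z z')).2 = (sval z').2.
Proof. by move=> e; rewrite (gmulE e). Qed.

Section Map.
Variables (M N : diffType R) (S : groupoid M) (p1 p2 : N -> M) (sigma : N -> S).
Hypotheses (ss : forall n, src (sigma n) = p1 n) (ts : forall n, tgt (sigma n) = p2 n).

(** Regarding [sigma] as a natural isomorphism from [p1] to [p2], this is the induced change of end
    points of an arrow. *)
Definition conj_arr (z : pullback p1 S) : S :=
  gmul (inv (sigma (sval z).1.1)) (gmul (sval z).1.2 (sigma (sval z).2)).

Let ok1 (z : pullback p1 S) : tgt (sval z).1.2 = src (sigma (sval z).2).
Proof. by rewrite ss; exact: (svalP z).2. Qed.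

Let ok2 (z : pullback p1 S) : tgt (inv (sigma (sval z).1.1)) = src (sval z).1.2.
Proof. by rewrite tgt_inv ss; exact: (svalP z).1. Qed.

Let ok3 (z : pullback p1 S) : tgt (inv (sigma (sval z).1.1)) =
  src (gmul (sval z).1.2 (sigma (sval z).2)).
Proof. by rewrite ok2 src_gmul // ok1. Qed.

Lemma conj_ok (z : pullback p1 S) :
  p2 (sval z).1.1 = src (conj_arr z) /\ tgt (conj_arr z) = p2 (sval z).2.
Proof.
by rewrite src_gmul ?ok3 // tgt_gmul ?ok3 // src_inv ts tgt_gmul ?ok1 // ts.
Qed.

Definition conj_fun (z : pullback p1 S) : pullback p2 S :=
  exist _ ((sval z).1.1, conj_arr z, (sval z).2) (conj_ok z).

Lemma conj_gmul (z z' : pullback p1 S) : tgt z = src z' ->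
  conj_fun (gmul z z') = gmul (conj_fun z) (conj_fun z').
Proof.
move=> e; have e' : tgt (conj_fun z) = src (conj_fun z') by [].
have e2 : (sval z).2 = (sval z').1.1 by [].
have e3 := pb_composable e.
apply: pb_eq; rewrite /= ?(pb_gmul_fst e') ?(pb_gmul_fst e) ?(pb_gmul_snd e')
  ?(pb_gmul_snd e) //.
rewrite pb_gmul_mid // /conj_arr pb_gmul_fst // pb_gmul_snd // pb_gmul_mid //=.
rewrite /conj_arr; set a := sval z in e2 e3 *; set a' := sval z' in e2 e3 *.
have h1 : tgt (inv (sigma a.1.1)) = src (gmul a.1.2 (sigma a.2)) := ok3 z.
have h2 : tgt (gmul a.1.2 (sigma a.2)) = src (inv (sigma a'.1.1)).
  by rewrite tgt_gmul ?(ok1 z) // src_inv e2.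
have h3 : tgt (inv (sigma a'.1.1)) = src (gmul a'.1.2 (sigma a'.2)) := ok3 z'.
rewrite -[RHS]gmulA ?h1 //; last by rewrite src_gmul.
(* The factors [sigma n] and its inverse at the common end point [n] cancel. *)
congr gmul; rewrite gmulA // -e2 gmulK; last exact: ok1 z.
by rewrite gmulA //; exact: ok1 z'.
Qed.

Definition conj_mor : gmor (pullback p1 S) (pullback p2 S) :=
  @Gmor R N (pullback p1 S) (pullback p2 S) conj_fun (fun=> erefl) (fun=> erefl)
    (@gmor_comp_eq R N (pullback p1 S) (pullback p2 S) conj_fun
      (fun=> erefl) (fun=> erefl) conj_gmul).

Lemma conj_smooth : lie_groupoid S -> smooth sigma -> smooth conj_fun.
Proof.
move=> lS sS; apply: smooth_pb; [exact: smooth_pb_fst| |exact: smooth_pb_snd].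
apply: (smooth_gmul lS) => [||z]; last exact: ok3.
  exact: smooth_comp (smooth_comp (@smooth_pb_fst _ _ _ p1 S) sS) (lieg_inv lS).
apply: (smooth_gmul lS (@smooth_pb_mid _ _ _ p1 S)) => [|z]; last exact: ok1.
exact: smooth_comp (@smooth_pb_snd _ _ _ p1 S) sS.
Qed.

End Map.

(** Keeping [sigma'] as a separate map lets the same lemma give both cancellations. *)
Lemma conj_funK (M N : diffType R) (S : groupoid M) (p1 p2 : N -> M) (sigma sigma' : N -> S)
  (ss : forall n, src (sigma n) = p1 n) (ts : forall n, tgt (sigma n) = p2 n)
  (ss' : forall n, src (sigma' n) = p2 n) (ts' : forall n, tgt (sigma' n) = p1 n) :
  (forall n, sigma' n = inv (sigma n)) ->
  cancel (conj_fun ss ts) (conj_fun ss' ts').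
Proof.
move=> E z; apply: pb_eq => //=; rewrite /conj_arr /= !E invK /conj_arr.
have [z1 z2] := svalP z.
have h1 : tgt (sval z).1.2 = src (sigma (sval z).2) by rewrite ss.
have h2 : tgt (inv (sigma (sval z).1.1)) = src (sval z).1.2 by rewrite tgt_inv ss.
have h3 : tgt (inv (sigma (sval z).1.1)) = src (gmul (sval z).1.2 (sigma (sval z).2)).
  by rewrite h2 src_gmul.
have h4 : tgt (gmul (sval z).1.2 (sigma (sval z).2)) = src (inv (sigma (sval z).2)).
  by rewrite tgt_gmul // src_inv.
by rewrite -[X in gmul _ X]gmulA // gmulK // gmulKV // ss.
Qed.

Variables (X : crossedModule R).

(** The hypothesis that [sigma n] lies over a unit of [B] makes the conjugation cover the identity
    of [B[h]], as an isomorphism of extensions must. *)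
Lemma restr_conj (B0 M N : diffType R) (B : groupoid B0) (q : M -> B0) (p1 p2 : N -> M)
    (h : N -> B0) (hE1 : forall n, h n = q (p1 n)) (hE2 : forall n, h n = q (p2 n))
    (E : ext_data X (pullback q B)) (sigma : N -> ext_grpd E) :
  extension E -> smooth sigma ->
  (forall n, src (sigma n) = p1 n) -> (forall n, tgt (sigma n) = p2 n) ->
  (forall n, (sval (ext_mor E (sigma n))).1.2 = idm B (h n)) ->
  ext_iso (restr hE1 E) (restr hE2 E).
Proof.
move=> hE sS ss ts bs; have lS := gext_lie (extn_G hE).
pose sigma' n := inv (sigma n).
have ss' n : src (sigma' n) = p2 n by rewrite src_inv ts.
have ts' n : tgt (sigma' n) = p1 n by rewrite tgt_inv ss.
have sS' : smooth sigma' by exact: smooth_comp sS (lieg_inv lS).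
have hS (z : pbe_bun p1 E) : ext_proj (gact (sigma' (sval z).2) (sval z).1) = p2 (sval z).2.
  by rewrite proj_gact // ts' (svalP z).
have hT (z : pbe_bun p2 E) : ext_proj (gact (sigma (sval z).2) (sval z).1) = p1 (sval z).2.
  by rewrite proj_gact // ts (svalP z).
(* The bundle is moved by the inverse of [sigma], so that [sigma n] cancels when the conjugated
   arrow acts on the moved point. *)
pose F z : pbe_bun p2 E := exist _ (gact (sigma' (sval z).2) (sval z).1, (sval z).2) (hS z).
pose K z : pbe_bun p1 E := exist _ (gact (sigma (sval z).2) (sval z).1, (sval z).2) (hT z).
exists (conj_mor ss ts), F; split.
- split.
    apply: (can_diffeo (g := conj_fun ss' ts')); [exact: conj_smooth|exact: conj_smooth| |];
    by apply: conj_funK => n; rewrite /sigma' ?invK.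
  move=> r; apply: pb_eq => //=; rewrite /conj_arr.
  have [z1 z2] := svalP r.
  have h1 : tgt (sval r).1.2 = src (sigma (sval r).2) by rewrite ss.
  have h2 : tgt (inv (sigma (sval r).1.1)) = src (sval r).1.2 by rewrite tgt_inv ss.
  have h3 : tgt (inv (sigma (sval r).1.1)) = src (gmul (sval r).1.2 (sigma (sval r).2)).
    by rewrite h2 src_gmul.
  rewrite gmor_gmul // pb_gmul_mid; last by rewrite gmor_tgt gmor_src.
  rewrite gmor_gmul // [X in gmul _ X]pb_gmul_mid; last by rewrite gmor_tgt gmor_src.
  rewrite gmor_inv /= !bs inv_idm.
  have [w1 w2] := svalP (ext_mor E (sval r).1.2).
  have w3 : src (ext_mor E (sval r).1.2) = src (sval r).1.2 by exact: gmor_src.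
  have w4 : tgt (ext_mor E (sval r).1.2) = tgt (sval r).1.2 by exact: gmor_tgt.
  rewrite gmul1; last by rewrite w2 hE1 -z2 -w4.
  by rewrite g1mul // hE1 z1 -w3 w1.
- split=> //; apply: (can_diffeo (g := K)).
  + apply: smooth_pbe; last exact: smooth_pbe_snd.
    apply: smooth_gact => // [||z]; last by rewrite ts' (svalP z).
      exact: smooth_comp (@smooth_pbe_snd _ _ _ _ _ p1 E) sS'.
    exact: smooth_pbe_fst.
  + apply: smooth_pbe; last exact: smooth_pbe_snd.
    apply: smooth_gact => // [||z]; last by rewrite ts (svalP z).
      exact: smooth_comp (@smooth_pbe_snd _ _ _ _ _ p2 E) sS.
    exact: smooth_pbe_fst.
  + move=> z; apply: pbe_eq => //=; rewrite -gactM //; last by rewrite ts' (svalP z).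
      by rewrite gmulV ss -(svalP z) gact1.
    by rewrite src_inv.
  + move=> z; apply: pbe_eq => //=; rewrite -gactM //; last by rewrite ts (svalP z).
      by rewrite gVmul ts -(svalP z) gact1.
    by rewrite tgt_inv.
- move=> r x k e e'; apply: pbe_eq => //=.
  have [z1 z2] := svalP r.
  have e1 := pbe_lact_ok e.
  have h1 : tgt (sval r).1.2 = src (sigma (sval r).2) by rewrite ss.
  have h2 : tgt (inv (sigma (sval r).1.1)) = src (sval r).1.2 by rewrite tgt_inv ss.
  have e2 : (sval r).2 = (sval x).2 by [].
  rewrite -!gactE gact_ract //; last by rewrite proj_gact // ts' z1.
  congr ext_ract; rewrite /conj_arr /=.
  have h3 : tgt (inv (sigma (sval r).1.1)) = src (gmul (sval r).1.2 (sigma (sval r).2)).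
    by rewrite h2 src_gmul.
  have h4 : tgt (sigma' (sval x).2) = ext_proj (sval x).1 by rewrite ts' (svalP x).
  have h5 : tgt (gmul (sval r).1.2 (sigma (sval r).2)) = src (sigma' (sval x).2).
    by rewrite tgt_gmul // ts ss' e2.
  rewrite [RHS]gactM //; last by rewrite proj_gact.
  congr gact; rewrite -gactM //; congr gact.
  by rewrite /sigma' -e2 gmulK.
(* Equivariance of [chi] under the inverse of [sigma] is precisely conjugation at an arrow with both
   end points equal. *)
- move=> x g; apply: pb_eq => //=.
  rewrite /conj_arr chi_gact //; last by rewrite ts' (svalP x).
  rewrite /sigma' invK -gmulA ?tgt_inv ?ss ?ext_src_chi ?(svalP x) //.
  by rewrite ext_tgt_chi (svalP x).
Qed.

End Conjugation.

(** * Gerbes and Morita equivalence *)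

Section SplitSmooth.
Variable R : realType.
Lemma split_smooth (Y Z : diffType R) (f : Y -> Z) : loc_split f -> smooth f.
Proof. by case. Qed.

Lemma surj_submersion_id (Y : diffType R) : manifold Y -> surj_submersion (@id Y).
Proof. by move=> mY; apply: (split_surj_submersion mY mY); exact/diffeo_split/diffeo_id. Qed.
End SplitSmooth.

Section MoritaEquivalence.
Variables (R : realType) (X : crossedModule R).
Variables (B0 : diffType R) (B : groupoid B0).
Hypothesis hB : lie_groupoid B.
Implicit Types Y : ext_over X B.

Lemma restr_extension (M N : diffType R) (q : M -> B0) (p : N -> M) (h : N -> B0)
    (hE : forall n, h n = q (p n)) (E : ext_data X (pullback q B)) :
  manifold M -> manifold N -> surj_submersion q -> surj_submersion p ->
  extension E -> extension (restr hE E).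
Proof.
move=> mM mN sq sp xE.
have sh : surj_submersion h.
  apply: (split_surj_submersion mN (lieg_base hB)).
  have -> : h = q \o p by apply/funext.
  exact: loc_split_comp (surj_submersion_split sp) (surj_submersion_split sq).
apply: push_extension.
- exact/flatten_diffeo/(surj_subm_smooth sp).
- exact: lieg_arr (lie_pullback hB mN sh).
- by apply: pullback_extension => //; exact: lie_pullback.
Qed.

Lemma morita_refl Y : extension_over Y -> morita_equivalent Y Y.
Proof.
move=> [mM sq xE]; exists (eo_base Y), id, id, (@eo_q _ _ _ _ Y), (fun=> erefl), (fun=> erefl).
by split=> //; [exact: surj_submersion_id|exact: surj_submersion_id|exact: ext_iso_refl].
Qed.

Lemma morita_sym Y Y' : morita_equivalent Y Y' -> morita_equivalent Y' Y.
Proof.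
move=> [N [p [p' [h [hE [hE' [mN sp sp' i]]]]]]].
by exists N, p', p, h, hE', hE; split=> //; exact: ext_iso_sym.
Qed.

(** Over the fibre product of the two covers along their maps to the base of [Y'], both isomorphisms
    restrict and meet in the same pull-back of [Y']. *)
Lemma morita_trans Y Y' Y'' :
  extension_over Y -> extension_over Y' -> extension_over Y'' ->
  morita_equivalent Y Y' -> morita_equivalent Y' Y'' -> morita_equivalent Y Y''.
Proof.
move=> [mM _ _] [mM' _ _] [mM'' _ _].
move=> [N1 [p1 [p1' [h1 [hE1 [hE1' [mN1 sp1 sp1' i1]]]]]]].
move=> [N2 [p2 [p2' [h2 [hE2 [hE2' [mN2 sp2 sp2' i2]]]]]]].
pose N : diffType R := {xy : N1 * N2 | p1' xy.1 = p2 xy.2}.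
pose a (w : N) : N1 := (sval w).1.
pose b (w : N) : N2 := (sval w).2.
have mN : manifold N by apply: fp_manifold_l => //; exact: surj_subm_smooth sp2.
have sa : loc_split a.
  by apply: fp_fst_split; [exact: surj_submersion_split|exact: surj_subm_smooth sp1'].
have sb : loc_split b.
  by apply: fp_snd_split; [exact: surj_submersion_split|exact: surj_subm_smooth sp2].
have hb n : h1 (a n) = h2 (b n).
  by rewrite hE1' hE2; congr eo_q; exact: (svalP n).
have e1 n : h1 (a n) = eo_q (p1 (a n)) by exact: hE1.
have e2 n : h1 (a n) = eo_q (p2' (b n)) by rewrite hb; exact: hE2'.
have em n : h1 (a n) = eo_q (p1' (a n)) by exact: hE1'.
exists N, (p1 \o a), (p2' \o b), (h1 \o a), e1, e2; split=> //.
- apply: split_surj_submersion => //.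
  exact: loc_split_comp sa (surj_submersion_split sp1).
- apply: split_surj_submersion => //.
  exact: loc_split_comp sb (surj_submersion_split sp2').
have ea n : (h1 \o a) n = h1 (a n) by [].
have eb n : (h1 \o a) n = h2 (b n) by exact: hb.
have cc n : (p1' \o a) n = p2 (b n) by exact: (svalP n).
have s1 := restr_comp hE1 ea (c := p1 \o a) (fun=> erefl) e1 (eo_ext Y) (split_smooth sa).
have s2 := restr_comp hE1' ea (c := p1' \o a) (fun=> erefl) em (eo_ext Y') (split_smooth sa).
(* [Y'] is reached by two routes, through [N1] and through [N2]; the equation [cc] of the fibre
   product makes them end in the same restriction. *)
have s3 := restr_comp hE2 eb cc em (eo_ext Y') (split_smooth sb).
have s4 := restr_comp hE2' eb (c := p2' \o b) (fun=> erefl) e2 (eo_ext Y'') (split_smooth sb).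
have t1 := ext_iso_trans (ext_iso_sym s1) (ext_iso_trans (restr_iso ea i1) s2).
have t2 := ext_iso_trans (ext_iso_sym s3) (ext_iso_trans (restr_iso eb i2) s4).
exact: ext_iso_trans t1 t2.
Qed.

Lemma iso_morita (M : diffType R) (q : M -> B0) (E E' : ext_data X (pullback q B)) :
  manifold M -> ext_iso E E' -> morita_equivalent (ExtOver E) (ExtOver E').
Proof.
move=> mM i; exists M, id, id, q, (fun=> erefl), (fun=> erefl).
by split=> //; [exact: surj_submersion_id|exact: surj_submersion_id|exact: restr_iso].
Qed.

Lemma restr_morita Y (N : diffType R) (p : N -> eo_base Y) (h : N -> B0)
    (hE : forall n, h n = eo_q (p n)) : manifold N -> surj_submersion p ->
  morita_equivalent (ExtOver (restr hE (eo_ext Y))) Y.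
Proof.
move=> mN sp; exists N, id, p, h, (fun=> erefl), hE; split=> //.
  exact: surj_submersion_id.
exact: (restr_comp hE (fun=> erefl) (c := p) (fun=> erefl) hE _ (@smooth_id _ N)).
Qed.

Lemma gerbe_class_eq Y Y' : extension_over Y -> extension_over Y' ->
  gerbe_class Y = gerbe_class Y' <-> morita_equivalent Y Y'.
Proof.
move=> hY hY'; split=> [E|YY'].
  have : gerbe_class Y' Y' by split=> //; exact: morita_refl.
  by rewrite -E => -[].
apply/funext => Z; apply/propext; split=> -[hZ YZ]; split=> //.
  exact: morita_trans hY' hY hZ (morita_sym YY') YZ.
exact: morita_trans hY hY' hZ YY' YZ.
Qed.

End MoritaEquivalence.

(** * Comparison of extensions over [B[f]] with extensions over [B] *)

Section Left.
Variables (R : realType) (X : crossedModule R).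
Variables (B0 T : diffType R) (B : groupoid B0) (f : T -> B0).
Hypotheses (hB : lie_groupoid B) (mT : manifold T) (sf : surj_submersion f).
Implicit Types Y : ext_over X (pullback f B).

Let hBf : lie_groupoid (pullback f B) := lie_pullback hB mT sf.

(** For [f] the left leg of a Morita equivalence this is convertible to [ext_on_left]. *)
Definition descend Y : ext_over X B :=
  ExtOver (push_ext (@flatten_mor _ _ _ _ B f (@eo_q _ _ _ _ Y) (f \o @eo_q _ _ _ _ Y)
    (fun=> erefl)) (eo_ext Y)).

Lemma descend_extension Y : extension_over Y -> extension_over (descend Y).
Proof.
move=> [mM sq xE].
have sfq : surj_submersion (f \o @eo_q _ _ _ _ Y).
  apply: (split_surj_submersion mM (lieg_base hB)).
  exact: loc_split_comp (surj_submersion_split sq) (surj_submersion_split sf).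
split=> //; apply: push_extension => //.
  exact/flatten_diffeo/(surj_subm_smooth sq).
exact: lieg_arr (lie_pullback hB mM sfq).
Qed.

(** Both sides have the same groupoid and bundle; only the projections onto the pull-back of [B] are
    assembled differently, so the identity is an isomorphism. *)
Lemma descend_restr Y (N : diffType R) (p : N -> eo_base Y) (h : N -> T)
    (hE : forall n, h n = eo_q (p n))
    (hE' : forall n, (f \o h) n = @eo_q _ _ _ _ (descend Y) (p n)) :
  ext_iso (push_ext (@flatten_mor _ _ _ _ B f h (f \o h) (fun=> erefl)) (restr hE (eo_ext Y)))
          (restr hE' (eo_ext (descend Y))).
Proof.
exists (gmor_id _), id; split=> //.
- by split; [exact: diffeo_id|move=> r; exact: pb_eq].
- by split=> //; exact: diffeo_id.
- by move=> r x k e e'; apply: pbe_eq => //=; congr ext_ract; exact: lact_congr.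
- by move=> x g; exact: pb_eq.
Qed.

Lemma descend_morita Y Y' : morita_equivalent Y Y' ->
  morita_equivalent (descend Y) (descend Y').
Proof.
move=> [N [p [p' [h [hE [hE' [mN sp sp' i]]]]]]].
have e n : (f \o h) n = @eo_q _ _ _ _ (descend Y) (p n) by rewrite /= hE.
have e' n : (f \o h) n = @eo_q _ _ _ _ (descend Y') (p' n) by rewrite /= hE'.
exists N, p, p', (f \o h), e, e'; split=> //.
apply: ext_iso_trans (ext_iso_sym (descend_restr hE e)) _.
apply: ext_iso_trans _ (descend_restr hE' e').
exact: push_ext_iso.
Qed.

Lemma descend_surj (Z : ext_over X B) : extension_over Z ->
  exists2 Y, extension_over Y & morita_equivalent (descend Y) Z.
Proof.
move=> [mM sq xE].
pose N : diffType R := {mt : eo_base Z * T | eo_q mt.1 = f mt.2}.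
pose p (w : N) : eo_base Z := (sval w).1.
pose r (w : N) : T := (sval w).2.
have mN : manifold N by apply: fp_manifold_l => //; exact: surj_subm_smooth sf.
have sp : surj_submersion p.
  apply: split_surj_submersion => //.
  by apply: fp_fst_split; [exact: surj_submersion_split|exact: surj_subm_smooth sq].
have sr : surj_submersion r.
  apply: split_surj_submersion => //.
  by apply: fp_snd_split; [exact: surj_submersion_split|exact: surj_subm_smooth sf].
have hE n : (f \o r) n = eo_q (p n) by rewrite /= -(svalP n).
have xr := restr_extension hB hE mM mN sq sp xE.
pose fl := @flatten_mor _ _ _ _ B f r (f \o r) (fun=> erefl).
have dfl : diffeo fl by exact/flatten_diffeo/(surj_subm_smooth sr).
(* The restriction of [Z] to [N] is an extension of [B[f \o r]]; the inverse of the flattening makes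
   it one of [B[f][r]]. *)
have [ul [dul flK ulK]] := gmor_inverse dfl.
pose Y : ext_over X (pullback f B) := ExtOver (push_ext ul (restr hE (eo_ext Z))).
have xY : extension_over Y.
  split=> //; apply: push_extension => //.
  exact: lieg_arr (lie_pullback hBf mN sr).
exists Y => //.
have hZ : extension_over Z by [].
have hN : extension_over (ExtOver (restr hE (eo_ext Z))).
  split=> //; apply: (split_surj_submersion mN (lieg_base hB)).
  exact: loc_split_comp (surj_submersion_split sr) (surj_submersion_split sf).
apply: (morita_trans (descend_extension xY) hN hZ); last exact: restr_morita.
apply: iso_morita => //.
exists (gmor_id _), id; split=> //.
- by split; [exact: diffeo_id|move=> z; exact: esym (ulK _)].
- by split=> //; exact: diffeo_id.
by move=> z x k e e'; congr ext_ract; exact: lact_congr.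
Qed.

Lemma descend_reflect Y Y' : extension_over Y -> extension_over Y' ->
  morita_equivalent (descend Y) (descend Y') -> morita_equivalent Y Y'.
Proof.
move=> hY hY'; have [mM sq xE] := hY; have [mM' sq' xE'] := hY'.
have [_ sfq xD] := descend_extension hY; have [_ sfq' xD'] := descend_extension hY'.
move=> [N [p [p' [h [hE [hE' [mN sp sp' i]]]]]]].
pose M := eo_base Y; pose M' := eo_base Y'.
pose q : M -> T := @eo_q _ _ _ _ Y; pose q' : M' -> T := @eo_q _ _ _ _ Y'.
pose S := ext_grpd (eo_ext Y); pose S' := ext_grpd (eo_ext Y').
have sh : loc_split h.
  have -> : h = (f \o q) \o p by apply/funext => n; rewrite hE.
  exact: loc_split_comp (surj_submersion_split sp) (surj_submersion_split sfq).
have ssq := surj_submersion_split sq; have ssq' := surj_submersion_split sq'.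
have smq := split_smooth ssq; have smq' := split_smooth ssq'.
have smf := surj_subm_smooth sf.
have smp := surj_subm_smooth sp; have smp' := surj_subm_smooth sp'.
(* The pairs that agree over [T]: every cover giving an equivalence over [B[f]] maps to this one. *)
pose Na : diffType R := {mm : M * M' | q mm.1 = q' mm.2}.
have mNa : manifold Na by exact: fp_manifold_l.
have sa1 : loc_split (fun w : Na => (sval w).1) by exact: fp_fst_split.
have sa2 : loc_split (fun w : Na => (sval w).2) by exact: fp_snd_split.
pose k (w : Na) : B0 := f (q (sval w).1).
have smk : smooth k := smooth_comp (split_smooth sa1) (smooth_comp smq smf).
have mh : surj_submersion h by exact: split_surj_submersion mN (lieg_base hB) sh.
(* Agreement with the point of [N] is required over [B0] only; since [h] is onto, every pair of [Na]
   is still reached. *)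
pose Nb : diffType R := {an : Na * N | k an.1 = h an.2}.
have mNb : manifold Nb by exact: fp_manifold_r.
have sb1 : loc_split (fun w : Nb => (sval w).1) by exact: fp_fst_split.
have smb2 : smooth (fun w : Nb => (sval w).2) by exact: smooth_fp_snd.
(* The points of the final cover are chains m - p n - p' n - m' whose outer links
   are arrows of the two extensions lying over units of B; conjugation by these
   arrows moves the given isomorphism from (p, p') to the pair (m, m'), which
   agrees over T. *)
have u1P (w : Nb) : (f \o q) (sval (sval w).1).1 = src (idm B (h (sval w).2)) /\
    tgt (idm B (h (sval w).2)) = (f \o q) (p (sval w).2).
  by rewrite src_idm tgt_idm; split; [exact: (svalP w)|exact: hE].
(* The arrow [(m, 1, p n)]: its end points have the same image in [B0], but possibly distinct images
   in [T]. *)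
pose u1 (w : Nb) : pullback (f \o q) B := exist _ (_, _, _) (u1P w).
have su1 : smooth u1.
  apply: smooth_pb => /=.
  - exact: smooth_comp (split_smooth sb1) (split_smooth sa1).
  - exact: smooth_comp (smooth_comp smb2 (split_smooth sh)) (lieg_idm hB).
  - exact: smooth_comp smb2 smp.
pose phi : S -> pullback (f \o q) B := ext_mor (eo_ext (descend Y)).
(* The component in [S] is a smooth lift of [u1] by construction; as [phi] is a surjective
   submersion, passing to [Nc] loses no point of [Nb]. *)
pose Nc : diffType R := {sw : S * Nb | phi sw.1 = u1 sw.2}.
have sphi : surj_submersion phi := gext_subm (extn_G xD).
have mNc : manifold Nc.
  by apply: fp_manifold_l => //; exact: lieg_arr (gext_lie (extn_G xE)).
have sc2 : loc_split (fun w : Nc => (sval w).2).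
  by apply: fp_snd_split => //; exact: surj_submersion_split.
pose nb (w : Nc) : N := (sval (sval w).2).2.
pose ab (w : Nc) : Na := (sval (sval w).2).1.
have snb : smooth nb := smooth_comp (split_smooth sc2) smb2.
have sab : loc_split ab := loc_split_comp sc2 sb1.
have u2P (w : Nc) : (f \o q') (p' (nb w)) = src (idm B (h (nb w))) /\
    tgt (idm B (h (nb w))) = (f \o q') (sval (ab w)).2.
  rewrite src_idm tgt_idm; split; first by rewrite hE'.
  by rewrite -(svalP (sval w).2) /k /= (svalP (ab w)).
pose u2 (w : Nc) : pullback (f \o q') B := exist _ (_, _, _) (u2P w).
have su2 : smooth u2.
  apply: smooth_pb => /=.
  - exact: smooth_comp snb smp'.
  - exact: smooth_comp (smooth_comp snb (split_smooth sh)) (lieg_idm hB).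
  - exact: smooth_comp (split_smooth sab) (split_smooth sa2).
pose phi' : S' -> pullback (f \o q') B := ext_mor (eo_ext (descend Y')).
pose W : diffType R := {sw : S' * Nc | phi' sw.1 = u2 sw.2}.
have sphi' : surj_submersion phi' := gext_subm (extn_G xD').
have mW : manifold W.
  by apply: fp_manifold_l => //; exact: lieg_arr (gext_lie (extn_G xE')).
have sw2 : loc_split (fun w : W => (sval w).2).
  by apply: fp_snd_split => //; exact: surj_submersion_split.
pose aw (w : W) : Na := ab (sval w).2.
have saw : loc_split aw := loc_split_comp sw2 sab.
pose P (w : W) : M := (sval (aw w)).1.
pose P' (w : W) : M' := (sval (aw w)).2.
pose nw (w : W) : N := nb (sval w).2.
have snw : smooth nw := smooth_comp (split_smooth sw2) snb.
have sP : surj_submersion P.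
  by apply: split_surj_submersion => //; exact: loc_split_comp saw sa1.
have sP' : surj_submersion P'.
  by apply: split_surj_submersion => //; exact: loc_split_comp saw sa2.
have eP (w : W) : (q \o P) w = eo_q (P w) by [].
have eP' (w : W) : (q \o P) w = eo_q (P' w) by exact: (svalP (aw w)).
have fP (w : W) : (f \o (q \o P)) w = @eo_q _ _ _ _ (descend Y) (P w) by [].
have fP' (w : W) : (f \o (q \o P)) w = @eo_q _ _ _ _ (descend Y') (P' w).
  exact: (congr1 f (eP' w)).
have fh (w : W) : (f \o (q \o P)) w = h (nw w) by exact: (svalP (sval (sval w).2).2).
have fp (w : W) : (f \o (q \o P)) w = @eo_q _ _ _ _ (descend Y) (p (nw w)).
  by rewrite fh hE.
have fp' (w : W) : (f \o (q \o P)) w = @eo_q _ _ _ _ (descend Y') (p' (nw w)).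
  by rewrite fh hE'.
exists W, P, P', (q \o P), eP, eP'; split=> //.
(* As the flattening is injective, the isomorphism may be built over [B]. *)
pose fl := @flatten_mor _ _ _ _ B f (q \o P) (f \o (q \o P)) (fun=> erefl).
have ifl : injective fl by exact: flatten_inj.
apply: (push_ext_iso_inj ifl).
apply: ext_iso_trans (descend_restr eP fP) _.
apply: ext_iso_trans _ (ext_iso_sym (descend_restr eP' fP')).
pose sg (w : W) : S := (sval (sval w).2).1.
pose sg' (w : W) : S' := (sval w).1.
have sgE (w : W) : phi (sg w) = u1 (sval (sval w).2).2 by exact: (svalP (sval w).2).
have sgE' (w : W) : phi' (sg' w) = u2 (sval w).2 by exact: (svalP w).
(* Conjugation has to take place over [B]: the arrow below [sg w] has a unit of [B] as middle
   component, whereas its image in [B[f]] need not be a unit. *)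
have c1 : ext_iso (restr fP (eo_ext (descend Y))) (restr (p := p \o nw) fp (eo_ext (descend Y))).
  apply: (@restr_conj R X B0 M W B (f \o q) P (p \o nw) _ fP fp (eo_ext (descend Y)) sg) => //.
  - exact: smooth_comp (split_smooth sw2) (@smooth_fp_fst _ _ _ _ _ _).
  - move=> w; rewrite -(gmor_src (ext_mor (eo_ext (descend Y)))).
    by rewrite [ext_mor _ _]sgE.
  - move=> w; rewrite -(gmor_tgt (ext_mor (eo_ext (descend Y)))).
    by rewrite [ext_mor _ _]sgE.
  - by move=> w; rewrite [ext_mor _ _]sgE fh.
have c2 : ext_iso (restr (p := p' \o nw) fp' (eo_ext (descend Y'))) (restr fP' (eo_ext (descend Y'))).
  apply: (@restr_conj R X B0 M' W B (f \o q') (p' \o nw) P' _ fp' fP' (eo_ext (descend Y')) sg') => //.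
  - exact: smooth_fp_fst.
  - move=> w; rewrite -(gmor_src (ext_mor (eo_ext (descend Y')))).
    by rewrite [ext_mor _ _]sgE'.
  - move=> w; rewrite -(gmor_tgt (ext_mor (eo_ext (descend Y')))).
    by rewrite [ext_mor _ _]sgE'.
  - by move=> w; rewrite [ext_mor _ _]sgE' fh.
(* Restricted along [nw], the given isomorphism joins the two inner links [p \o nw] and
   [p' \o nw]. *)
have s1 := restr_comp hE fh (c := p \o nw) (fun=> erefl) fp (eo_ext (descend Y)) snw.
have s2 := restr_comp hE' fh (c := p' \o nw) (fun=> erefl) fp' (eo_ext (descend Y')) snw.
apply: ext_iso_trans c1 (ext_iso_trans _ c2).
exact: ext_iso_trans (ext_iso_sym s1) (ext_iso_trans (restr_iso fh i) s2).
Qed.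

End Left.

(** * Transport of extensions along an isomorphism of groupoids over [T] *)

Section Transport.
Variables (R : realType) (X : crossedModule R).
Variables (T : diffType R) (B1 B2 : groupoid T) (theta : gmor B1 B2).
Hypotheses (h2 : lie_groupoid B2) (dtheta : diffeo theta).
Implicit Types Y : ext_over X B1.

Definition transport Y : ext_over X B2 :=
  ExtOver (push_ext (pullback_mor (@eo_q _ _ _ _ Y) theta) (eo_ext Y)).

Lemma transport_extension Y : extension_over Y -> extension_over (transport Y).
Proof.
move=> [mM sq xE]; split=> //; apply: push_extension => //.
  exact: pullback_mor_diffeo.
exact: lieg_arr (lie_pullback h2 mM sq).
Qed.

Lemma transport_restr Y (N : diffType R) (p : N -> eo_base Y) (h : N -> T)
    (hE : forall n, h n = eo_q (p n)) :
  ext_iso (push_ext (pullback_mor h theta) (restr hE (eo_ext Y)))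
          (restr (q := @eo_q _ _ _ _ (transport Y)) hE (eo_ext (transport Y))).
Proof.
exists (gmor_id _), id; split=> //.
- by split; [exact: diffeo_id|move=> r; exact: pb_eq].
- by split=> //; exact: diffeo_id.
- by move=> r x k e e'; apply: pbe_eq => //=; congr ext_ract; exact: lact_congr.
- by move=> x g; exact: pb_eq.
Qed.

Lemma transport_morita Y Y' :
  morita_equivalent (transport Y) (transport Y') <-> morita_equivalent Y Y'.
Proof.
split=> -[N [p [p' [h [hE [hE' [mN sp sp' i]]]]]]]; exists N, p, p', h, hE, hE'; split=> //.
  have inj := diffeo_inj (pullback_mor_diffeo h dtheta).
  apply: (push_ext_iso_inj inj); apply: ext_iso_trans (transport_restr hE) _.
  exact: ext_iso_trans i (ext_iso_sym (transport_restr hE')).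
apply: ext_iso_trans (ext_iso_sym (transport_restr hE)) _.
by apply: ext_iso_trans _ (transport_restr hE'); exact: push_ext_iso.
Qed.

End Transport.

Lemma transport_surj (R : realType) (X : crossedModule R)
    (T : diffType R) (B1 B2 : groupoid T) (theta : gmor B1 B2) :
  lie_groupoid B1 -> diffeo theta -> forall Z : ext_over X B2, extension_over Z ->
  exists2 Y, extension_over Y & morita_equivalent (transport theta Y) Z.
Proof.
(* Transport along the inverse [eta] and then along [theta] changes only the projection, by a
   composite equal to the identity. *)
move=> h1 dtheta Z hZ; have [eta [deta tK eK]] := gmor_inverse dtheta.
exists (transport eta Z); first exact: transport_extension.
have mM := eo_manifold hZ.
have := @iso_morita R X _ B2 (eo_base Z) (@eo_q _ _ _ _ Z)
  (eo_ext (transport theta (transport eta Z))) (eo_ext Z) mM.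
have -> : ExtOver (eo_ext Z) = Z by case: (Z).
apply; exists (gmor_id _), id; split=> //.
- split; first exact: diffeo_id.
  by move=> r; apply: pb_eq => //=; rewrite eK.
- by split=> //; exact: diffeo_id.
by move=> r x k e e'; congr ext_ract; exact: lact_congr.
Qed.

(** Totality provides choice functions in both directions; single-valuedness makes them mutually
    inverse and identifies [rho] with the graph of the first. *)
Lemma correspondence_bijective (A A' : Type) (rho : A -> A' -> Prop) :
  (forall a, exists a', rho a a') -> (forall a', exists a, rho a a') ->
  (forall a a1' a2', rho a a1' -> rho a a2' -> a1' = a2') ->
  (forall a1 a2 a', rho a1 a' -> rho a2 a' -> a1 = a2) ->
  exists F : A -> A', bijective F /\ forall a a', F a = a' <-> rho a a'.
Proof.
move=> t t' u u'.
pose F a := sval (cid (t a)); pose K a' := sval (cid (t' a')).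
have FP a : rho a (F a) := svalP (cid (t a)).
have KP a' : rho (K a') a' := svalP (cid (t' a')).
exists F; split.
  by exists K => [a|a']; [exact: u' (KP _) (FP _)|exact: u (FP _) (KP _)].
by move=> a a'; split=> [<-|]; [exact: FP|exact: u (FP a)].
Qed.

Theorem theorem1p4p14 (R : realType) (X : crossedModule R)
    (B0 B0' : diffType R) (B : groupoid B0) (B' : groupoid B0')
    (hB : lie_groupoid B) (hB' : lie_groupoid B') (m : morita B B') :
  exists F : gerbe X B -> gerbe X B',
    bijective F /\
    forall (c : gerbe X B) (c' : gerbe X B'),
      F c = c' <-> induced_correspondence m c c'.
Proof.
have mT := mor_manifold m; have sf := mor_f_subm m; have sg := mor_g_subm m.
have hBf := lie_pullback hB mT sf; have hBg := lie_pullback hB' mT sg.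
have dPhi := mor_iso_diffeo m.
(* Extensions [Z] over [B[f]] are sent by [L] to extensions over [B] and by [L'] to extensions over
   [B']. Both maps preserve and reflect Morita equivalence and are onto up to it. *)
pose L Z := descend (f := @mor_f _ _ _ _ _ m) (X := X) (B := B) Z.
pose L' Z := descend (f := @mor_g _ _ _ _ _ m) (X := X) (B := B') (transport (mor_iso m) Z).
have xL Z : extension_over Z -> extension_over (L Z) by exact: descend_extension.
have xL' Z : extension_over Z -> extension_over (L' Z).
  by move=> hZ; apply: descend_extension => //; exact: transport_extension.
have LE Z Z' : extension_over Z -> extension_over Z' ->
    morita_equivalent (L Z) (L Z') <-> morita_equivalent Z Z'.
  move=> hZ hZ'; split; first exact: descend_reflect.
  exact: descend_morita.
have LE' Z Z' : extension_over Z -> extension_over Z' ->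
    morita_equivalent (L' Z) (L' Z') <-> morita_equivalent Z Z'.
  move=> hZ hZ'; split=> [|ZZ']; last by apply/descend_morita/transport_morita.
  move=> /(descend_reflect hB' sg (transport_extension hBg dPhi hZ)
    (transport_extension hBg dPhi hZ')).
  by rewrite transport_morita.
(* [ext_on_left] and [ext_on_right] are [L] and [L'] by conversion, so the correspondence is the
   relation spanned by these two maps. *)
have rhoE (c : gerbe X B) (c' : gerbe X B') : induced_correspondence m c c' <->
    exists2 Z, extension_over Z &
      sval c = gerbe_class (L Z) /\ sval c' = gerbe_class (L' Z).
  split; first by move=> [M [q [E [mM sq hE cE c'E]]]]; exists (ExtOver E).
  by move=> [[M q E] [/= mM sq hE] [cE c'E]]; exists M, q, E; split.
apply: correspondence_bijective.
- move=> c; have [Y hY cE] := svalP c.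
  have [Z hZ LZ] := descend_surj hB mT sf hY.
  exists (exist _ (gerbe_class (L' Z)) (ex_intro2 _ _ (L' Z) (xL' _ hZ) erefl)).
  apply/rhoE; exists Z => //; split=> //.
  by rewrite cE; apply/gerbe_class_eq => //; [exact: xL|exact: morita_sym].
- move=> c'; have [Y hY cE] := svalP c'.
  (* Surjectivity on this side takes two steps: to an extension [Z'] over [B'[g]], then back along
     the isomorphism with [B[f]]. *)
  have [Z' hZ' LZ'] := descend_surj hB' mT sg hY.
  have [Z hZ ZZ'] := transport_surj hBf dPhi hZ'.
  exists (exist _ (gerbe_class (L Z)) (ex_intro2 _ _ (L Z) (xL _ hZ) erefl)).
  apply/rhoE; exists Z => //; split=> //.
  rewrite cE; apply/gerbe_class_eq => //; first exact: xL'.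
  apply: morita_sym; apply: morita_trans LZ' => //; first exact: xL'.
    exact: descend_extension.
  exact: descend_morita.
(* Two choices [Z], [Z'] for the same [c] are equivalent since [L] reflects equivalence, and [L']
   preserves it; the last case exchanges the two roles. *)
- move=> c c1 c2 /rhoE[Z hZ [E E1]] /rhoE[Z' hZ' [E' E2]]; apply: sig_eq.
  rewrite E1 E2; apply/gerbe_class_eq; [exact: xL'|exact: xL'|].
  apply/LE' => //; apply/LE => //; apply/gerbe_class_eq; [exact: xL|exact: xL|].
  by rewrite -E.
- move=> c1 c2 c /rhoE[Z hZ [E1 E]] /rhoE[Z' hZ' [E2 E']]; apply: sig_eq.
  rewrite E1 E2; apply/gerbe_class_eq; [exact: xL|exact: xL|].
  apply/LE => //; apply/LE' => //; apply/gerbe_class_eq; [exact: xL'|exact: xL'|].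
  by rewrite -E.
Qed.
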